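(* Let $m\ge3$ be an integer, let $0<\gamma\le1$, and let $(H_n)_{n\ge1}$ be the intertwining sequence of any two Leja sequences for the closed unit disk $\overline{\mathbb{D}}$, with $\Omega_N=\{H_1,\ldots,H_N\}$. Then for all $f\in Lip^m_\gamma(\overline{\mathbb{D}}^2)$, $$\sup_{(z,w)\in\overline{\mathbb{D}}^2}\big|f(z,w)-L_{\Omega_N}[f](z,w)\big|=O\left(\frac{1}{N^{(m+\gamma-3)/2}}\right),$$ where $L_{\Omega_N}[f]$ is the bidimensional Lagrange interpolation polynomial of $f$ with respect to $\Omega_N$.
   Context: $\mathbb{D}=\{z\in\mathbb{C}:|z|<1\}$, $\overline{\mathbb{D}}$ its closure, $\mathbb{T}^2$ the unit torus in $\mathbb{C}^2$. Leja sequence: a Leja sequence for a compact set $K\subset\mathbb{C}$ is a sequence $(\eta_i)_{i\ge 0}$ of elements of $K$ with $\eta_0\in\partial K$ and, for all $k\ge 1$, $\sup_{z\in K}\prod_{i=0}^{k-1}|z-\eta_i|=\prod_{i=0}^{k-1}|\eta_k-\eta_i|$. Numeration: $n\mapsto(k(n),l(n))$, $n\ge1$, enumerates $\mathbb{N}^2$ ($\mathbb{N}=\{0,1,\ldots\}$) by increasing $k+l$, and for equal $k+l$ by increasing $k$: $(0,0),(0,1),(1,0),(0,2),(1,1),(2,0),\ldots$ The intertwining sequence of complex sequences $(\eta_i)_{i\ge0},(\theta_j)_{j\ge0}$ is $H_n=(\eta_{k(n)},\theta_{l(n)})\in\mathbb{C}^2$, $n\ge1$. Put $e_n(z,w)=z^{k(n)}w^{l(n)}$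 and $\mathcal{P}_N=\mathrm{span}\{e_1,\ldots,e_N\}$. Lagrange polynomial: when both sequences have pairwise distinct elements (which holds for Leja sequences of the unit disk), $\Omega_N$ is unisolvent for $\mathcal{P}_N$, and for a function $f$ defined on $\Omega_N$, $L_{\Omega_N}[f]$ is the unique element of $\mathcal{P}_N$ that coincides with $f$ on $\Omega_N$. Lipschitz spaces: for $0<\gamma\le1$, $Lip_\gamma(\overline{\mathbb{D}}^2)$ is the set of functions $g$ holomorphic on $\mathbb{D}^2$ and continuous on $\overline{\mathbb{D}}^2$ for which there is $L>0$ with $|g(e^{ih}\zeta)-g(\zeta)|\le L|h|^\gamma$ for all $\zeta\in\mathbb{T}^2$ and $h\in\mathbb{R}$ (where $e^{ih}\zeta=(e^{ih}\zeta_1,e^{ih}\zeta_2)$). For $m\in\mathbb{N}$, $Lip^m_\gamma(\overline{\mathbb{D}}^2)$ is the set of $f$ holomorphic on $\mathbb{D}^2$ and continuous on $\overline{\mathbb{D}}^2$ such that $\frac{\partial^{\alpha}f}{\partial z^{\alpha}}\in Lip_\gamma(\overline{\mathbb{D}}^2)$ for every multi-index $\alpha$ with $|\alpha|=\alpha_1+\alpha_2\le m$. *)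

(* Defs.v *)
From HB Require Import structures.
From mathcomp Require Export all_boot all_order all_algebra.
From mathcomp Require Export all_classical all_reals all_analysis.
From mathcomp Require Export complex.

Set Implicit Arguments.
Unset Strict Implicit.
Unset Printing Implicit Defensive.

Export Order.TTheory GRing.Theory Num.Theory numFieldNormedType.Exports.

Local Open Scope classical_set_scope.
Local Open Scope ring_scope.
Local Open Scope complex_scope.

(* The topology and the R[i]-normed-module structure are found on the regular
   module R[i]^o, not on the bare type R[i]; so [differentiable] and ['D_v]
   below mean complex differentiability and complex derivatives. *)
Notation Cplx R := ((R[i])^o).
Notation Cplx2 R := (Cplx R * Cplx R)%type.

(* The modulus as an element of R: the norm `|z| lives in R[i], and
   `|z| = (cmod z)%:C. *)
Notation cmod := ComplexField.Normc.normc.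

Definition disk (R : realType) : set (Cplx R) := [set z | cmod z < 1].
Arguments disk R : clear implicits.

Definition cdisk (R : realType) : set (Cplx R) := closure (disk R).
Arguments cdisk R : clear implicits.

Definition bidisk (R : realType) : set (Cplx2 R) := disk R `*` disk R.
Arguments bidisk R : clear implicits.

Definition cbidisk (R : realType) : set (Cplx2 R) := cdisk R `*` cdisk R.
Arguments cbidisk R : clear implicits.

Definition torus2 (R : realType) : set (Cplx2 R) :=
  [set p | cmod p.1 = 1 /\ cmod p.2 = 1].
Arguments torus2 R : clear implicits.

(* Meant for compact K: the real-valued [sup] is then a genuine supremum. *)
Definition leja (R : realType) (K : set (Cplx R)) (eta : nat -> Cplx R) : Prop :=
  [/\ forall i, K (eta i),
      (closure K `\` interior K) (eta 0%N)
    & forall k, (1 <= k)%N ->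
        sup [set \prod_(i < k) cmod (z - eta i) | z in K]
        = \prod_(i < k) cmod (eta k - eta i)].

(* Successor for the order by increasing k + l, then increasing k. *)
Definition next_index (kl : nat * nat) : nat * nat :=
  if kl.2 is l.+1 then (kl.1.+1, l) else (0%N, kl.1.+1).

(* Indices start at n = 1; the value at n = 0 is never used. *)
Definition numeration (n : nat) : nat * nat := iter n.-1 next_index (0%N, 0%N).

Definition intertwining (R : realType) (eta theta : nat -> Cplx R) (n : nat)
    : Cplx2 R :=
  (eta (numeration n).1, theta (numeration n).2).

Definition nodes (R : realType) (H : nat -> Cplx2 R) (N : nat) : set (Cplx2 R) :=
  [set H n | n in [set n | (1 <= n <= N)%N]].

Definition monomial (R : realType) (n : nat) (p : Cplx2 R) : Cplx R :=
  p.1 ^+ (numeration n).1 * p.2 ^+ (numeration n).2.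

Definition poly_space (R : realType) (N : nat) : set (Cplx2 R -> Cplx R) :=
  [set P | exists c : nat -> Cplx R,
     P = fun p => \sum_(1 <= n < N.+1) c n * monomial n p].

(* The element of [poly_space N] that coincides with f on Omega. The default
   value 0 of [xget] is only taken when no such element exists. *)
Definition lagrange (R : realType) (N : nat) (Omega : set (Cplx2 R))
    (f : Cplx2 R -> Cplx R) : Cplx2 R -> Cplx R :=
  xget (fun=> 0)
    [set P | poly_space N P /\ (forall p, Omega p -> P p = f p)].

Definition holomorphic_on (R : realType) (U : set (Cplx2 R))
    (f : Cplx2 R -> Cplx R) : Prop :=
  forall p, U p -> differentiable f p.

Definition partial_z (R : realType) (f : Cplx2 R -> Cplx R) : Cplx2 R -> Cplx R :=
  'D_((1, 0) : Cplx2 R) f.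

Definition partial_w (R : realType) (f : Cplx2 R -> Cplx R) : Cplx2 R -> Cplx R :=
  'D_((0, 1) : Cplx2 R) f.

Definition partial (R : realType) (a b : nat) (f : Cplx2 R -> Cplx R)
    : Cplx2 R -> Cplx R :=
  iter a (@partial_z R) (iter b (@partial_w R) f).

Definition expi (R : realType) (h : R) : Cplx R := cos h +i* sin h.

(* Functions on the closed bidisk are represented by total functions, whose
   values outside the closed bidisk are irrelevant. *)
Definition Lip (R : realType) (gamma : R) (g : Cplx2 R -> Cplx R) : Prop :=
  [/\ holomorphic_on (bidisk R) g,
      {within cbidisk R, continuous g}
    & exists2 L : R, 0 < L &
        forall p, torus2 R p -> forall h : R,
          cmod (g (expi h * p.1, expi h * p.2) - g p) <= L * `|h| `^ gamma].

(* A partial derivative is only defined on the open bidisk: to be in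
   [Lip gamma] means to extend to a function of the closed bidisk that is. *)
Definition Lipm (R : realType) (m : nat) (gamma : R) (f : Cplx2 R -> Cplx R)
    : Prop :=
  [/\ holomorphic_on (bidisk R) f,
      {within cbidisk R, continuous f}
    & forall a b : nat, (a + b <= m)%N ->
        exists2 g, Lip gamma g & {in bidisk R, partial a b f =1 g}].

(* Extended-real valued, so that it is +oo when f - g is unbounded on A. *)
Definition sup_dist (R : realType) (A : set (Cplx2 R)) (f g : Cplx2 R -> Cplx R)
    : \bar R :=
  ereal_sup [set (cmod (f p - g p))%:E | p in A].

(* Main.v *)
(** The error operator of Lagrange interpolation is bounded by 1 + Lambda_N, where
    Lambda_N is the Lebesgue constant, times the distance from f to P_N.

    One variable.  A Leja sequence of the disk satisfies eta_(2i+1) = - eta_(2i),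
    and (eta_(2i) ^ 2) is again a Leja sequence.  Pairing the nodes x and - x, the sum
    S_k(z) of the squared moduli of the k fundamental polynomials at z obeys a
    recursion on binary digits that gives S_k <= 16 k, so the Lebesgue function
    is at most 4 k by Cauchy-Schwarz.

    Two variables.  If j(k) counts the l with (k, l) among the first N indices, then on
    P_N the interpolation operator is the sum over k of
    (I_(k+1) - I_k) (x) I_(j(k)), which gives Lambda_N = O(N ^ (3/2)).

    Approximation.  No integral is used: averages over roots of unity, which are exact
    on polynomials, replace contour integrals.  A discrete Cauchy formula
    approximates f and its partial derivatives by polynomials on smaller bidisks;
    applied along the circles u |-> (u z, u w), the operator 1 - (1 - K) ^ (m + 1),
    where K is convolution with a Jackson kernel, turns such a polynomial into one
    of total degree at most 2 s - 2 at distance O(s ^ - (m + gamma)). *)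

Require Import Defs.
From mathcomp Require Import ring lra zify polyrcf.

Set Implicit Arguments.
Unset Strict Implicit.
Unset Printing Implicit Defensive.

Local Open Scope classical_set_scope.
Local Open Scope ring_scope.
Local Open Scope complex_scope.

(** * Leja sequences of the unit disk *)

(** With d complete diagonals among the first N indices, N is comparable to d^2 / 2, so a Lebesgue
    constant O(d^3) against an error O(d^-(m + gamma)) gives the exponent (m + gamma - 3) / 2.

    The Lipschitz condition only compares points of the torus that differ by a common rotation, so
    smoothness is available along the circles u |-> (u z, u w) alone. On such a circle the
    coefficient of u^k is the homogeneous part of degree k; a multiplier in u therefore acts by
    total degree, which is how the numeration orders monomials. The m-th circular derivative
    multiplies the coefficient of z^a w^b by (a + b)^m, a combination of products a^_s b^_t, that
    is, of z^s w^t times partial derivatives of order at most m.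

    Those derivatives live on the open bidisk and merely extend to the closed one. Estimates are
    thus made for polynomials close to f on a smaller bidisk, then dilated; the degree of such a
    polynomial is out of control, so no bound may depend on it. *)

Lemma cmodM (R : rcfType) (x y : R[i]) : cmod (x * y) = cmod x * cmod y.
Proof. exact: ComplexField.Normc.normcM. Qed.

Lemma cmodV (R : rcfType) (x : R[i]) : cmod x^-1 = (cmod x)^-1.
Proof. exact: ComplexField.Normc.normcV. Qed.

Lemma cmod0 (R : rcfType) : cmod (0 : R[i]) = 0.
Proof. exact: ComplexField.Normc.normc0. Qed.

Lemma cmod1 (R : rcfType) : cmod (1 : R[i]) = 1.
Proof. exact: ComplexField.Normc.normc1. Qed.

Lemma cmodN (R : rcfType) (x : R[i]) : cmod (- x) = cmod x.
Proof. exact: normcN. Qed.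

Lemma cmodD (R : rcfType) (x y : R[i]) : cmod (x + y) <= cmod x + cmod y.
Proof. exact: le_normcD. Qed.

Lemma cmod_ge0 (R : rcfType) (x : R[i]) : 0 <= cmod x.
Proof. by case: x => a b; exact: sqrtr_ge0. Qed.

Lemma cmod_eq0 (R : rcfType) (x : R[i]) : (cmod x == 0) = (x == 0).
Proof.
by apply/eqP/eqP => [/ComplexField.Normc.eq0_normc|->]; rewrite ?cmod0.
Qed.

Lemma cmodB (R : rcfType) (x y : R[i]) : cmod (x - y) <= cmod x + cmod y.
Proof. by rewrite (le_trans (cmodD _ _)) ?cmodN. Qed.

Lemma cmod_distC (R : rcfType) (x y : R[i]) : cmod (x - y) = cmod (y - x).
Proof. by rewrite -cmodN opprB. Qed.

Lemma cmodX (R : rcfType) (x : R[i]) n : cmod (x ^+ n) = cmod x ^+ n.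
Proof. by elim: n => [|n IH]; rewrite ?expr0 ?cmod1// !exprS cmodM IH. Qed.

Lemma cmod_prod (R : rcfType) (I : Type) (r : seq I) (P : pred I)
    (F : I -> R[i]) :
  cmod (\prod_(i <- r | P i) F i) = \prod_(i <- r | P i) cmod (F i).
Proof.
elim/big_rec2: _ => [|i u v _ <-]; [exact: cmod1 | exact: cmodM].
Qed.

Lemma cmod_sum (R : rcfType) (I : Type) (r : seq I) (P : pred I)
    (F : I -> R[i]) :
  cmod (\sum_(i <- r | P i) F i) <= \sum_(i <- r | P i) cmod (F i).
Proof.
elim/big_rec2: _ => [|i u v _ huv]; first by rewrite cmod0.
by rewrite (le_trans (cmodD _ _))// lerD2l.
Qed.

Lemma cmod_sqr (R : rcfType) (x : R[i]) : cmod x ^+ 2 = complex.Re x ^+ 2 + complex.Im x ^+ 2.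
Proof. by case: x => a b /=; rewrite sqr_sqrtr// addr_ge0 ?sqr_ge0. Qed.

Lemma cmod_real (R : rcfType) (x : R) : cmod x%:C = `|x|.
Proof. by rewrite /= expr0n /= addr0 sqrtr_sqr. Qed.

Lemma cmod_nat (R : rcfType) n : cmod (n%:R : R[i]) = n%:R.
Proof.
have -> : (n%:R : R[i]) = (n%:R : R)%:C by rewrite rmorph_nat.
by rewrite cmod_real ger0_norm.
Qed.

Lemma cmod_parallelogram (R : rcfType) (x y : R[i]) :
  cmod (x + y) ^+ 2 + cmod (x - y) ^+ 2 = (cmod x ^+ 2 + cmod y ^+ 2) *+ 2.
Proof. by rewrite !cmod_sqr; case: x => a b; case: y => c d /=; ring. Qed.

(** * Fundamental polynomials, and Leja sequences as sequences of antipodal pairs *)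

Definition fund_lagrange (F : fieldType) (eta : nat -> F) (k i : nat) (z : F) :=
  \prod_(j < k) (if j == i :> nat then 1 else (z - eta j) / (eta i - eta j)).

Lemma fund_lagrangeS (F : fieldType) (eta : nat -> F) k i z : (i < k)%N ->
  fund_lagrange eta k.+1 i z
  = fund_lagrange eta k i z * ((z - eta k) / (eta i - eta k)).
Proof. by move=> ik; rewrite /fund_lagrange big_ord_recr /= gtn_eqF. Qed.

Lemma fund_lagrange_last (F : fieldType) (eta : nat -> F) k z :
  fund_lagrange eta k.+1 k z = \prod_(j < k) ((z - eta j) / (eta k - eta j)).
Proof.
rewrite /fund_lagrange big_ord_recr /= eqxx mulr1.
by apply: eq_bigr => j _; rewrite ltn_eqF.
Qed.

Lemma fund_lagrangeD1 (F : fieldType) (eta : nat -> F) k (i : 'I_k) z :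
  fund_lagrange eta k i z
  = \prod_(j < k | j != i) ((z - eta j) / (eta i - eta j)).
Proof.
rewrite /fund_lagrange (bigD1 i)//= eqxx mul1r; apply: eq_bigr => j ji.
by rewrite val_eqE (negbTE ji).
Qed.

Definition lebesgue_sqr (R : rcfType) (eta : nat -> R[i]) (k : nat) (z : R[i]) :=
  \sum_(i < k) cmod (fund_lagrange eta k i z) ^+ 2.

(** The truncation at [K] serves the induction: passing to [sqr_subseq eta] requires antipodal pairs
    only below the current length, where they are already known. *)
Definition leja_upto (R : rcfType) (K : nat) (eta : nat -> R[i]) :=
  [/\ cmod (eta 0%N) = 1,
      forall i, (i <= K)%N -> cmod (eta i) <= 1
    & forall k, (0 < k <= K)%N -> forall z, cmod z <= 1 ->
        \prod_(i < k) cmod (z - eta i) <= \prod_(i < k) cmod (eta k - eta i)].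

Definition unit_leja (R : rcfType) (eta : nat -> R[i]) :=
  forall K, leja_upto K eta.

Definition sqr_subseq (F : fieldType) (eta : nat -> F) (i : nat) : F :=
  eta i.*2 ^+ 2.

Lemma big_ord_double (T : Type) (idx : T) (op : Monoid.law idx)
    (F : nat -> T) n :
  \big[op/idx]_(i < n.*2) F i
  = \big[op/idx]_(i < n) op (F i.*2) (F i.*2.+1).
Proof.
elim: n => [|n IH]; first by rewrite !big_ord0.
by rewrite doubleS !big_ord_recr /= IH Monoid.mulmA.
Qed.

Lemma leja_upto_le (R : rcfType) (K K' : nat) (eta : nat -> R[i]) :
  (K' <= K)%N -> leja_upto K eta -> leja_upto K' eta.
Proof.
move=> KK [h0 h1 hK]; split => // [i iK|k /andP[k0 kK] z hz].
  by apply: h1; apply: leq_trans KK.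
by apply: hK => //; rewrite k0 (leq_trans kK).
Qed.

Lemma prod_sqr_subseq (F : fieldType) (eta : nat -> F) k z :
  (forall i, (i < k)%N -> eta i.*2.+1 = - eta i.*2) ->
  \prod_(i < k.*2) (z - eta i) = \prod_(i < k) (z ^+ 2 - sqr_subseq eta i).
Proof.
move=> he; rewrite (big_ord_double _ (fun i => z - eta i)) /=.
by apply: eq_bigr => i _; rewrite he// opprK /sqr_subseq; ring.
Qed.

(** Every point of the disk is a square, and at a square root of [z] the product over antipodal
    pairs is the product at [z] over the squared nodes. *)
Lemma leja_upto_sqr (R : rcfType) (k : nat) (eta : nat -> R[i]) :
  (forall i, (i < k)%N -> eta i.*2.+1 = - eta i.*2) ->
  leja_upto k.*2 eta -> leja_upto k (sqr_subseq eta).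
Proof.
move=> he [h0 h1 hK]; split.
- by rewrite /sqr_subseq double0 cmodX h0 expr1n.
- move=> i ik; rewrite /sqr_subseq cmodX expr_le1 ?cmod_ge0//.
  by apply: h1; rewrite leq_double.
- move=> j /andP[j0 jk] z hz.
  have he' i : (i < j)%N -> eta i.*2.+1 = - eta i.*2.
    by move=> ij; apply: he; exact: leq_trans jk.
  rewrite -!cmod_prod -{1}[z]sqr_sqrtc -!(prod_sqr_subseq _ he') !cmod_prod.
  apply: hK; first by rewrite double_gt0 j0 leq_double.
  by rewrite -(@expr_le1 _ 2%N) ?cmod_ge0// -cmodX sqr_sqrtc.
Qed.

(** Both claims advance together. A node of even index is unimodular because its square is a node of
    the squared sequence, to which the induction applies; a node of odd index is shown to be the
    opposite of the preceding one. *)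
Lemma leja_upto_unit (R : rcfType) (K : nat) (eta : nat -> R[i]) :
  leja_upto K eta ->
  (forall i, (i <= K)%N -> cmod (eta i) = 1) /\
  (forall i, (i.*2.+1 <= K)%N -> eta i.*2.+1 = - eta i.*2).
Proof.
elim/ltn_ind: K eta => -[|K] IH eta hl.
  split=> // i; rewrite leqn0 => /eqP ->; by case: hl.
have [h1 h2] := IH K (ltnSn K) eta (leja_upto_le (leqnSn K) hl).
have [odK|evK] := boolP (odd K).
  have kE : K.+1 = (K.+1)./2.*2 by rewrite -[LHS]odd_double_half /= odK.
  set k := (K.+1)./2 in kE.
  have k0 : (0 < k)%N by rewrite -double_gt0 -kE.
  have he i : (i < k)%N -> eta i.*2.+1 = - eta i.*2.
    by move=> ik; apply: h2; rewrite -ltnS kE ltn_Sdouble.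
  have kK : (k < K.+1)%N by rewrite kE -addnn -addn1 leq_add2l.
  have hk : leja_upto k.*2 eta by rewrite -kE.
  have [hu _] := IH k kK _ (leja_upto_sqr he hk).
  split=> i.
    rewrite leq_eqVlt => /predU1P[->|]; last by rewrite ltnS => /h1.
    have := hu k (leqnn k); rewrite /sqr_subseq -kE cmodX => /eqP.
    by rewrite sqrp_eq1 ?cmod_ge0// => /eqP.
  by move=> hi; apply: he; rewrite -ltn_double -kE; apply: leq_trans hi _.
have kE : K = K./2.*2 by rewrite -[LHS]odd_double_half /= (negbTE evK).
set k := K./2 in kE.
have he i : (i < k)%N -> eta i.*2.+1 = - eta i.*2.
  by move=> ik; apply: h2; rewrite kE ltn_double.
have [e0 e1 eK] := hl.
set e := eta k.*2.
have he1 : cmod e = 1 by rewrite /e -kE; apply: h1.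
have hprod z : \prod_(i < K) cmod (z - eta i)
    = cmod (\prod_(i < k) (z ^+ 2 - sqr_subseq eta i)).
  by rewrite -cmod_prod kE prod_sqr_subseq.
(* P(z), the product of the |z - eta i| over i < K, is even and maximal at [e], with P(e) >= P(0) =
   1. Comparing [s] with [- e] gives 2 P(e) <= P(s) |s - e| <= P(e) |s - e|, hence |s - e| = 2. *)
have hs : eta K.+1 = - e.
  set s := eta K.+1.
  have s1 : cmod s <= 1 by exact: e1.
  have P0 z : 0 <= \prod_(i < K) cmod (z - eta i).
    by apply: prodr_ge0 => i _; exact: cmod_ge0.
  have Pe z : cmod z <= 1 ->
      \prod_(i < K) cmod (z - eta i) <= \prod_(i < K) cmod (e - eta i).
    move=> hz; case: (posnP K) => [->|K0]; first by rewrite !big_ord0.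
    by rewrite /e -kE; apply: eK; rewrite ?K0/=.
  have Pe1 : 1 <= \prod_(i < K) cmod (e - eta i).
    have := Pe 0; rewrite cmod0 => /(_ ler01); rewrite (eq_bigr (fun=> 1)).
      by rewrite big1_eq.
    by move=> i _; rewrite sub0r cmodN h1// ltnW.
  have := eK K.+1; rewrite leqnn => /(_ isT (- e)); rewrite cmodN he1.
  move=> /(_ (lexx _)); rewrite !big_ord_recr /= -/s.
  have -> : \prod_(i < K) cmod (- e - eta i) = \prod_(i < K) cmod (e - eta i).
    by rewrite !hprod sqrrN.
  have -> : eta K = e by rewrite /e -kE.
  have -> : cmod (- e - e) = 2.
    have -> : - e - e = - (e * 2%:R) by ring.
    by rewrite cmodN cmodM he1 mul1r cmod_nat.
  move=> hle.
  have se2 : cmod (s - e) <= 2.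
    by rewrite (le_trans (cmodB _ _))// he1 (lerD s1 (lexx 1)).
  have h2se : 2 <= cmod (s - e).
    have hb : \prod_(i < K) cmod (s - eta i) * cmod (s - e)
        <= \prod_(i < K) cmod (e - eta i) * cmod (s - e).
      by rewrite ler_wpM2r ?cmod_ge0// Pe.
    rewrite -(ler_pM2l (lt_le_trans ltr01 Pe1)); exact: le_trans hb.
  (* |s + e|^2 = 2 (|s|^2 + 1) - |s - e|^2 <= 4 - 4. *)
  have := cmod_parallelogram s e; rewrite he1 expr1n => hpar.
  apply/eqP; rewrite -addr_eq0 -cmod_eq0.
  have := cmod_ge0 (s + e); have := cmod_ge0 s; move: hpar h2se s1.
  move: (cmod (s + e)) (cmod (s - e)) (cmod s) => u v w hpar hv hw w0 u0.
  rewrite eq_le u0 andbT -(@ler_sqr _ u 0)// ?nnegrE// expr0n /=.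
  by nra.
split=> i.
  rewrite leq_eqVlt => /predU1P[->|]; last by rewrite ltnS => /h1.
  by rewrite hs cmodN.
rewrite leq_eqVlt => /predU1P[|]; last by rewrite ltnS => /h2.
move=> [iK]; rewrite iK hs /e; congr (- eta _).
by rewrite -kE -iK.
Qed.

Lemma unit_leja_norm (R : rcfType) (eta : nat -> R[i]) i :
  unit_leja eta -> cmod (eta i) = 1.
Proof. by move=> h; apply: (leja_upto_unit (h i)).1. Qed.

Lemma unit_leja_odd (R : rcfType) (eta : nat -> R[i]) i :
  unit_leja eta -> eta i.*2.+1 = - eta i.*2.
Proof. by move=> h; apply: (leja_upto_unit (h i.*2.+1)).2. Qed.

Lemma unit_leja_sqr (R : rcfType) (eta : nat -> R[i]) :
  unit_leja eta -> unit_leja (sqr_subseq eta).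
Proof.
by move=> h K; apply: leja_upto_sqr (h _) => i _; exact: unit_leja_odd.
Qed.

Lemma unit_leja_max (R : rcfType) (eta : nat -> R[i]) k z :
  unit_leja eta -> cmod z <= 1 ->
  \prod_(i < k) cmod (z - eta i) <= \prod_(i < k) cmod (eta k - eta i).
Proof.
move=> h hz; case: (posnP k) => [->|k0]; first by rewrite !big_ord0.
by case: (h k) => _ _; apply; rewrite ?k0 /=.
Qed.

(** The maximal product is at least its value 1 at the origin, so none of its factors vanishes. *)
Lemma unit_leja_neq (R : rcfType) (eta : nat -> R[i]) k i :
  unit_leja eta -> (i < k)%N -> eta k != eta i.
Proof.
move=> h ik; apply/eqP => hE.
have := @unit_leja_max _ eta k 0 h; rewrite cmod0 => /(_ ler01).
rewrite (eq_bigr (fun=> 1)); last by move=> j _; rewrite sub0r cmodN unit_leja_norm.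
by rewrite big1_eq (bigD1 (Ordinal ik))//= hE subrr cmod0 mul0r ler10.
Qed.

Lemma unit_leja_inj (R : rcfType) (eta : nat -> R[i]) :
  unit_leja eta -> injective eta.
Proof.
move=> h i j hij; case: (ltngtP i j) => // ij.
- by have := unit_leja_neq h ij; rewrite hij eqxx.
- by have := unit_leja_neq h ij; rewrite hij eqxx.
Qed.

(** This is the Leja condition itself, divided by the product at [eta k]. *)
Lemma fund_lagrange_last_le1 (R : rcfType) (eta : nat -> R[i]) k z :
  unit_leja eta -> cmod z <= 1 -> cmod (fund_lagrange eta k.+1 k z) <= 1.
Proof.
move=> h hz; rewrite fund_lagrange_last cmod_prod.
under eq_bigr do rewrite cmodM cmodV.
rewrite prodf_div ler_pdivrMr ?mul1r; first exact: unit_leja_max.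
apply: prodr_gt0 => j _; rewrite lt_def cmod_ge0 cmod_eq0 subr_eq0 andbT.
exact: unit_leja_neq.
Qed.

Lemma fund_lagrange_nodes (R : rcfType) (eta : nat -> R[i]) k i j :
  unit_leja eta -> (i < k)%N -> (j < k)%N ->
  fund_lagrange eta k i (eta j) = (i == j)%:R.
Proof.
move=> h ik jk; rewrite /fund_lagrange; case: eqVneq => [->|ij].
  rewrite big1// => l _; case: eqVneq => // lj.
  by rewrite divff// subr_eq0 (inj_eq (unit_leja_inj h)) eq_sym.
rewrite (bigD1 (Ordinal jk))//= eq_sym (negbTE ij) subrr mul0r mul0r//.
Qed.

(** The other pairs contribute a function of z^2; the remaining factor is the two-point fundamental
    polynomial of x among x and - x. *)
Lemma fund_lagrange_double (F : numFieldType) (eta : nat -> F) k i z :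
  (i < k)%N -> (forall j, (j < k)%N -> eta j.*2.+1 = - eta j.*2) ->
  fund_lagrange eta k.*2 i.*2 z
  = fund_lagrange (sqr_subseq eta) k i (z ^+ 2)
    * ((z + eta i.*2) / (eta i.*2 *+ 2)).
Proof.
move=> ik he; rewrite /fund_lagrange.
rewrite (big_ord_double _ (fun j => if j == i.*2 then 1 else
  (z - eta j) / (eta i.*2 - eta j))) /=.
rewrite (bigD1 (Ordinal ik))//= [in RHS](bigD1 (Ordinal ik))//= !eqxx mul1r.
rewrite gtn_eqF// mul1r he// opprK -mulr2n mulrC; congr (_ * _).
apply: eq_bigr => j; rewrite -val_eqE /= => ji.
rewrite (negbTE ji) (inj_eq double_inj) (negbTE ji).
have -> : (j.*2.+1 == i.*2) = false.
  by apply/negP => /eqP /(congr1 odd); rewrite /= !odd_double.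
rewrite he// opprK /sqr_subseq mulf_div; congr (_ / _); ring.
Qed.

Lemma fund_lagrange_doubleS (F : numFieldType) (eta : nat -> F) k i z :
  (i < k)%N -> (forall j, (j < k)%N -> eta j.*2.+1 = - eta j.*2) ->
  fund_lagrange eta k.*2 i.*2.+1 z
  = fund_lagrange (sqr_subseq eta) k i (z ^+ 2)
    * ((z - eta i.*2) / - (eta i.*2 *+ 2)).
Proof.
move=> ik he; rewrite /fund_lagrange.
rewrite (big_ord_double _ (fun j => if j == i.*2.+1 then 1 else
  (z - eta j) / (eta i.*2.+1 - eta j))) /=.
rewrite (bigD1 (Ordinal ik))//= [in RHS](bigD1 (Ordinal ik))//= !eqxx mul1r.
rewrite ltn_eqF// mulr1 he// -opprD -mulr2n mulrC; congr (_ * _).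
apply: eq_bigr => j; rewrite -val_eqE /= => ji.
rewrite (negbTE ji) eqSS (inj_eq double_inj) (negbTE ji).
have -> : (j.*2 == i.*2.+1) = false.
  by apply/negP => /eqP /(congr1 odd); rewrite /= !odd_double.
rewrite he// !opprK /sqr_subseq mulf_div; congr (_ / _); ring.
Qed.

(** * Linear growth of the Lebesgue function *)

(** By the parallelogram law, the two-point factors of a pair have squared moduli with sum (|z|^2 +
    1) / 2 <= 1. *)
Lemma lebesgue_sqr_double (R : rcfType) (eta : nat -> R[i]) k z :
  unit_leja eta -> cmod z <= 1 ->
  lebesgue_sqr eta k.*2 z <= lebesgue_sqr (sqr_subseq eta) k (z ^+ 2).
Proof.
move=> h hz; rewrite /lebesgue_sqr.
rewrite (big_ord_double _ (fun j => cmod (fund_lagrange eta k.*2 j z) ^+ 2)) /=.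
apply: ler_sum => i _.
have he j : (j < k)%N -> eta j.*2.+1 = - eta j.*2.
  by move=> _; exact: unit_leja_odd.
have hx := unit_leja_norm i.*2 h.
rewrite fund_lagrange_double// fund_lagrange_doubleS//.
rewrite -mulr_natr !(cmodM, cmodV, cmodN) hx cmod_nat mul1r.
have := cmod_parallelogram z (eta i.*2); rewrite hx.
move: (cmod (z + _)) (cmod (z - _)) (cmod (fund_lagrange _ _ _ _)) => u v l.
move=> hp; have : cmod z ^+ 2 <= 1 by rewrite expr_le1 ?cmod_ge0.
move: hp; move: (cmod z) => a hp ha.
have -> : (l * (u / 2%:R)) ^+ 2 + (l * (v / 2%:R)) ^+ 2
          = l ^+ 2 * ((u ^+ 2 + v ^+ 2) / 4%:R) by field.
by rewrite ler_piMr ?sqr_ge0// hp; lra.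
Qed.

(* With x = eta (2i), e = eta (2k), the two fundamental polynomials at x and -x
   are c * A and c * B, where A = (z+x)(x+e), B = (z-x)(x-e). *)
Lemma fund_lagrange_pair (R : rcfType) (eta : nat -> R[i]) k i z :
  unit_leja eta -> (i < k)%N ->
  cmod (fund_lagrange eta k.*2.+1 i.*2 z) ^+ 2
  + cmod (fund_lagrange eta k.*2.+1 i.*2.+1 z) ^+ 2
  = (cmod (fund_lagrange (sqr_subseq eta) k.+1 i (z ^+ 2)) ^+ 2
     + cmod (z * fund_lagrange (sqr_subseq eta) k.+1 i (z ^+ 2)
       + (z - eta k.*2)
         * (fund_lagrange (sqr_subseq eta) k.+1 k (z ^+ 2)
            * fund_lagrange (sqr_subseq eta) k i (eta k.*2 ^+ 2))) ^+ 2) / 2.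
Proof.
move=> h ik.
have he j : (j < k)%N -> eta j.*2.+1 = - eta j.*2.
  by move=> _; exact: unit_leja_odd.
have hx := unit_leja_norm i.*2 h.
have x0 : eta i.*2 != 0 by rewrite -cmod_eq0 hx oner_eq0.
have h' := unit_leja_sqr h.
have d0 : sqr_subseq eta i - sqr_subseq eta k != 0.
  by rewrite subr_eq0 eq_sym unit_leja_neq.
rewrite !(@fund_lagrangeS _ _ _ i) // (@fund_lagrangeS _ _ _ i.*2) ?ltn_double//.
rewrite (@fund_lagrangeS _ _ _ i.*2.+1) ?ltn_Sdouble//.
rewrite fund_lagrange_double// fund_lagrange_doubleS// he//.
set l := fund_lagrange _ k i (z ^+ 2).
(* The differences [y k - y j] with [j != i] cancel between the two polynomials. *)
have -> : fund_lagrange (sqr_subseq eta) k.+1 k (z ^+ 2) *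
   fund_lagrange (sqr_subseq eta) k i (eta k.*2 ^+ 2)
   = l * ((z ^+ 2 - eta i.*2 ^+ 2) / (eta k.*2 ^+ 2 - eta i.*2 ^+ 2)).
  rewrite fund_lagrange_last /l !(fund_lagrangeD1 _ (Ordinal ik)).
  rewrite (bigD1 (Ordinal ik))//= -mulrA mulrC -/(sqr_subseq eta i).
  rewrite -/(sqr_subseq eta k); congr (_ * _).
  rewrite -big_split /=; apply: eq_bigr => j ji.
  have : sqr_subseq eta k - sqr_subseq eta j != 0.
    by rewrite subr_eq0 unit_leja_neq.
  have : sqr_subseq eta i - sqr_subseq eta j != 0.
    by rewrite subr_eq0 (inj_eq (unit_leja_inj h')) eq_sym.
  move: (sqr_subseq eta) => y; rewrite -/(y k) => n1 n2; field.
  by rewrite n1 n2.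
rewrite /sqr_subseq in d0 *.
move: l (eta i.*2) (eta k.*2) x0 hx d0 => l x e x0 hx d0.
have xe : x - e != 0.
  by apply: contraNneq d0 => xe; rewrite subr_sqr xe mul0r.
have xe' : x + e != 0.
  by apply: contraNneq d0 => xe'; rewrite subr_sqr xe' mulr0.
set c := l * (z - e) / (x *+ 2 * (x ^+ 2 - e ^+ 2)).
have -> : l * ((z + x) / (x *+ 2)) * ((z - e) / (x - e))
    = c * ((z + x) * (x + e)).
  by rewrite /c; field; rewrite x0 d0 xe.
have -> : l * ((z - x) / - (x *+ 2)) * ((z - e) / (- x - e))
    = c * ((z - x) * (x - e)).
  by rewrite /c -opprD; field; rewrite x0 d0 xe'.
set A := _ * (x + e); set B := _ * (x - e).
(* [c * A + c * B] and, up to the unimodular [x^-1], [c * A - c * B] are the two quantities on the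
   right-hand side. *)
have := cmod_parallelogram (c * A) (c * B).
have -> : c * A + c * B = l * ((z ^+ 2 - e ^+ 2) / (x ^+ 2 - e ^+ 2)).
  by rewrite /c /A /B; field; rewrite x0 d0.
have -> : c * A - c * B = (z * (l * ((z ^+ 2 - e ^+ 2) / (x ^+ 2 - e ^+ 2)))
  + (z - e) * (l * ((z ^+ 2 - x ^+ 2) / (e ^+ 2 - x ^+ 2)))) * x^-1.
  rewrite /c /A /B; field; rewrite x0 d0 -opprB oppr_eq0 d0 //.
rewrite (cmodM _ x^-1) cmodV hx invr1 mulr1 => ->.
by rewrite -mulr_natr mulfK// pnatr_eq0.
Qed.

Lemma lebesgue_sqr_doubleS (R : rcfType) (eta : nat -> R[i]) k z :
  unit_leja eta -> cmod z <= 1 ->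
  lebesgue_sqr eta k.*2.+1 z
  = \sum_(i < k) (cmod (fund_lagrange (sqr_subseq eta) k.+1 i (z ^+ 2)) ^+ 2
     + cmod (z * fund_lagrange (sqr_subseq eta) k.+1 i (z ^+ 2)
       + (z - eta k.*2)
         * (fund_lagrange (sqr_subseq eta) k.+1 k (z ^+ 2)
            * fund_lagrange (sqr_subseq eta) k i (eta k.*2 ^+ 2))) ^+ 2) / 2
    + cmod (fund_lagrange eta k.*2.+1 k.*2 z) ^+ 2.
Proof.
move=> h hz; rewrite /lebesgue_sqr big_ord_recr /=; congr (_ + _).
rewrite (big_ord_double _
  (fun j => cmod (fund_lagrange eta k.*2.+1 j z) ^+ 2)) /=.
by apply: eq_bigr => i _; rewrite fund_lagrange_pair.
Qed.

(** A sharper bound at the next node, which the recursion at a general point calls for. If k = 2j +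
    1, that node is - e with e = [eta j.*2]: its square is a node of the squared sequence, so only
    the terms with factor - 2 e survive. They give S_k <= 2 S_j + 1, where S_j is again taken at the
    next node. *)
Lemma lebesgue_sqr_next (R : rcfType) (eta : nat -> R[i]) k :
  unit_leja eta -> lebesgue_sqr eta k (eta k) <= k%:R.
Proof.
elim/ltn_ind: k eta => k IH eta h.
case: (posnP k) => [->|k0]; first by rewrite /lebesgue_sqr big_ord0.
have h' := unit_leja_sqr h.
rewrite -(odd_double_half k).
have hk : (k./2 < k)%N by rewrite -divn2 ltn_Pdiv.
case: (odd k); rewrite ?add0n ?add1n.
- have hz : cmod (eta (k./2).*2.+1) <= 1 by rewrite unit_leja_norm.
  rewrite lebesgue_sqr_doubleS// -[leRHS]natr1.
  apply: lerD; last first.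
    by rewrite expr_le1 ?cmod_ge0// fund_lagrange_last_le1.
  rewrite unit_leja_odd// sqrrN.
  have -> : (k./2).*2%:R = 2 * (k./2)%:R :> R.
    by rewrite -muln2 natrM mulrC.
  apply: le_trans (_ : 2 * lebesgue_sqr (sqr_subseq eta) k./2 (sqr_subseq eta k./2) <= _).
    rewrite /lebesgue_sqr mulr_sumr; apply: ler_sum => i _.
    rewrite (@fund_lagrange_nodes _ (sqr_subseq eta) k./2.+1 i k./2)// ?ltnS ?(ltnW (ltn_ord i))//.
    rewrite (@fund_lagrange_nodes _ (sqr_subseq eta) k./2.+1 k./2 k./2)//.
    rewrite eqxx mul1r ltn_eqF// mulr0 add0r cmod0 expr0n add0r.
    rewrite -opprD mulNr cmodN cmodM exprMn -mulr2n -(mulr_natr (eta _)) cmodM.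
    rewrite unit_leja_norm// cmod_nat mul1r -/(sqr_subseq eta k./2).
    by rewrite le_eqVlt; apply/orP; left; apply/eqP; field.
  by rewrite ler_pM2l// IH.
- have hz : cmod (eta (k./2).*2) <= 1 by rewrite unit_leja_norm.
  apply: le_trans (lebesgue_sqr_double _ h hz) _.
  rewrite -/(sqr_subseq eta k./2); apply: le_trans (IH _ hk _ h') _.
  by rewrite ler_nat -addnn leq_addr.
Qed.

(** Even lengths are halved at no cost. For k = 2j + 1 with j >= 1 the recursion costs (5 / 4) 16 (j
    + 1) + 6 j + 1, at most 16 (2 j + 1). The case k = 1 is apart because j + 1 < k fails there. *)
Lemma lebesgue_sqr_le (R : rcfType) (eta : nat -> R[i]) k z :
  unit_leja eta -> cmod z <= 1 -> lebesgue_sqr eta k z <= 16 * k%:R.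
Proof.
elim/ltn_ind: k eta z => k IH eta z h hz.
case: (posnP k) => [->|k0]; first by rewrite /lebesgue_sqr big_ord0 mulr0.
have [->|k1] := eqVneq k 1%N.
  rewrite /lebesgue_sqr big_ord1 /fund_lagrange big_ord1 eqxx cmod1; lra.
have h' := unit_leja_sqr h.
have hz2 : cmod (z ^+ 2) <= 1 by rewrite cmodX expr_le1 ?cmod_ge0.
have hk : (k./2 < k)%N by rewrite -divn2 ltn_Pdiv.
have kE := odd_double_half k.
case: (odd k) kE; rewrite ?add0n ?add1n => kE; last first.
  rewrite -{1}kE; apply: le_trans (lebesgue_sqr_double _ h hz) _.
  apply: le_trans (IH _ hk _ _ h' hz2) _.
  by rewrite ler_pM2l// ler_nat ltnW.
have hk0 : (0 < k./2)%N by rewrite half_gt0 ltn_neqAle eq_sym k1.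
have hk1 : (k./2.+1 < k)%N by rewrite -{2}kE; lia.
rewrite -kE lebesgue_sqr_doubleS//.
set T := cmod (fund_lagrange eta _ _ z).
have T1 : T ^+ 2 <= 1 by rewrite expr_le1 ?cmod_ge0 ?fund_lagrange_last_le1.
have B := IH _ hk1 _ _ h' hz2.
have A : lebesgue_sqr (sqr_subseq eta) k./2 (eta k./2.*2 ^+ 2) <= (k./2)%:R.
  exact: lebesgue_sqr_next.
have tau1 := fund_lagrange_last_le1 k./2 h' hz2.
have he := unit_leja_norm k./2.*2 h.
(* As |z - e| <= 2 and the last polynomial is at most 1 in modulus, each pair is at most (w^2 + (w +
   2 v)^2) / 2, and 4 w v <= w^2 / 2 + 8 v^2 yields the weights 5 / 4 and 6. *)
apply: le_trans
  (_ : \sum_(i < k./2) (cmod (fund_lagrange (sqr_subseq eta) k./2.+1 i (z ^+ 2)) ^+ 2 * (5 / 4)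
     + cmod (fund_lagrange (sqr_subseq eta) k./2 i (eta k./2.*2 ^+ 2)) ^+ 2 * 6)
     + 1 <= _).
  apply: lerD => //; apply: ler_sum => i _.
  set b := fund_lagrange _ _ i _; set t := fund_lagrange _ _ _ _ in tau1 *.
  set a := fund_lagrange _ _ i _.
  have hu : cmod (z * b + (z - eta k./2.*2) * (t * a)) <= cmod b + 2 * cmod a.
    apply: le_trans (cmodD _ _) _; rewrite !cmodM; apply: lerD.
      by rewrite ler_piMl ?cmod_ge0.
    rewrite mulrA ler_wpM2r ?cmod_ge0// -[leRHS]mulr1.
    apply: ler_pM; rewrite ?cmod_ge0// (le_trans (cmodB _ _))// he.
    by rewrite -[leRHS]/(1 + 1) lerD2r.
  have := cmod_ge0 b; have := cmod_ge0 a; move: hu.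
  have := cmod_ge0 (z * b + (z - eta k./2.*2) * (t * a)).
  move: (cmod (_ + _)) (cmod a) (cmod b) => u v w u0 huv v0 w0.
  have : u ^+ 2 <= (w + 2 * v) ^+ 2.
    by rewrite ler_sqr ?nnegrE// addr_ge0// mulr_ge0.
  have := sqr_ge0 (w / 2 - 2 * v); rewrite !expr2; lra.
rewrite big_split /= -!mulr_suml.
have B' : \sum_(i < k./2) cmod (fund_lagrange (sqr_subseq eta) k./2.+1 i (z ^+ 2)) ^+ 2
   <= 16 * (k./2.+1)%:R.
  by apply: le_trans B; rewrite [leRHS]big_ord_recr /= lerDl sqr_ge0.
rewrite -natr1 in B'.
have -> : (k./2).*2.+1%:R = (k./2)%:R * 2 + 1 :> R by rewrite -natr1 -muln2 natrM.
rewrite /lebesgue_sqr in A; have := ler1n R k./2; rewrite hk0; lra.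
Qed.

Definition lebesgue_fun (R : rcfType) (eta : nat -> R[i]) (k : nat) (z : R[i]) :=
  \sum_(i < k) cmod (fund_lagrange eta k i z).

Lemma lebesgue_fun_le (R : rcfType) (eta : nat -> R[i]) k z :
  unit_leja eta -> cmod z <= 1 -> lebesgue_fun eta k z <= 4 * k%:R.
Proof.
(* Cauchy-Schwarz in termwise form: x <= x^2 / 8 + 2, with equality at the root mean square 4, so
   the total is 2 k + 2 k. *)
move=> h hz; apply: le_trans
  (_ : \sum_(i < k) (cmod (fund_lagrange eta k i z) ^+ 2 / 8 + 2) <= _).
  apply: ler_sum => i _; have := sqr_ge0 (cmod (fund_lagrange eta k i z) - 4).
  rewrite !expr2; lra.
rewrite big_split /= sumr_const card_ord -mulr_suml -mulr_natr.
have := lebesgue_sqr_le k h hz; rewrite /lebesgue_sqr; lra.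
Qed.

Lemma fund_lagrange_poly (F : fieldType) (eta : nat -> F) k i : (i < k)%N ->
  exists2 p : {poly F}, (size p <= k)%N & forall z, fund_lagrange eta k i z = p.[z].
Proof.
move=> ik; pose i' := Ordinal ik.
exists (\prod_(j < k | j != i') ((eta i - eta j)^-1 *: ('X - (eta j)%:P))).
  apply: leq_trans (size_prod_leq _ _) _.
  rewrite (eq_bigl (mem (predC1 i'))) // cardC1 card_ord.
  apply: (@leq_trans ((k.-1 * 2).+1 - k.-1)); last by lia.
  rewrite leq_sub2r// ltnS -[in leqRHS](card_ord k) -(cardC1 i').
  rewrite -sum_nat_const; apply: leq_sum => j _.
  by apply: leq_trans (size_scale_leq _ _) _; rewrite size_XsubC.
move=> z; rewrite (fund_lagrangeD1 _ i') horner_prod; apply: eq_bigr => j _.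
by rewrite !hornerE mulrC.
Qed.

Lemma fund_lagrange_reproduce (R : rcfType) (eta : nat -> R[i]) k a z :
  unit_leja eta -> (a < k)%N ->
  \sum_(i < k) fund_lagrange eta k i z * eta i ^+ a = z ^+ a.
Proof.
move=> h ak.
have /fin_all_exists2[p hs hp] (i : 'I_k) := fund_lagrange_poly eta (ltn_ord i).
pose q := \sum_(i < k) (eta i ^+ a) *: p i - 'X^a.
have qE y : q.[y] = \sum_(i < k) fund_lagrange eta k i y * eta i ^+ a - y ^+ a.
  rewrite /q !hornerE horner_sum; congr (_ - _); apply: eq_bigr => i _.
  by rewrite !hornerE mulrC hp.
apply/eqP; rewrite -subr_eq0 -qE; suff -> : q = 0 by rewrite horner0.
apply: (@roots_geq_poly_eq0 _ q [seq eta i | i <- iota 0 k]).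
- apply/allP => x /mapP[j]; rewrite mem_iota /= => jk ->.
  rewrite /root qE (bigD1 (Ordinal jk))//= fund_lagrange_nodes// eqxx mul1r.
  rewrite big1 ?addr0 ?subrr// => i ij; have {}ij : i != j :> nat by [].
  by rewrite fund_lagrange_nodes// (negbTE ij) mul0r.
- by rewrite map_inj_uniq ?iota_uniq//; exact: unit_leja_inj.
- rewrite size_map size_iota (leq_trans (size_polyD _ _))// geq_max.
  rewrite size_polyN size_polyXn ak andbT.
  apply: leq_trans (size_sum _ _ _) _; apply/bigmax_leqP => i _.
  exact: leq_trans (size_scale_leq _ _) (hs _).
Qed.

(** * Bidimensional interpolation *)

(** The inverse of [numeration]: ['C((k + l).+1, 2)] pairs lie on earlier diagonals, [k] precede on
    the same one, and indices start at 1. *)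
Definition rank (k l : nat) : nat := ('C((k + l).+1, 2) + k).+1.

Lemma rank_next p : rank (next_index p).1 (next_index p).2 = (rank p.1 p.2).+1.
Proof.
case: p => k [|l]; rewrite /rank /= ?addn0 ?add0n ?addnS ?addSn.
  by rewrite (binS _.+1 1) bin1; lia.
by [].
Qed.

Lemma numerationK n : (0 < n)%N -> rank (numeration n).1 (numeration n).2 = n.
Proof.
case: n => // n _; rewrite /numeration /=.
elim: n => [|n IH]; first by rewrite /rank.
by rewrite iterS rank_next IH.
Qed.

(** The last offset on diagonal [s] stays below the first on diagonal [t]: diagonals occupy disjoint
    intervals. *)
Lemma ltn_triangle s t : (s < t)%N -> ('C(s.+1, 2) + s < 'C(t.+1, 2))%N.
Proof.
elim: t => // t IH; rewrite ltnS leq_eqVlt => /predU1P[->|/IH].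
  by rewrite (binS t.+1 1) bin1; lia.
by rewrite (binS t.+1 1); lia.
Qed.

Lemma rank_inj k l k' l' : rank k l = rank k' l' -> k = k' /\ l = l'.
Proof.
rewrite /rank => -[]; case: (ltngtP (k + l) (k' + l')) => h.
- have := ltn_triangle h; lia.
- have := ltn_triangle h; lia.
- by rewrite h => /addnI kk; split => //; lia.
Qed.

Lemma rankK k l : numeration (rank k l) = (k, l).
Proof.
have := @numerationK (rank k l) isT.
by case: numeration => a b /= /rank_inj[-> ->].
Qed.

(** The first [N] indices thus form a lower set of pairs, on which both the Newton construction of
    the interpolant and its decomposition into rows rest. *)
Lemma leq_rank k l k' l' : (k <= k')%N -> (l <= l')%N ->
  (rank k l <= rank k' l')%N.
Proof.
move=> kk ll; rewrite /rank ltnS; case: (ltngtP (k + l) (k' + l')) => h.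
- have := ltn_triangle h; lia.
- lia.
- by rewrite h leq_add2l.
Qed.

Lemma leq_rank_degree d N k l :
  (N < 'C(d.+2, 2))%N -> (rank k l <= N)%N -> (k + l <= d)%N.
Proof.
move=> hN hr; rewrite leqNgt; apply/negP => hd; move: hN; apply/negP.
rewrite -leqNgt; apply: leq_trans hr; rewrite /rank.
apply: leq_trans (leqnSn _); apply: leq_trans (leq_addr _ _).
by apply: leq_bin2l; rewrite ltnS.
Qed.

Lemma degree_leq_rank d N k l :
  ('C(d.+1, 2) <= N)%N -> (k + l < d)%N -> (rank k l <= N)%N.
Proof. by move=> hN /ltn_triangle; rewrite /rank; lia. Qed.

Lemma sum_numeration (V : zmodType) (F : nat -> nat -> V) (K L N : nat) :
  (forall a b, F a b != 0 -> [/\ rank a b <= N, a < K & b < L]%N) ->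
  \sum_(a < K) \sum_(b < L) F a b
  = \sum_(1 <= n < N.+1) F (numeration n).1 (numeration n).2.
Proof.
move=> hF.
transitivity (\sum_(a < K) \sum_(b < L) \sum_(1 <= n < N.+1)
    (if n == rank a b then F a b else 0)).
  apply: eq_bigr => a _; apply: eq_bigr => b _.
  have [F0|/hF[hr _ _]] := eqVneq (F a b) 0.
    by rewrite big1// => n _; rewrite F0 if_same.
  rewrite -big_mkcond big_nat1_eq.
  by rewrite (_ : (1 <= rank a b < N.+1)%N)// ltnS hr.
under eq_bigr do rewrite exchange_big /=.
rewrite exchange_big /= [LHS]big_nat [RHS]big_nat; apply: eq_bigr => n /andP[n0 nN].
have [F0|hn] := eqVneq (F (numeration n).1 (numeration n).2) 0.
  rewrite F0 big1// => a _; rewrite big1// => b _; case: eqVneq => // nE.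
  by move: F0; rewrite nE rankK.
have [_ aK bL] := hF _ _ hn.
rewrite (bigD1 (Ordinal aK))//= (bigD1 (Ordinal bL))//= numerationK// eqxx.
rewrite !big1 ?addr0//.
- move=> a aa; rewrite big1// => b _; case: eqVneq => // nE.
  by case/eqP: aa; apply/val_inj; rewrite /= nE rankK.
- move=> b bb; case: eqVneq => // nE.
  by case/eqP: bb; apply/val_inj; rewrite /= nE rankK.
Qed.

Definition bipoly (R : realType) (n : nat) (c : nat -> nat -> R[i]) (z w : R[i])
    : R[i] :=
  \sum_(a < n) \sum_(b < n) c a b * (z ^+ a * w ^+ b).

Lemma bipoly_poly_space (R : realType) (n N : nat) (c : nat -> nat -> R[i]) :
  (forall a b, (a < n)%N -> (b < n)%N -> c a b != 0 -> (rank a b <= N)%N) ->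
  poly_space N (fun p : Cplx2 R => bipoly n c p.1 p.2).
Proof.
(* [c] is unconstrained outside the box, which the first [N] pairs may leave; hence the cut-off. *)
move=> hc; pose c' a b := if ((a < n) && (b < n))%N then c a b else 0.
exists (fun k => c' (numeration k).1 (numeration k).2); apply/funext => p.
rewrite -(@sum_numeration _ (fun a b => c' a b * (p.1 ^+ a * p.2 ^+ b)) n n).
  by apply: eq_bigr => a _; apply: eq_bigr => b _; rewrite /c' !ltn_ord.
move=> a b; rewrite /c'; case: ifP => [/andP[an bn]|]; last by rewrite mul0r eqxx.
by rewrite mulf_eq0 negb_or => /andP[/hc-/(_ an bn)].
Qed.

Lemma ex_rowlen N k : exists l, (N < rank k l)%N.
Proof.
by exists N; rewrite /rank ltnS (leq_trans _ (leq_addr _ _))// (binS _ 1) bin1; lia.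
Qed.

Definition rowlen N k := ex_minn (ex_rowlen N k).

Lemma ltn_rowlen N k l : (l < rowlen N k)%N = (rank k l <= N)%N.
Proof.
rewrite /rowlen; case: ex_minnP => j hj jmin; apply/idP/idP => [lj|].
  by rewrite leqNgt; apply/negP => /jmin; rewrite leqNgt lj.
by apply: contraTT; rewrite -leqNgt -ltnNge => jl; apply: leq_trans hj (leq_rank _ _).
Qed.

Definition numerated_poly (F : fieldType) (N : nat) (c : nat -> F) (z w : F) :=
  \sum_(1 <= n < N.+1) c n * (z ^+ (numeration n).1 * w ^+ (numeration n).2).

(** Test on z^a w^b. Rows k > a vanish, since I_(k+1) and I_k both reproduce z^a. Rows k <= a
    contain (k, b), the indices being a lower set, so they reproduce w^b, and the differences in z
    telescope to z^a. The conditional is there because I_k has no term for node k. *)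
Lemma numerated_poly_reproduce (R : rcfType) (eta theta : nat -> R[i]) d N
    (c : nat -> R[i]) z w :
  unit_leja eta -> unit_leja theta -> (N < 'C(d.+2, 2))%N ->
  numerated_poly N c z w =
  \sum_(k < d.+1) \sum_(i < k.+1) \sum_(l < rowlen N k)
    (fund_lagrange eta k.+1 i z
     - (if (i < k)%N then fund_lagrange eta k i z else 0))
    * fund_lagrange theta (rowlen N k) l w * numerated_poly N c (eta i) (theta l).
Proof.
move=> he ht hN; rewrite /numerated_poly.
under [RHS]eq_bigr do under eq_bigr do under eq_bigr do rewrite mulr_sumr.
under [RHS]eq_bigr do under eq_bigr do rewrite exchange_big /=.
under [RHS]eq_bigr do rewrite exchange_big /=.
rewrite exchange_big /= !big_nat; apply: eq_bigr => n /andP[n0 nN].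
set a := (numeration n).1; set b := (numeration n).2.
have hr : (rank a b <= N)%N by rewrite numerationK.
have ad : (a < d.+1)%N by rewrite ltnS (leq_trans _ (leq_rank_degree hN hr))// leq_addr.
pose S k := \sum_(i < k) fund_lagrange eta k i z * eta i ^+ a.
transitivity (\sum_(k < d.+1) c n * w ^+ b * (S k.+1 - S k)).
  rewrite -mulr_sumr -(big_mkord predT (fun k => S k.+1 - S k)) telescope_sumr//.
  rewrite /S fund_lagrange_reproduce// big_ord0 subr0; ring.
apply: eq_bigr => k _.
have -> : S k.+1 - S k = \sum_(i < k.+1) (fund_lagrange eta k.+1 i z
     - (if (i < k)%N then fund_lagrange eta k i z else 0)) * eta i ^+ a.
  under [RHS]eq_bigr do rewrite mulrBl.
  rewrite sumrB; congr (_ - _); rewrite big_ord_recr /= ltnn mul0r addr0.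
  by apply: eq_bigr => i _; rewrite ltn_ord.
rewrite mulr_sumr.
have [ka|ak] := leqP k a.
  apply: eq_bigr => i _; set D := _ - _.
  transitivity (c n * (D * eta i ^+ a) *
      \sum_(l < rowlen N k) fund_lagrange theta (rowlen N k) l w * theta l ^+ b).
    rewrite fund_lagrange_reproduce//; first by rewrite -!mulrA; congr (_ * _); ring.
    by rewrite ltn_rowlen; apply: leq_trans hr; exact: leq_rank.
  rewrite mulr_sumr; apply: eq_bigr => l _; ring.
have h0 : \sum_(i < k.+1) (fund_lagrange eta k.+1 i z
     - (if (i < k)%N then fund_lagrange eta k i z else 0)) * eta i ^+ a = 0.
  under eq_bigr do rewrite mulrBl.
  rewrite sumrB fund_lagrange_reproduce ?(ltnW ak)//; last by rewrite ltnS ltnW.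
  rewrite big_ord_recr /= ltnn mul0r addr0.
  under eq_bigr do rewrite ltn_ord.
  by rewrite fund_lagrange_reproduce// subrr.
rewrite -mulr_sumr h0 mulr0; symmetry.
transitivity (\sum_(i < k.+1) (fund_lagrange eta k.+1 i z
     - (if (i < k)%N then fund_lagrange eta k i z else 0)) * eta i ^+ a
   * \sum_(l < rowlen N k) fund_lagrange theta (rowlen N k) l w * (c n * theta l ^+ b)).
  apply: eq_bigr => i _; rewrite mulr_sumr; apply: eq_bigr => l _.
  by set D := (_ - _); ring.
by rewrite -mulr_suml h0 mul0r.
Qed.

Lemma poly_space_numerated (R : realType) N (P : Cplx2 R -> Cplx R) :
  poly_space N P -> exists c : nat -> R[i], forall z w, P (z, w) = numerated_poly N c z w.
Proof. by case=> c ->; exists c. Qed.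

(** Each of the d + 1 rows costs at most 4 (k + 1) + 4 k <= 8 (d + 1) in [z] and 4 (d + 1) in
    [w]. *)
Lemma numerated_poly_bound (R : rcfType) (eta theta : nat -> R[i]) d N
    (c : nat -> R[i]) z w (M : R) :
  unit_leja eta -> unit_leja theta -> (N < 'C(d.+2, 2))%N -> 0 <= M ->
  cmod z <= 1 -> cmod w <= 1 ->
  (forall k l, (rank k l <= N)%N -> cmod (numerated_poly N c (eta k) (theta l)) <= M) ->
  cmod (numerated_poly N c z w) <= 32 * (d.+1)%:R ^+ 3 * M.
Proof.
move=> he ht hN M0 hz hw hM.
rewrite (numerated_poly_reproduce c z w he ht hN).
have hj k : (rowlen N k <= d.+1)%N.
  rewrite leqNgt ltn_rowlen; apply/negP => /(leq_rank_degree hN).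
  by rewrite addnS ltnNge leq_addl.
have -> : 32 * d.+1%:R ^+ 3 * M
    = \sum_(k < d.+1) (8 * d.+1%:R) * (4 * d.+1%:R) * M.
  by rewrite sumr_const card_ord -mulr_natr; ring.
apply: le_trans (cmod_sum _ _ _) _; apply: ler_sum => k _.
apply: le_trans (_ : (lebesgue_fun eta k.+1 z + lebesgue_fun eta k z)
  * lebesgue_fun theta (rowlen N k) w * M <= _); last first.
  have kd : k%:R <= d%:R :> R by rewrite ler_nat -ltnS.
  rewrite ler_wpM2r//; apply: ler_pM.
  - by rewrite addr_ge0// sumr_ge0// => *; rewrite cmod_ge0.
  - by rewrite sumr_ge0// => *; rewrite cmod_ge0.
  - have := lebesgue_fun_le k.+1 he hz; have := lebesgue_fun_le k he hz.
    by rewrite -!natr1; lra.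
  - apply: le_trans (lebesgue_fun_le _ ht hw) _.
    by rewrite ler_pM2l// ler_nat.
have -> : (lebesgue_fun eta k.+1 z + lebesgue_fun eta k z)
  * lebesgue_fun theta (rowlen N k) w * M
  = \sum_(i < k.+1) \sum_(l < rowlen N k)
     (cmod (fund_lagrange eta k.+1 i z)
      + cmod (if (i < k)%N then fund_lagrange eta k i z else 0))
     * cmod (fund_lagrange theta (rowlen N k) l w) * M.
  under [RHS]eq_bigr do rewrite -mulr_suml -mulr_sumr.
  rewrite -!mulr_suml big_split /=; congr ((_ + _) * _ * _).
  rewrite big_ord_recr /= ltnn cmod0 addr0.
  by apply: eq_bigr => i _; rewrite ltn_ord.
apply: le_trans (cmod_sum _ _ _) _; apply: ler_sum => i _.
apply: le_trans (cmod_sum _ _ _) _; apply: ler_sum => l _.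
rewrite !cmodM; apply: ler_pM; rewrite ?mulr_ge0 ?cmod_ge0//.
  by rewrite ler_wpM2r ?cmod_ge0// cmodB.
apply: hM; apply: leq_trans (_ : rank k l <= N)%N; last by rewrite -ltn_rowlen.
by apply: leq_rank => //; rewrite -ltnS.
Qed.

(** * Existence of the interpolant and comparison with any approximant *)

(** Newton's step: the product [nu] of the z - eta i, i < k, and w - theta j, j < l, vanishes at
    every earlier node, since an earlier index pair cannot dominate (k, l) in both coordinates, but
    not at the new node. *)
Lemma poly_space_interpolant (R : realType) (eta theta : nat -> R[i]) N
    (f : Cplx2 R -> Cplx R) :
  unit_leja eta -> unit_leja theta ->
  exists P, poly_space N P /\
    forall n, (1 <= n <= N)%N -> P (intertwining eta theta n) = f (intertwining eta theta n).
Proof.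
move=> he ht; elim: N => [|N [P [[c PE] hP]]].
  exists (fun=> 0); split; first by exists (fun=> 0); apply/funext => p; rewrite big_nil.
  by move=> [].
pose k := (numeration N.+1).1; pose l := (numeration N.+1).2.
pose p : {poly R[i]} := \prod_(i < k) ('X - (eta i)%:P).
pose q : {poly R[i]} := \prod_(j < l) ('X - (theta j)%:P).
have sp : size p = k.+1 by rewrite size_prod_XsubC /index_enum -enumT size_enum_ord.
have sq : size q = l.+1 by rewrite size_prod_XsubC /index_enum -enumT size_enum_ord.
pose n := maxn k.+1 l.+1.
pose nu (x : Cplx2 R) : Cplx R := p.[x.1] * q.[x.2].
have nuP : poly_space N.+1 nu.
  have -> : nu = fun x : Cplx2 R => bipoly n (fun a b => p`_a * q`_b) x.1 x.2.
    apply/funext => x; rewrite /nu /bipoly.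
    rewrite (@horner_coef_wide _ n p) ?sp ?leq_maxl//.
    rewrite (@horner_coef_wide _ n q) ?sq ?leq_maxr//.
    rewrite mulr_suml; apply: eq_bigr => a _.
    by rewrite mulr_sumr; apply: eq_bigr => b _; rewrite mulrACA.
  apply: bipoly_poly_space => a b _ _; rewrite mulf_eq0 negb_or => /andP[pa qb].
  rewrite -[N.+1]numerationK//; apply: leq_rank.
    by rewrite -/k -ltnS -sp ltnNge; apply: contraNN pa => /(nth_default 0) ->.
  by rewrite -/l -ltnS -sq ltnNge; apply: contraNN qb => /(nth_default 0) ->.
have nu_node m : (1 <= m <= N)%N -> nu (intertwining eta theta m) = 0.
  move=> /andP[m0 mN]; rewrite /nu /intertwining /=.
  have [kk|kk] := ltnP (numeration m).1 k.
    suff -> : p.[eta (numeration m).1] = 0 by rewrite mul0r.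
    by rewrite horner_prod (bigD1 (Ordinal kk))//= !hornerE subrr mul0r.
  have [ll|ll] := ltnP (numeration m).2 l.
    suff -> : q.[theta (numeration m).2] = 0 by rewrite mulr0.
    by rewrite horner_prod (bigD1 (Ordinal ll))//= !hornerE subrr mul0r.
  have := leq_rank kk ll; rewrite /k /l !numerationK// ltnNge.
  by rewrite mN.
have nu_last : nu (intertwining eta theta N.+1) != 0.
  rewrite /nu mulf_neq0// /intertwining /= -/k -/l.
    rewrite horner_prod prodf_seq_neq0; apply/allP => i _ /=; rewrite !hornerE subr_eq0.
    by rewrite unit_leja_neq.
  rewrite horner_prod prodf_seq_neq0; apply/allP => i _ /=; rewrite !hornerE subr_eq0.
  by rewrite unit_leja_neq.
have [c' nuE] := nuP.
pose s : Cplx R := (f (intertwining eta theta N.+1) - P (intertwining eta theta N.+1))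
   / nu (intertwining eta theta N.+1).
exists (fun x => P x + s * nu x); split.
  exists (fun m => (if (m <= N)%N then c m else 0) + s * c' m); apply/funext => x.
  rewrite PE nuE mulr_sumr.
  under [RHS]eq_bigr do rewrite mulrDl -mulrA.
  rewrite big_split /=; congr (_ + _).
  rewrite [RHS]big_nat_recr//= ltnn mul0r addr0 !big_nat; apply: eq_bigr => m.
  by rewrite ltnS => /andP[_ ->].
move=> m /andP[m0]; rewrite leq_eqVlt => /predU1P[->|mN].
  by rewrite /s divfK// addrC subrK.
by rewrite nu_node ?m0// mulr0 addr0 hP// m0.
Qed.

Lemma lagrange_spec (R : realType) (eta theta : nat -> R[i]) N
    (f : Cplx2 R -> Cplx R) :
  unit_leja eta -> unit_leja theta ->
  let L := lagrange N (nodes (intertwining eta theta) N) f in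
  poly_space N L /\
    forall k l, (rank k l <= N)%N -> L (eta k, theta l) = f (eta k, theta l).
Proof.
move=> he ht L.
have [P [hP PN]] := poly_space_interpolant N f he ht.
have [hL LN] : poly_space N L /\
    (forall p, nodes (intertwining eta theta) N p -> L p = f p).
  rewrite /L /lagrange; apply: (@xgetPex _ (fun=> 0) [set P | poly_space N P /\
   (forall p, nodes (intertwining eta theta) N p -> P p = f p)]).
  by exists P; split => // _ [n /= hn <-]; apply: PN.
split=> // k l hr; apply: LN; exists (rank k l) => //=.
by rewrite /intertwining rankK.
Qed.

(** [Q - L] lies in the polynomial space and equals [Q - f] at the nodes, so the Lebesgue bound
    applies to it. *)
Lemma lagrange_near_best (R : realType) (eta theta : nat -> R[i]) d N
    (f Q : Cplx2 R -> Cplx R) (e : R) z w :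
  unit_leja eta -> unit_leja theta -> (N < 'C(d.+2, 2))%N ->
  poly_space N Q ->
  (forall z w, cmod z <= 1 -> cmod w <= 1 -> cmod (f (z, w) - Q (z, w)) <= e) ->
  cmod z <= 1 -> cmod w <= 1 ->
  cmod (f (z, w) - lagrange N (nodes (intertwining eta theta) N) f (z, w))
  <= (1 + 32 * d.+1%:R ^+ 3) * e.
Proof.
move=> he ht hN hQ hfQ hz hw; set L := lagrange _ _ _.
have [hL LN] := lagrange_spec N f he ht; rewrite -/L in hL LN.
have [c cE] := poly_space_numerated hQ.
have [c' cE'] := poly_space_numerated hL.
have e0 : 0 <= e by apply: le_trans (hfQ 0 0 _ _); rewrite ?cmod0 ?cmod_ge0.
have -> : f (z, w) - L (z, w) = (f (z, w) - Q (z, w)) + (Q (z, w) - L (z, w)).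
  by rewrite addrA subrK.
apply: le_trans (cmodD _ _) _; rewrite mulrDl mul1r; apply: lerD; first exact: hfQ.
pose c'' n := c n - c' n.
have cB x y : Q (x, y) - L (x, y) = numerated_poly N c'' x y.
  rewrite cE cE' /numerated_poly -sumrB; apply: eq_bigr => n _.
  by rewrite /c'' mulrBl.
rewrite cB; apply: (numerated_poly_bound he ht hN) => // k l hr.
by rewrite -cB LN// cmod_distC hfQ ?unit_leja_norm.
Qed.

(** * Roots of unity *)

Lemma expiD (R : realType) (x y : R) : expi (x + y) = expi x * expi y :> R[i].
Proof. by rewrite /expi cosD sinD; simpc; congr (_ +i* _); rewrite addrC. Qed.

Lemma expi0 (R : realType) : expi (0 : R) = 1 :> R[i].
Proof. by rewrite /expi cos0 sin0. Qed.

Lemma expiMn (R : realType) (x : R) n : expi (n%:R * x) = (expi x : R[i]) ^+ n.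
Proof.
elim: n => [|n IH]; first by rewrite mul0r expi0.
by rewrite -natr1 mulrDl mul1r expiD IH exprSr.
Qed.

Lemma cmod_expi (R : realType) (x : R) : cmod (expi x) = 1.
Proof. by rewrite /expi /= cos2Dsin2 sqrtr1. Qed.

Lemma cmod_expi_subr1 (R : realType) (x : R) :
  cmod ((expi x : R[i]) - 1) = 2 * `|sin (x / 2)|.
Proof.
have hx : x = (x / 2) *+ 2 by rewrite -mulr_natr divfK.
apply: (pexpIrn (n := 2)) => //; rewrite ?nnegrE ?cmod_ge0 ?mulr_ge0//.
rewrite cmod_sqr exprMn real_normK ?num_real// /expi /=.
have hc : cos x = 1 - 2 * sin (x / 2) ^+ 2.
  by rewrite {1}hx cos_mulr2n cos2sin2 !mulr2n; ring.
have : cos x ^+ 2 + sin x ^+ 2 = 1 := cos2Dsin2 x.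
by rewrite subr0 hc => /(canRL (addKr _)) ->; ring.
Qed.

Lemma sin_mvt (R : realType) (x : R) : 0 <= x ->
  exists2 c, 0 <= c <= x & sin x = cos c * x.
Proof.
move=> x0; have [|c hc] := @MVT_segment R sin cos 0 x x0 (fun y _ => is_derive_sin y).
  by apply: continuous_subspaceT => y; exact: continuous_sin.
by rewrite sin0 !subr0 => E; exists c => //; move: hc; rewrite in_itv.
Qed.

Lemma norm_sin_le (R : realType) (x : R) : `|sin x| <= `|x|.
Proof.
wlog x0 : x / 0 <= x => [hw|].
  case: (leP 0 x) => [|/ltW x0]; first exact: hw.
  by rewrite -normrN -sinN -[leRHS]normrN; apply: hw; rewrite oppr_ge0.
have [c _ ->] := sin_mvt x0; rewrite normrM ler_piMl//; exact: cos_max.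
Qed.

Lemma cmod_expi_subr1_le (R : realType) (x : R) :
  cmod ((expi x : R[i]) - 1) <= `|x|.
Proof.
rewrite cmod_expi_subr1; have := norm_sin_le (x / 2).
by rewrite normrM (ger0_norm (_ : 0 <= 2^-1))//; lra.
Qed.

(** A weak Jordan inequality. The mean value theorem gives the slope cos 1 on [0, 1]; beyond 1 the
    sine increases while x <= pi / 2 < 2, which halves the slope. *)
Lemma sin_ge (R : realType) (x : R) : 0 <= x <= pi / 2 ->
  cos 1 / 2 * x <= sin x.
Proof.
move=> /andP[x0 xpi].
have k0 : 0 < cos (1 : R) by exact: cos1_gt0.
have pi2 := @pihalf_lt2 R; have pi1 := @pihalf_ge1 R.
have small (y : R) : 0 <= y <= 1 -> cos 1 * y <= sin y.
  move=> /andP[y0 y1]; have [c /andP[c0 cy] ->] := sin_mvt y0.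
  rewrite ler_wpM2r// leNgt ltr_cos -?leNgt ?in_itv /= ?c0 ?ler01 //=; move: pi1; lra.
have [x1|x1] := leP x 1.
  by apply: le_trans (small _ _); rewrite ?x0 ?x1//; nra.
have : sin 1 < sin x.
  by rewrite ltr_sin// in_itv /=; apply/andP; split; lra.
have := small 1; rewrite ler01 lexx => /(_ isT); nra.
Qed.

(** Trades the angle [h] of the Lipschitz condition for the chord |u - 1|: with |h| <= pi, [sin_ge]
    applies to |h| / 2. It also provides the polar coordinates behind the compactness of the
    disk. *)
Lemma expi_surj (R : realType) : exists2 C : R, 0 < C &
  forall u : R[i], cmod u = 1 ->
    exists2 h : R, u = expi h & `|h| <= C * cmod (u - 1).
Proof.
have k0 : 0 < cos (1 : R) by exact: cos1_gt0.
exists (2 / cos 1); first by rewrite divr_gt0.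
move=> u hu.
suff [h uE hh] : exists2 h : R, u = expi h & `|h| <= pi.
  exists h => //; rewrite uE cmod_expi_subr1.
  have -> : `|sin (h / 2)| = `|sin (`|h| / 2)|.
    by case: (ger0P h) => _; rewrite ?mulNr ?sinN ?normrN.
  have hs := @sin_ge R (`|h| / 2).
  have h2 : cos 1 / 2 * (`|h| / 2) <= `|sin (`|h| / 2)|.
    by apply: le_trans (hs _) (ler_norm _); apply/andP; split;
      [rewrite divr_ge0 | rewrite ler_pM2r].
  rewrite [leLHS](_ : _ = (2 / cos 1) * (2 * (cos 1 / 2 * (`|h| / 2)))); last first.
    by field; rewrite gt_eqF.
  by rewrite ler_pM2l ?divr_gt0 ?ltr0n// ler_pM2l ?ltr0n.
case: u hu => a b /= /(congr1 (fun x => x ^+ 2)).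
rewrite sqr_sqrtr ?addr_ge0 ?sqr_ge0// expr1n => hab.
have ha : -1 <= a <= 1.
  by have := sqr_ge0 b; apply: contraTT; rewrite negb_and -!ltNge => /orP[] h; nra.
have hc := acosK (_ : a \in `[(-1), 1]); rewrite in_itv /= in hc.
have hs : sin (acos a) = `|b|.
  by rewrite sin_acos// -sqrtr_sqr; congr Num.sqrt; lra.
case: (leP 0 b) => b0.
  exists (acos a); last by rewrite ger0_norm ?acos_ge0// acos_lepi.
  by rewrite /expi hc// hs ger0_norm.
exists (- acos a); last by rewrite normrN ger0_norm ?acos_ge0// acos_lepi.
by rewrite /expi cosN sinN hc// hs ltr0_norm// opprK.
Qed.

Definition unit_root (R : realType) (M : nat) : R[i] := expi (2 * pi / M%:R).
Arguments unit_root R M : clear implicits.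

Lemma unit_root_neq1 (R : realType) (M k : nat) : (0 < k < M)%N ->
  unit_root R M ^+ k != 1.
Proof.
move=> /andP[k0 kM]; rewrite /unit_root -expiMn -subr_eq0 -cmod_eq0.
rewrite cmod_expi_subr1 mulf_neq0// normr_eq0.
have M0 : 0 < M%:R :> R by rewrite ltr0n (leq_ltn_trans _ kM).
have -> : k%:R * (2 * pi / M%:R) / 2 = k%:R / M%:R * pi :> R.
  by field; rewrite gt_eqF.
rewrite gt_eqF//; apply: sin_gt0_pi; apply/andP; split.
  by rewrite mulr_gt0 ?pi_gt0// divr_gt0// ltr0n.
by rewrite gtr_pMl ?pi_gt0// ltr_pdivrMr// mul1r ltr_nat.
Qed.

Lemma unit_rootX (R : realType) (M : nat) : (0 < M)%N -> unit_root R M ^+ M = 1.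
Proof.
move=> M0; rewrite /unit_root -expiMn mulrC divfK ?pnatr_eq0 -?lt0n//.
by rewrite /expi mulrC mulr_natr cos2pi sin2pi.
Qed.

Lemma cmod_unit_root (R : realType) (M : nat) : cmod (unit_root R M) = 1.
Proof. exact: cmod_expi. Qed.

Lemma unit_root_neq0 (R : realType) (M : nat) : unit_root R M != 0.
Proof. by rewrite -cmod_eq0 cmod_unit_root oner_eq0. Qed.

(** Orthogonality of characters; [k] and [l] below [M] exclude aliasing. *)
Lemma sum_unit_root (R : realType) (M k l : nat) : (k < M)%N -> (l < M)%N ->
  \sum_(j < M) (unit_root R M ^+ j) ^+ k / (unit_root R M ^+ j) ^+ l
  = ((k == l)%:R * M%:R : R[i]).
Proof.
move=> kM lM; set w := unit_root R M.
have w0 : w != 0 := unit_root_neq0 R M.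
have [->|kl] := eqVneq k l.
  under eq_bigr do rewrite divff ?expf_neq0//.
  by rewrite sumr_const card_ord mul1r.
rewrite mul0r.
pose v := w ^+ k / w ^+ l.
under eq_bigr do rewrite -!exprM mulnC (mulnC _ l) !exprM -expr_div_n -/v.
have vM : v ^+ M = 1.
  by rewrite /v expr_div_n -!exprM mulnC (mulnC l) !exprM unit_rootX ?(leq_ltn_trans _ kM)// !expr1n divr1.
have v1 : v != 1.
  apply: contraNneq kl => /(congr1 ( *%R^~ (w ^+ l))); rewrite mul1r divfK ?expf_neq0//.
  wlog lk : k l kM lM {v vM} / (l <= k)%N => [hw|] E.
    by case/orP: (leq_total l k) => h; [|rewrite eq_sym]; apply: hw h _.
  move: E; rewrite -{1}(subnK lk) exprD => /(canRL (mulfK (expf_neq0 l w0))).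
  rewrite divff ?expf_neq0//.
  case: (posnP (k - l)%N) => [/eqP h _|h]; first by rewrite eqn_leq lk -subn_eq0 h.
  by move/eqP; rewrite (negbTE (unit_root_neq1 _ _))// h (leq_ltn_trans (leq_subr _ _) kM).
apply: (mulfI (_ : v - 1 != 0)); first by rewrite subr_eq0.
by rewrite -subrX1 vM subrr mulr0.
Qed.

(** * Polynomials on the unit disk *)

Lemma coef_mean (R : realType) (p : {poly R[i]}) (M k : nat) (x : R[i]) :
  (size p <= M)%N -> (k < M)%N -> x != 0 ->
  \sum_(j < M) p.[x * unit_root R M ^+ j] / (x * unit_root R M ^+ j) ^+ k
  = M%:R * p`_k.
Proof.
move=> sp kM x0; set w := unit_root R M.
transitivity (\sum_(l < M) p`_l * x ^+ l / x ^+ k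
  * \sum_(j < M) ((w ^+ j) ^+ l / (w ^+ j) ^+ k)).
  under eq_bigr do rewrite (horner_coef_wide _ sp) mulr_suml.
  rewrite exchange_big; apply: eq_bigr => l _; rewrite mulr_sumr.
  by apply: eq_bigr => j _; rewrite !exprMn mulf_div mulrA.
rewrite (bigD1 (Ordinal kM))//= sum_unit_root// eqxx mul1r.
rewrite big1 ?addr0; first by rewrite mulfK ?expf_neq0// mulrC.
move=> l lk; have {}lk : l != k :> nat by [].
by rewrite sum_unit_root// (negbTE lk) mul0r mulr0.
Qed.

Lemma cauchy_coef (R : realType) (p : {poly R[i]}) (k : nat) (r B : R) :
  0 < r -> (forall x, cmod x = r -> cmod p.[x] <= B) -> cmod p`_k * r ^+ k <= B.
Proof.
move=> r0 hB; pose M := (size p + k.+1)%N.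
have M0 : 0 < M%:R :> R by rewrite ltr0n /M addnS.
have hr : cmod r%:C = r by rewrite cmod_real gtr0_norm.
have hx j : cmod (r%:C * unit_root R M ^+ j) = r.
  by rewrite cmodM hr cmodX cmod_unit_root expr1n mulr1.
rewrite -(ler_pM2l M0) mulrA -[in M%:R * _](cmod_nat R M) -cmodM.
rewrite -(coef_mean (x := r%:C)) ?leq_addr//; last first.
- by rewrite -cmod_eq0 hr gt_eqF.
- by rewrite /M addnS ltnS leq_addl.
rewrite -ler_pdivlMr ?exprn_gt0//; apply: le_trans (cmod_sum _ _ _) _.
have -> : M%:R * B / r ^+ k = \sum_(j < M) B / r ^+ k.
  by rewrite sumr_const card_ord -mulrA mulr_natl.
apply: ler_sum => j _; rewrite cmodM cmodV cmodX hx.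
rewrite ler_wpM2r ?invr_ge0 ?exprn_ge0 ?(ltW r0)//; apply: hB; exact: hx.
Qed.

Lemma geometric_sum_le (R : realFieldType) (x : R) n : 0 <= x < 1 ->
  \sum_(k < n) x ^+ k <= (1 - x)^-1.
Proof.
move=> /andP[x0 x1]; have h : 0 < 1 - x by rewrite subr_gt0.
rewrite -(ler_pM2l h) divff ?gt_eqF//.
by rewrite -opprB mulNr -subrX1 opprB gerBl exprn_ge0.
Qed.

Lemma le_of_pow_le (R : realType) (a b C : R) : 0 <= a -> 0 <= b ->
  (forall n, a ^+ n <= C * b ^+ n) -> a <= b.
Proof.
move=> a0 b0 h; rewrite leNgt; apply/negP => ba.
have [b0'|bn0] := eqVneq b 0.
  by have := h 1%N; rewrite b0' !expr1 mulr0 leNgt -b0' ba.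
have bp : 0 < b by rewrite lt_def bn0.
pose t := a / b - 1; have t0 : 0 < t by rewrite subr_gt0 ltr_pdivlMr ?mul1r.
have bern n : 1 + n%:R * t <= (1 + t) ^+ n.
  elim: n => [|n IH]; first by rewrite mul0r addr0.
  rewrite exprS; apply: le_trans (ler_wpM2l _ IH); last lra.
  rewrite -natr1; have : 0 <= n%:R * t ^+ 2 by rewrite mulr_ge0// sqr_ge0.
  rewrite expr2; lra.
have hC n : n%:R * t <= C.
  have := h n; rewrite -ler_pdivrMr ?exprn_gt0// -expr_div_n.
  have -> : a / b = 1 + t by rewrite /t; ring.
  by have := bern n; lra.
have C0 : 0 <= C by have := hC 0%N; rewrite mul0r.
have := hC (Num.truncn (C / t)).+1; rewrite -ler_pdivlMr// leNgt.
by rewrite truncnS_gt.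
Qed.

(* Maximum principle by the power trick: apply the bound
   |p(z)| <= B / (1 - |z|/r), given by the coefficients, to p ^ n. *)
Lemma poly_max_principle (R : realType) (p : {poly R[i]}) (r B : R) z :
  (forall x, cmod x = r -> cmod p.[x] <= B) -> cmod z <= r -> cmod p.[z] <= B.
Proof.
move=> hB; rewrite le_eqVlt => /predU1P[|zr]; first exact: hB.
have r0 : 0 < r by rewrite (le_lt_trans (cmod_ge0 z)).
have B0 : 0 <= B.
  by apply: le_trans (hB r%:C _); rewrite ?cmod_ge0// cmod_real gtr0_norm.
apply: (@le_of_pow_le _ _ _ (1 - cmod z / r)^-1); rewrite ?cmod_ge0// => n.
have hn x : cmod x = r -> cmod (p ^+ n).[x] <= B ^+ n.
  by move=> /hB hx; rewrite horner_exp cmodX lerXn2r ?nnegrE ?cmod_ge0.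
rewrite -cmodX -horner_exp horner_coef; apply: le_trans (cmod_sum _ _ _) _.
apply: le_trans (_ : \sum_(k < size (p ^+ n)) (cmod z / r) ^+ k * B ^+ n <= _).
  apply: ler_sum => k _.
  have := cauchy_coef k r0 hn; rewrite -ler_pdivlMr ?exprn_gt0// => ha.
  rewrite cmodM cmodX expr_div_n mulrC -mulrA (mulrC _ (B ^+ n)).
  by rewrite ler_wpM2l ?exprn_ge0 ?cmod_ge0.
rewrite -mulr_suml ler_wpM2r ?exprn_ge0//; apply: geometric_sum_le.
by rewrite divr_ge0 ?cmod_ge0 ?ltW//= ltr_pdivrMr ?mul1r.
Qed.

(** As for Schwarz's lemma: the maximum principle applied to the quotient of p - p(0) by the
    variable, which is at most 2 B / r on the circle. *)
Lemma poly_schwarz (R : realType) (p : {poly R[i]}) (r B : R) h :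
  0 < r -> (forall x, cmod x <= r -> cmod p.[x] <= B) -> cmod h <= r ->
  cmod (p.[h] - p.[0]) <= 2 * B / r * cmod h.
Proof.
move=> r0 hB hr.
have /factor_theorem[q qE] : root (p - (p.[0])%:P) 0 by rewrite /root !hornerE subrr.
rewrite subr0 in qE.
have E x : p.[x] - p.[0] = q.[x] * x.
  by move/(congr1 (horner^~ x)): qE; rewrite !hornerE.
rewrite E cmodM ler_wpM2r ?cmod_ge0//.
apply: (@poly_max_principle _ q r) => // x xr.
rewrite ler_pdivlMr// -[in leLHS]xr -cmodM -E.
apply: le_trans (cmodB _ _) _.
by have := hB x; have := hB 0; rewrite xr cmod0 lexx ltW// => /(_ isT) + /(_ isT); lra.
Qed.

(** The real part of the values on the segment, taken against the conjugate of the increment [D], is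
    a real polynomial whose increment is |D|^2; the real mean value theorem then bounds |D|^2 by |D|
    B |u - v|. *)
Lemma poly_lipschitz (R : realType) (p : {poly R[i]}) (B : R) u v :
  (forall x, cmod x <= 1 -> cmod (p^`()).[x] <= B) -> cmod u <= 1 -> cmod v <= 1 ->
  cmod (p.[u] - p.[v]) <= B * cmod (u - v).
Proof.
move=> hB hu hv; set D := p.[u] - p.[v].
have [->|D0] := eqVneq D 0.
  by rewrite cmod0 mulr_ge0 ?cmod_ge0// (le_trans (cmod_ge0 _) (hB 0 _))// cmod0.
pose q : {poly R[i]} := (D^*)%C *: (p \Po (v%:P + (u - v) *: 'X)).
pose g : {poly R} := map_poly (@complex.Re R) q.
have ReD (x y : R[i]) : complex.Re (x + y) = complex.Re x + complex.Re y.
  by case: x; case: y.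
have ReMn (x : R[i]) n : complex.Re (x *+ n) = complex.Re x *+ n.
  by elim: n => // n IH; rewrite !mulrS ReD IH.
have gE (s : R) (P : {poly R[i]}) : (map_poly (@complex.Re R) P).[s] = complex.Re P.[s%:C].
  rewrite (@horner_coef_wide _ (size P) _ s (size_poly _ _)) (horner_coef P).
  rewrite (big_morph (@complex.Re R) ReD (erefl : complex.Re (0 : R[i]) = 0)).
  apply: eq_bigr => k _; rewrite coef_map_id0//.
  rewrite -rmorphXn /=; case: (P`_k) => a b /=; rewrite mulr0 subr0 //.
have [c /andP[c0 c1]] := poly_mvt g (@ltr01 R).
have -> : g^`() = map_poly (@complex.Re R) (q^`()).
  apply/polyP => k; rewrite coef_deriv !coef_map_id0// coef_deriv.
  by rewrite ReMn.
have qE (s : R[i]) : q.[s] = D^*%C * p.[v + (u - v) * s].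
  by rewrite /q hornerZ horner_comp !(hornerD, hornerC, hornerZ, hornerX).
have q'E (s : R[i]) : (q^`()).[s] = D^*%C * ((p^`()).[v + (u - v) * s] * (u - v)).
  rewrite /q derivZ deriv_comp derivD derivC derivZ derivX add0r.
  rewrite hornerZ hornerM horner_comp !(hornerD, hornerC, hornerZ, hornerX).
  by rewrite mulr1.
rewrite subr0 mulr1 !gE !qE q'E mulr1 mulr0 addr0 [v + (u - v)]addrC subrK.
set x := v + _ * _.
have hx : cmod x <= 1.
  have -> : x = c%:C * u + (1 - c)%:C * v by rewrite /x rmorphB rmorph1; ring.
  move: c0 c1; rewrite !bnd_simp => c0 c1.
  apply: le_trans (cmodD _ _) _; rewrite !cmodM !cmod_real.
  rewrite !ger0_norm ?subr_ge0//; have := cmod_ge0 u; have := cmod_ge0 v; nra.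
have ReB (y z : R[i]) : complex.Re y - complex.Re z = complex.Re (y - z).
  by case: y; case: z.
rewrite ReB -mulrBr -/D.
have -> : complex.Re (D^*%C * D) = cmod D ^+ 2.
  by rewrite cmod_sqr; case: (D) => a b /=; ring.
have Rele (y : R[i]) : complex.Re y <= cmod y.
  apply: le_trans (ler_norm _) _; rewrite -(@ler_sqr _ _ (cmod y)) ?nnegrE ?cmod_ge0//.
  by rewrite cmod_sqr real_normK ?num_real// lerDl sqr_ge0.
have Jc : cmod D^*%C = cmod D by case: (D) => a b /=; rewrite sqrrN.
move=> E; have := Rele (D^*%C * ((p^`()).[x] * (u - v))).
rewrite -E !cmodM Jc expr2 ler_pM2l ?lt_def ?cmod_eq0 ?D0 ?cmod_ge0//.
by move=> h; apply: le_trans h _; rewrite ler_wpM2r ?cmod_ge0 ?hB.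
Qed.

(** * Jackson kernels *)

(** A Fourier multiplier on circles. Convolutions and the circular derivative ([mu n = n]) both have
    this form, so they commute. *)
Definition coef_weight (R : rcfType) (mu : nat -> R) (p : {poly R[i]}) : {poly R[i]} :=
  \poly_(n < size p) ((mu n)%:C * p`_n).

Lemma coef_coef_weight (R : rcfType) (mu : nat -> R) (p : {poly R[i]}) n :
  (coef_weight mu p)`_n = (mu n)%:C * p`_n.
Proof.
rewrite coef_poly; case: ltnP => // h; by rewrite nth_default// mulr0.
Qed.

Lemma coef_weight_comp (R : rcfType) (mu nu : nat -> R) (p : {poly R[i]}) :
  coef_weight mu (coef_weight nu p) = coef_weight (fun n => mu n * nu n) p.
Proof. by apply/polyP => n; rewrite !coef_coef_weight rmorphM mulrA. Qed.

Lemma coef_weightB (R : rcfType) (mu nu : nat -> R) (p : {poly R[i]}) :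
  coef_weight (fun n => mu n - nu n) p = coef_weight mu p - coef_weight nu p.
Proof.
by apply/polyP => n; rewrite coefB !coef_coef_weight rmorphB mulrBl.
Qed.

Lemma coef_weight1 (R : rcfType) (p : {poly R[i]}) :
  coef_weight (fun=> 1) p = p.
Proof. by apply/polyP => n; rewrite !coef_coef_weight rmorph1 mul1r. Qed.

Lemma coef_weight_id (R : rcfType) (p : {poly R[i]}) :
  coef_weight (fun n => n%:R) p = 'X * p^`().
Proof.
apply/polyP => -[|n]; rewrite coef_coef_weight coefXM /=.
  by rewrite rmorph0 mul0r.
by rewrite coef_deriv rmorph_nat mulr_natl.
Qed.

(** The Fourier coefficients of |D(u)|^2 on the unit circle. *)
Definition autocorrelation (R : rcfType) (D : {poly R}) (n : nat) : R :=
  \sum_(a < size D) D`_a * D`_(a + n).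

Lemma conj_horner_unit (R : rcfType) (D : {poly R}) (u : R[i]) : cmod u = 1 ->
  ((map_poly (real_complex R) D).[u])^*%C = \sum_(b < size D) (D`_b)%:C / u ^+ b.
Proof.
move=> hu; have uJ : u^*%C = u^-1.
  apply: (mulfI (_ : u != 0)); first by rewrite -cmod_eq0 hu oner_eq0.
  rewrite divff -?cmod_eq0 ?hu ?oner_eq0//.
  have := cmod_sqr u; rewrite hu expr1n; case: (u) => a b /= h.
  by simpc; rewrite -!expr2 -h mulrC addNr.
rewrite (@horner_coef_wide _ (size D)) ?size_poly// rmorph_sum.
apply: eq_bigr => b _; rewrite coef_map /=.
by rewrite rmorphM rmorphXn /= uJ exprVn oppr0.
Qed.

Lemma cmod_sqr_conj (R : rcfType) (x : R[i]) : (cmod x ^+ 2)%:C = x * x^*%C.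
Proof.
rewrite cmod_sqr; case: x => a b; simpc; congr (_ +i* _) => //=; ring.
Qed.

(** Convolution with |D|^2, computed exactly by a finite mean: the size condition keeps all the
    exponents n + a and b below [M], where orthogonality holds. *)
Lemma autocorrelation_mean (R : realType) (D : {poly R}) (p : {poly R[i]}) M z :
  (size p + size D <= M)%N ->
  \sum_(j < M) p.[z * unit_root R M ^+ j]
     * (cmod (map_poly (real_complex R) D).[unit_root R M ^+ j] ^+ 2)%:C
  = M%:R * (coef_weight (autocorrelation D) p).[z].
Proof.
move=> hM; set w := unit_root R M; set s := size D.
transitivity (\sum_(n < size p) \sum_(a < s) \sum_(b < s)
   p`_n * z ^+ n * (D`_a * D`_b)%:C *
   \sum_(j < M) ((w ^+ j) ^+ (n + a) / (w ^+ j) ^+ b)).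
  transitivity (\sum_(j < M) \sum_(n < size p) \sum_(a < s) \sum_(b < s)
     p`_n * z ^+ n * (D`_a * D`_b)%:C * ((w ^+ j) ^+ (n + a) / (w ^+ j) ^+ b)).
    apply: eq_bigr => j _; set u := w ^+ j.
    have hu : cmod u = 1 by rewrite cmodX cmod_unit_root expr1n.
    rewrite cmod_sqr_conj conj_horner_unit//.
    rewrite horner_coef (@horner_coef_wide _ s) ?size_poly// mulr_suml.
    apply: eq_bigr => n _; rewrite mulr_suml mulr_sumr.
    apply: eq_bigr => a _; rewrite mulr_sumr mulr_sumr; apply: eq_bigr => b _.
    rewrite coef_map exprMn exprD rmorphM /=.
    by move: (u ^+ b)^-1 => v; ring.
  rewrite exchange_big; apply: eq_bigr => n _.
  rewrite exchange_big; apply: eq_bigr => a _.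
  rewrite exchange_big; apply: eq_bigr => b _.
  by rewrite mulr_sumr.
rewrite (@horner_coef_wide _ (size p)) ?size_poly// mulr_sumr.
apply: eq_bigr => n _; rewrite coef_coef_weight /autocorrelation rmorph_sum.
rewrite !mulr_suml mulr_sumr; apply: eq_bigr => a _.
have hna : (n + a < M)%N.
  by apply: leq_trans hM; rewrite -addnS; apply: leq_add; rewrite // ltnW.
have hb (b : 'I_s) : (b < M)%N.
  by apply: leq_trans hM; apply: ltn_addl.
under eq_bigr => b _ do rewrite sum_unit_root//.
have [h|h] := ltnP (n + a) s.
  rewrite (bigD1 (Ordinal h))//= eqxx big1 ?addr0.
    by rewrite mul1r addnC !rmorphM; ring.
  by move=> b; rewrite -val_eqE /= eq_sym => /negbTE ->; rewrite mul0r mulr0.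
rewrite (nth_default 0 (_ : (size D <= a + n)%N)) 1?addnC// mulr0 rmorph0 !mul0r mulr0.
rewrite big1// => b _; rewrite gtn_eqF ?mul0r ?mulr0//.
by rewrite addnC; exact: leq_trans (ltn_ord b) h.
Qed.

Lemma energy_mean (R : realType) (D : {poly R}) M : ((size D).+1 <= M)%N ->
  \sum_(j < M) cmod (map_poly (real_complex R) D).[unit_root R M ^+ j] ^+ 2
  = M%:R * autocorrelation D 0.
Proof.
move=> hM; apply: (@complexI R); rewrite rmorph_sum rmorphM rmorph_nat.
have := @autocorrelation_mean R D 1 M 1; rewrite size_poly1 => /(_ hM).
under eq_bigr do rewrite hornerC mul1r.
move=> ->; rewrite (@horner_coef_wide _ 1) ?(leq_trans (size_poly _ _)) ?size_poly1//.
by rewrite big_ord1 coef_coef_weight coefC !mulr1.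
Qed.

Definition geom_poly (R : rcfType) (s : nat) : {poly R} := \poly_(i < s) 1.

(** On the circle |[geom_poly]|^2 is s times the Fejer kernel, so the squared modulus of this
    polynomial is the Jackson kernel (sin (s t / 2) / sin (t / 2))^4, unnormalised. *)
Definition jackson_poly (R : rcfType) (s : nat) : {poly R} := geom_poly R s ^+ 2.

Definition jackson_coef (R : rcfType) (s n : nat) : R :=
  autocorrelation (jackson_poly R s) n / autocorrelation (jackson_poly R s) 0.
Arguments jackson_coef R s n : clear implicits.

Lemma size_jackson_poly (R : rcfType) s : (0 < s)%N ->
  (size (jackson_poly R s) <= s.*2.-1)%N.
Proof.
move=> s0; rewrite /jackson_poly expr2; apply: leq_trans (size_polyMleq _ _) _.
have h : (size (geom_poly R s) <= s)%N by exact: size_poly.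
rewrite -addnn -!subn1; apply: leq_sub2r; exact: leq_add.
Qed.

Lemma jackson_coef_eq0 (R : rcfType) s n : (0 < s)%N -> (s.*2.-1 <= n)%N ->
  jackson_coef R s n = 0.
Proof.
move=> s0 hn; rewrite /jackson_coef /autocorrelation big1 ?mul0r// => a _.
rewrite (nth_default 0 (_ : (_ <= a + n)%N)) ?mulr0//.
apply: leq_trans (size_jackson_poly R s0) _; apply: leq_trans hn (leq_addl _ _).
Qed.

Lemma autocorrelation0 (R : rcfType) (D : {poly R}) n : (size D <= n)%N ->
  autocorrelation D 0 = \sum_(a < n) D`_a ^+ 2.
Proof.
move=> hn; rewrite /autocorrelation -(big_mkord predT (fun a => D`_a * D`_(a + 0))).
rewrite -(big_mkord predT (fun a => D`_a ^+ 2)) (big_cat_nat (leq0n _) hn) /=.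
rewrite [X in _ = _ + X]big_nat_cond [X in _ = _ + X]big1 ?addr0.
  by apply: eq_bigr => a _; rewrite addn0.
by move=> a /andP[/andP[h _] _]; rewrite nth_default// expr0n.
Qed.

Lemma geom_poly_energy (R : rcfType) s : autocorrelation (geom_poly R s) 0 = s%:R.
Proof.
rewrite (autocorrelation0 (size_poly s _)) (eq_bigr (fun=> 1)).
  by rewrite sumr_const card_ord.
by move=> a _; rewrite coef_poly ltn_ord expr1n.
Qed.

(** The coefficients sum to s^2 over 2 s places; x^2 >= s x - s^2 / 4 is the tangent bound at their
    mean s / 2. *)
Lemma jackson_energy_ge (R : rcfType) s : (0 < s)%N ->
  s%:R ^+ 3 / 2 <= autocorrelation (jackson_poly R s) 0.
Proof.
move=> s0; have hs : (size (jackson_poly R s) <= s.*2)%N.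
  by apply: leq_trans (size_jackson_poly R s0) (leq_pred _).
rewrite (autocorrelation0 hs).
apply: le_trans (_ : \sum_(a < s.*2) (s%:R * (jackson_poly R s)`_a - s%:R ^+ 2 / 4) <= _).
  rewrite sumrB -mulr_sumr sumr_const card_ord.
  have -> : \sum_(i < s.*2) (jackson_poly R s)`_i = s%:R ^+ 2.
    have -> : \sum_(i < s.*2) (jackson_poly R s)`_i = (jackson_poly R s).[1].
      by rewrite (horner_coef_wide _ hs); apply: eq_bigr => i _; rewrite expr1n mulr1.
    rewrite horner_exp; congr (_ ^+ 2).
    rewrite horner_poly (eq_bigr (fun=> 1)) ?sumr_const ?card_ord// => i _.
    by rewrite expr1n mulr1.
  by rewrite -[_ *+ s.*2]mulr_natr -muln2 natrM le_eqVlt; apply/orP; left; apply/eqP; field.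
apply: ler_sum => a _; have := sqr_ge0 ((jackson_poly R s)`_a - s%:R / 2).
rewrite !expr2; lra.
Qed.

Lemma jackson_energy_gt0 (R : rcfType) s : (0 < s)%N ->
  0 < autocorrelation (jackson_poly R s) 0.
Proof.
move=> s0; apply: lt_le_trans (jackson_energy_ge R s0).
by rewrite divr_gt0// exprn_gt0// ltr0n.
Qed.

Definition jackson_kernel (R : rcfType) (s : nat) (u : R[i]) : R :=
  cmod (map_poly (real_complex R) (jackson_poly R s)).[u] ^+ 2.

(** The geometric sum gives |u - 1| G <= 2, hence |u - 1| G^4 <= 2 G^3 <= s G^2 + G^4 / s. The mean
    of G^2 is s and that of G^4 is A >= s^3 / 2, so the two terms cost 2 A / s and A / s. *)
Lemma jackson_kernel_moment (R : realType) s M : (0 < s)%N -> (s.*2 <= M)%N ->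
  \sum_(j < M) cmod (unit_root R M ^+ j - 1) * jackson_kernel s (unit_root R M ^+ j)
  <= M%:R * autocorrelation (jackson_poly R s) 0 * (3 / s%:R).
Proof.
move=> s0 hM.
have sR : 0 < s%:R :> R by rewrite ltr0n.
set A := autocorrelation _ _.
pose G u := cmod (map_poly (real_complex R) (geom_poly R s)).[u].
have kE u : jackson_kernel s u = G u ^+ 4.
  by rewrite /jackson_kernel /jackson_poly rmorphXn horner_exp cmodX -exprM.
apply: le_trans (_ : \sum_(j < M) (s%:R * G (unit_root R M ^+ j) ^+ 2
    + jackson_kernel s (unit_root R M ^+ j) / s%:R) <= _).
  apply: ler_sum => j _; set u := unit_root R M ^+ j.
  have hu : cmod u = 1 by rewrite cmodX cmod_unit_root expr1n.
  have hG : cmod (u - 1) * G u <= 2.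
    rewrite /G -cmodM.
    have -> : (map_poly (real_complex R) (geom_poly R s)).[u] = \sum_(i < s) u ^+ i.
      rewrite (@horner_coef_wide _ s); last by rewrite (leq_trans (size_poly _ _))// size_poly.
      by apply: eq_bigr => i _; rewrite coef_map coef_poly ltn_ord /= mul1r.
    rewrite -subrX1; apply: le_trans (cmodB _ _) _.
    by rewrite cmodX hu expr1n cmod1.
  rewrite kE; have := cmod_ge0 (u - 1); move: hG.
  have := cmod_ge0 (map_poly (real_complex R) (geom_poly R s)).[u]; rewrite -/(G u).
  move: (G u) (cmod (u - 1)) => g v g0 hvg v0.
  apply: le_trans (_ : 2 * g ^+ 3 <= _).
    by rewrite (_ : v * _ = v * g * g ^+ 3) ?ler_wpM2r ?exprn_ge0//; ring.
  rewrite -subr_ge0 (_ : _ - _ = s%:R * (g * (1 - g / s%:R)) ^+ 2).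
    by rewrite mulr_ge0 ?sqr_ge0// ltW.
  by field; rewrite gt_eqF.
rewrite big_split /= -mulr_sumr -mulr_suml.
rewrite !energy_mean ?geom_poly_energy; last first.
- by apply: leq_trans hM; rewrite -addnn -addn1 leq_add ?size_poly.
- apply: leq_trans hM; have := size_jackson_poly R s0.
  by rewrite -ltnS prednK ?double_gt0.
rewrite -/A; have := jackson_energy_ge R s0; rewrite -/A => hA.
have -> : s%:R * (M%:R * s%:R) + M%:R * A / s%:R = M%:R * ((s%:R ^+ 3 + A) / s%:R).
  by field; rewrite gt_eqF.
rewrite -mulrA ler_wpM2l// mulrA ler_pdivrMr// divfK ?gt_eqF//.
by lra.
Qed.

(** The left-hand side is the modulus of the mean of p(z) - p(z u) against the normalised kernel,
    whose first moment is at most 3 / s. *)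
Lemma jackson_step (R : realType) s (p : {poly R[i]}) (A B : R) z :
  (0 < s)%N -> 0 <= B ->
  (forall u, cmod u = 1 -> cmod (p.[z * u] - p.[z]) <= A + B * cmod (u - 1)) ->
  cmod (coef_weight (fun n => 1 - jackson_coef R s n) p).[z] <= A + B * (3 / s%:R).
Proof.
move=> s0 B0 h; pose M := (size p + s.*2)%N.
have hM : (size p + size (jackson_poly R s) <= M)%N.
  rewrite leq_add2l; apply: leq_trans (size_jackson_poly R s0) (leq_pred _).
have M0 : 0 < M%:R :> R by rewrite ltr0n /M addn_gt0 double_gt0 s0 orbT.
have := @autocorrelation_mean R (jackson_poly R s) p M z hM.
have hE : \sum_(j < M) jackson_kernel s (unit_root R M ^+ j)
    = M%:R * autocorrelation (jackson_poly R s) 0.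
  apply: energy_mean; apply: leq_trans (leq_addl _ _).
  have := size_jackson_poly R s0; by rewrite -ltnS prednK ?double_gt0.
have A0 := jackson_energy_gt0 R s0.
have hm : (s.*2 <= M)%N by rewrite leq_addl.
have := jackson_kernel_moment R s0 hm.
set E := autocorrelation (jackson_poly R s) 0 in hE A0 *.
move=> hmom hmean.
have ME : 0 < M%:R * E by rewrite mulr_gt0.
rewrite -(ler_pM2l ME) coef_weightB coef_weight1 hornerD hornerN.
have -> : (coef_weight (jackson_coef R s) p).[z]
  = (E^-1)%:C * (coef_weight (autocorrelation (jackson_poly R s)) p).[z].
  rewrite -hornerZ; congr (_.[z]); apply/polyP => n.
  by rewrite coefZ !coef_coef_weight /jackson_coef rmorphM mulrA (mulrC (E^-1)%:C).
have -> : M%:R * E * cmod (p.[z] - (E^-1)%:C * (coef_weight (autocorrelation (jackson_poly R s)) p).[z])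
  = cmod ((M%:R * E)%:C * p.[z] - M%:R * (coef_weight (autocorrelation (jackson_poly R s)) p).[z]).
  rewrite -[in LHS](gtr0_norm ME) -cmod_real -cmodM mulrBr; congr (cmod (_ - _)).
  rewrite mulrA -rmorphM -mulrA divff ?gt_eqF// mulr1 rmorph_nat //.
rewrite -hmean -hE rmorph_sum mulr_suml -sumrB.
apply: le_trans (cmod_sum _ _ _) _.
apply: le_trans (_ : \sum_(j < M) (A + B * cmod (unit_root R M ^+ j - 1))
   * jackson_kernel s (unit_root R M ^+ j) <= _).
  apply: ler_sum => j _; set u := unit_root R M ^+ j.
  have hu : cmod u = 1 by rewrite cmodX cmod_unit_root expr1n.
  rewrite -[X in _ - _ * X]/((jackson_kernel s u)%:C) mulrC -mulrBl cmodM cmod_real.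
  rewrite ger0_norm ?sqr_ge0// ler_wpM2r ?sqr_ge0// cmod_distC.
  exact: h.
under eq_bigr do rewrite mulrDl -mulrA.
rewrite big_split /= -!mulr_sumr hE mulrDr; apply: lerD; first by rewrite mulrC.
rewrite mulrCA ler_wpM2l// mulrA; exact: hmom.
Qed.

Lemma coef_weight_horner_norm (R : rcfType) (p : {poly R[i]}) z : cmod z = 1 ->
  cmod (p^`()).[z] = cmod (coef_weight (fun n => n%:R) p).[z].
Proof. by move=> hz; rewrite coef_weight_id hornerM hornerX cmodM hz mul1r. Qed.

(* Since the circular derivative commutes with the multipliers, each factor
   1 - jackson_coef costs one derivative and gains a factor 3 / s. *)
Lemma jackson (R : realType) s m (p : {poly R[i]}) (A B : R) :
  (0 < s)%N -> 0 <= A -> 0 <= B ->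
  (forall z u, cmod z = 1 -> cmod u = 1 ->
    cmod ((coef_weight (fun n => n%:R ^+ m) p).[z * u]
        - (coef_weight (fun n => n%:R ^+ m) p).[z]) <= A + B * cmod (u - 1)) ->
  forall z, cmod z = 1 ->
  cmod (coef_weight (fun n => (1 - jackson_coef R s n) ^+ m.+1) p).[z]
  <= (3 / s%:R) ^+ m * (A + B * (3 / s%:R)).
Proof.
move=> s0 A0 B0; have sR : 0 <= 3 / s%:R :> R by rewrite divr_ge0.
elim: m p => [|m IH] p h z hz.
  have -> : coef_weight (fun n => (1 - jackson_coef R s n) ^+ 1) p
     = coef_weight (fun n => 1 - jackson_coef R s n) p by [].
  rewrite expr0 mul1r; apply: jackson_step => // u hu; have := h z u hz hu.
  by rewrite (_ : coef_weight _ p = p) //; exact: coef_weight1.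
set C := (3 / s%:R) ^+ m * (A + B * (3 / s%:R)) in IH.
have C0 : 0 <= C by rewrite mulr_ge0 ?exprn_ge0// addr_ge0// mulr_ge0.
pose q := coef_weight (fun n => (1 - jackson_coef R s n) ^+ m.+1) p.
have -> : coef_weight (fun n => (1 - jackson_coef R s n) ^+ m.+2) p
   = coef_weight (fun n => 1 - jackson_coef R s n) q.
  by rewrite coef_weight_comp.
rewrite exprS -mulrA -/C mulrC -[leRHS]add0r; apply: jackson_step => // u hu.
rewrite add0r; have -> : u - 1 = (z * u - z) / z.
  by field; rewrite -cmod_eq0 hz oner_eq0.
rewrite cmodM cmodV hz invr1 mulr1; apply: poly_lipschitz; last 2 first.
- by rewrite cmodM hz hu mulr1.
- by rewrite hz.
(* On the circle the derivative of [q] has the modulus of its circular derivative; moved past the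
   multiplier onto [p], it falls under the induction hypothesis. *)
move=> x hx; apply: poly_max_principle hx => {}x hx.
rewrite coef_weight_horner_norm// /q coef_weight_comp.
have -> : coef_weight (fun n => n%:R * (1 - jackson_coef R s n) ^+ m.+1) p
   = coef_weight (fun n => (1 - jackson_coef R s n) ^+ m.+1) (coef_weight (fun n => n%:R) p).
  by rewrite coef_weight_comp; apply/polyP => n; rewrite !coef_coef_weight (mulrC n%:R).
apply: IH => // z' u' hz' hu'; rewrite coef_weight_comp.
have -> : coef_weight (fun n => n%:R ^+ m * n%:R) p = coef_weight (fun n => n%:R ^+ m.+1) p.
  by apply/polyP => n; rewrite !coef_coef_weight exprSr.
exact: h.
Qed.

(** * A discrete Cauchy formula *)

Definition has_cderiv (R : rcfType) (f : R[i] -> R[i]) (z D : R[i]) :=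
  forall e : R, 0 < e -> exists2 d : R, 0 < d &
    forall h, cmod h < d -> cmod (f (z + h) - f z - D * h) <= e * cmod h.

Definition has_rderiv (R : rcfType) (g : R -> R[i]) (s : R) (D : R[i]) :=
  forall e : R, 0 < e -> exists2 d : R, 0 < d &
    forall h : R, `|h| < d -> cmod (g (s + h) - g s - D * h%:C) <= e * `|h|.

Lemma has_rderivD (R : rcfType) (g1 g2 : R -> R[i]) s D1 D2 :
  has_rderiv g1 s D1 -> has_rderiv g2 s D2 ->
  has_rderiv (fun t => g1 t + g2 t) s (D1 + D2).
Proof.
move=> h1 h2 e e0; have e2 : 0 < e / 2 by rewrite divr_gt0.
have [d1 d10 H1] := h1 _ e2; have [d2 d20 H2] := h2 _ e2.
exists (Num.min d1 d2) => [|h]; first by rewrite lt_min d10.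
rewrite lt_min => /andP[/H1 l1 /H2 l2].
have -> : g1 (s + h) + g2 (s + h) - (g1 s + g2 s) - (D1 + D2) * h%:C
  = (g1 (s + h) - g1 s - D1 * h%:C) + (g2 (s + h) - g2 s - D2 * h%:C) by ring.
by apply: le_trans (cmodD _ _) _; lra.
Qed.

Lemma has_rderiv_sum (R : rcfType) n (g : 'I_n -> R -> R[i]) s D :
  (forall i, has_rderiv (g i) s (D i)) ->
  has_rderiv (fun t => \sum_(i < n) g i t) s (\sum_(i < n) D i).
Proof.
elim: n g D => [|n IH] g D h.
  move=> e e0; exists 1 => // t _; rewrite !big_ord0 subrr mul0r subr0 cmod0.
  by rewrite mulr_ge0// ltW.
have -> : (fun t => \sum_(i < n.+1) g i t)
    = (fun t => \sum_(i < n) g (widen_ord (leqnSn n) i) t + g ord_max t).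
  by apply/funext => t; rewrite big_ord_recr.
by rewrite big_ord_recr; apply: has_rderivD => //; apply: IH => i.
Qed.

Lemma has_rderiv_path (R : rcfType) (f : R[i] -> R[i]) (a b c : R[i]) s D :
  has_cderiv f (a + s%:C * b) D ->
  has_rderiv (fun t : R => c * f (a + t%:C * b)) s (c * D * b).
Proof.
move=> hf e e0.
have c0 := cmod_ge0 c; have b0 := cmod_ge0 b.
have cb : 0 < cmod c * cmod b + 1 by rewrite ltr_wpDl// mulr_ge0.
have e' : 0 < e / (cmod c * cmod b + 1) by rewrite divr_gt0.
have [d d0 H] := hf _ e'.
exists (d / (cmod b + 1)); first by rewrite divr_gt0// ltr_wpDl.
move=> h; rewrite ltr_pdivlMr ?ltr_wpDl// => hd.
have H' : `|h| * cmod b < d.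
  by apply: le_lt_trans hd; rewrite ler_wpM2l// lerDl.
have := H (h%:C * b); rewrite cmodM cmod_real => /(_ H') {}H.
have -> : c * f (a + (s + h)%:C * b) - c * f (a + s%:C * b) - c * D * b * h%:C
  = c * (f (a + s%:C * b + h%:C * b) - f (a + s%:C * b) - D * (h%:C * b)).
  by rewrite rmorphD mulrDl addrA; ring.
rewrite cmodM; apply: le_trans (ler_wpM2l c0 H) _.
rewrite [leLHS](_ : _ = e * `|h| * ((cmod c * cmod b) / (cmod c * cmod b + 1))); last first.
  move: (cmod c) (cmod b) (`|h|) cb => x y t cb; field; by rewrite gt_eqF.
by rewrite ler_piMr ?mulr_ge0 ?(ltW e0)// ler_pdivrMr// mul1r lerDl.
Qed.

Lemma is_derive_eps (R : realType) (g : R -> R) (s l : R) :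
  (forall e : R, 0 < e -> exists2 d : R, 0 < d &
    forall h : R, `|h| < d -> `|g (s + h) - g s - l * h| <= e * `|h|) ->
  is_derive s (1 : R) g l.
Proof.
move=> H.
have cv : (fun h : R => h^-1 *: (g (h *: (1 : R) + s) - g s)) @ (0 : R)^' --> l.
  apply/cvgrPdist_le => e e0; have [d d0 Hd] := H _ e0.
  near=> h.
  have h0 : h != 0 by near: h; exact: nbhs_dnbhs_neq.
  have hd : `|h| < d by near: h; apply: dnbhs0_lt.
  have := Hd h hd; rewrite -ler_pdivrMr ?normr_gt0// -normf_div.
  rewrite distrC; congr (`|_| <= _).
  by rewrite /GRing.scale /= mulr1 (addrC h); field.
split; first by apply/cvg_ex; exists l.
exact: cvg_lim cv.
Unshelve. all: by end_near. Qed.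

Lemma Re_le_cmod (R : rcfType) (y : R[i]) : `|complex.Re y| <= cmod y.
Proof.
rewrite -(@ler_sqr _ _ (cmod y)) ?nnegrE ?cmod_ge0//.
by rewrite cmod_sqr real_normK ?num_real// lerDl sqr_ge0.
Qed.

(** As in [poly_lipschitz], the real part against the conjugate of the total increment reduces this
    to the real mean value theorem. *)
Lemma path_mvt (R : realType) (g g' : R -> R[i]) (B : R) :
  (forall s, 0 <= s <= 1 -> has_rderiv g s (g' s)) ->
  (forall s, 0 < s < 1 -> cmod (g' s) <= B) ->
  cmod (g 1 - g 0) <= B.
Proof.
move=> hg hB; set D := g 1 - g 0.
have [D0|D0] := eqVneq D 0.
  by rewrite D0 cmod0; apply: le_trans (hB (1 / 2) _); rewrite ?cmod_ge0//; lra.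
pose u (s : R) := complex.Re (D^*%C * g s).
pose u' (s : R) := complex.Re (D^*%C * g' s).
have ReB (y z : R[i]) : complex.Re (y - z) = complex.Re y - complex.Re z.
  by case: y; case: z.
have Jc : cmod D^*%C = cmod D by case: (D) => a b /=; rewrite sqrrN.
have hu (s : R) : 0 <= s <= 1 -> is_derive s (1 : R) u (u' s).
  move=> hs; apply: is_derive_eps => e e0.
  have c0 : 0 < cmod D by rewrite lt_def cmod_eq0 D0 cmod_ge0.
  have e' : 0 < e / cmod D by rewrite divr_gt0.
  have [d d0 H] := hg s hs _ e'; exists d => // h /H {}H.
  have -> : u (s + h) - u s - u' s * h
     = complex.Re (D^*%C * (g (s + h) - g s - g' s * h%:C)).
    rewrite /u /u' !mulrBr !ReB; congr (_ - _).
    rewrite mulrA; case: (_ * g' s) => a b /=; ring.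
  apply: le_trans (Re_le_cmod _) _; rewrite cmodM Jc.
  by apply: le_trans (ler_wpM2l (ltW c0) H) _; rewrite mulrA mulrCA divff ?mulr1// gt_eqF.
have [||c hc] := @MVT R u u' 0 1 ltr01.
- by move=> s; rewrite in_itv /= => /andP[/ltW s0 /ltW s1]; apply: hu; rewrite s0.
- apply: derivable_within_continuous => s; rewrite in_itv /= => hs.
  by have [] := hu s hs.
rewrite subr0 mulr1 /u -ReB -mulrBr -/D.
have -> : complex.Re (D^*%C * D) = cmod D ^+ 2.
  by rewrite cmod_sqr; case: (D) => a b /=; ring.
move=> E; have := Re_le_cmod (D^*%C * g' c); rewrite cmodM Jc.
move/(le_trans (ler_norm _)); rewrite -/(u' c) -E expr2.
rewrite ler_pM2l ?lt_def ?cmod_eq0 ?D0 ?cmod_ge0// => h.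
by apply: le_trans h _; apply: hB; move: hc; rewrite in_itv.
Qed.

Lemma disk_convex (R : rcfType) (x y : R[i]) (s : R) :
  cmod x < 1 -> cmod y < 1 -> 0 <= s <= 1 -> cmod (y + s%:C * (x - y)) < 1.
Proof.
move=> hx hy /andP[s0 s1].
have -> : y + s%:C * (x - y) = s%:C * x + (1 - s)%:C * y by rewrite rmorphB rmorph1; ring.
apply: le_lt_trans (cmodD _ _) _; rewrite !cmodM !cmod_real !ger0_norm ?subr_ge0//.
apply: le_lt_trans (_ : Num.max (cmod x) (cmod y) < 1); last by rewrite gt_max hx.
set m := Num.max _ _; rewrite [leRHS](_ : m = s * m + (1 - s) * m); last by ring.
by apply: lerD; rewrite ler_wpM2l ?subr_ge0// le_max lexx ?orbT.
Qed.

Lemma disk_mvt (R : realType) (f f' : R[i] -> R[i]) (B : R) x y :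
  (forall z, cmod z < 1 -> has_cderiv f z (f' z)) ->
  cmod x < 1 -> cmod y < 1 ->
  (forall s : R, 0 < s < 1 -> cmod (f' (y + s%:C * (x - y))) <= B) ->
  cmod (f x - f y) <= B * cmod (x - y).
Proof.
move=> hf hx hy hB.
have := @path_mvt R (fun t => 1 * f (y + t%:C * (x - y)))
  (fun t => 1 * f' (y + t%:C * (x - y)) * (x - y)) (B * cmod (x - y)).
rewrite -[1%:C]/(1 : R[i]) -[0%:C]/(0 : R[i]) !mul1r mul0r addr0 [y + (x - y)]addrC subrK; apply.
  by move=> s hs; apply: has_rderiv_path; apply: hf; apply: disk_convex.
by move=> s hs; rewrite mul1r cmodM ler_wpM2r ?cmod_ge0// hB.
Qed.

Lemma has_cderiv_subl (R : rcfType) (f : R[i] -> R[i]) (z D c : R[i]) :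
  has_cderiv f z D -> has_cderiv (fun x => f x - c * x) z (D - c).
Proof.
move=> hf e e0; have [d d0 H] := hf e e0; exists d => // h hd.
rewrite (_ : _ - _ - _ = f (z + h) - f z - D * h); first exact: H.
by ring.
Qed.

(** The mean value inequality for f z - f' y * z, whose derivative f' z - f' y is bounded by the
    same inequality through f''; hence [B] where Taylor's formula would give B / 2. *)
Lemma disk_taylor1 (R : realType) (f f' f'' : R[i] -> R[i]) (B : R) x y :
  (forall z, cmod z < 1 -> has_cderiv f z (f' z)) ->
  (forall z, cmod z < 1 -> has_cderiv f' z (f'' z)) ->
  (forall z, cmod z < 1 -> cmod (f'' z) <= B) ->
  cmod x < 1 -> cmod y < 1 ->
  cmod (f x - f y - f' y * (x - y)) <= B * cmod (x - y) ^+ 2.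
Proof.
move=> hf hf' hB hx hy.
have B0 : 0 <= B by apply: le_trans (hB 0 _); rewrite ?cmod_ge0// cmod0.
have -> : f x - f y - f' y * (x - y) = (f x - f' y * x) - (f y - f' y * y) by ring.
rewrite expr2 mulrA.
apply: (@disk_mvt R (fun z => f z - f' y * z) (fun z => f' z - f' y)) => //.
  by move=> z hz; apply: has_cderiv_subl; exact: hf.
move=> s /andP[s0 s1]; have hs : 0 <= s <= 1 by rewrite !ltW.
apply: le_trans (_ : B * cmod (y + s%:C * (x - y) - y) <= _).
  apply: (@disk_mvt R f' f'') => //; first exact: disk_convex.
  move=> t /andP[t0 t1]; apply: hB; apply: disk_convex => //; last by rewrite !ltW.
  exact: disk_convex.
rewrite addrC addKr cmodM cmod_real ger0_norm ?(ltW s0)// ler_wpM2l//.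
by rewrite ler_piMl ?cmod_ge0 ?(ltW s1).
Qed.

(** * Discretised Cauchy integrals *)

Definition circle_node (R : realType) (r : R) (M j : nat) : R[i] :=
  r%:C * unit_root R M ^+ j.

Lemma cmod_circle_node (R : realType) (r : R) M j : 0 <= r ->
  cmod (circle_node r M j) = r.
Proof.
by move=> r0; rewrite cmodM cmod_real ger0_norm// cmodX cmod_unit_root expr1n mulr1.
Qed.

(** The mean over the circle of f(x) times the Cauchy kernel x / (x - z), with its geometric series
    cut at [M] terms so that the result is a polynomial in [z]. *)
Definition cauchy_mean (R : realType) (r : R) (M : nat) (f : R[i] -> R[i]) (z : R[i]) : R[i] :=
  M%:R^-1 * \sum_(j < M) f (circle_node r M j)
     * \sum_(k < M) (z / circle_node r M j) ^+ k.

(* The discrete form of: the integral of f' along the circle z + s (x - z) is 0. *)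
Lemma sum_deriv_circle (R : realType) (f f' f'' : R[i] -> R[i]) (B r s : R) M z :
  (1 < M)%N -> 0 <= B ->
  (forall z, cmod z < 1 -> has_cderiv f z (f' z)) ->
  (forall z, cmod z < 1 -> has_cderiv f' z (f'' z)) ->
  (forall z, cmod z < 1 -> cmod (f'' z) <= B) ->
  0 <= r < 1 -> cmod z < 1 -> 0 < s < 1 ->
  cmod (\sum_(j < M) f' (z + s%:C * (circle_node r M j - z)) * circle_node r M j)
  <= M%:R * B * cmod (unit_root R M - 1).
Proof.
move=> M1 B0 hf hf' hB /andP[r0 r1] hz /andP[s0 s1]; set w := unit_root R M.
pose y j := z + s%:C * (circle_node r M j - z).
have hy j : cmod (y j) < 1.
  by apply: disk_convex => //; [rewrite cmod_circle_node | rewrite !ltW].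
have w1 : 0 < cmod (w - 1).
  by rewrite lt_def cmod_eq0 subr_eq0 cmod_ge0 andbT -[w]expr1 unit_root_neq1.
have tele : \sum_(j < M) (f (y j.+1) - f (y j)) = 0.
  rewrite -(big_mkord predT (fun j => f (y j.+1) - f (y j))) telescope_sumr//.
  by rewrite /y /circle_node unit_rootX ?expr0 ?subrr// (ltn_trans _ M1).
have dy j : y j.+1 - y j = s%:C * (w - 1) * circle_node r M j.
  by rewrite /y /circle_node exprS -/w; ring.
(* The increments of f around the closed polygon cancel and each step is s (w - 1) x_j, so only
   Taylor remainders, quadratic in w - 1, are left. *)
have E : s%:C * (w - 1) * \sum_(j < M) f' (y j) * circle_node r M j
   = - \sum_(j < M) (f (y j.+1) - f (y j) - f' (y j) * (y j.+1 - y j)).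
  rewrite sumrB tele sub0r opprK mulr_sumr; apply: eq_bigr => j _.
  by rewrite dy; ring.
have := congr1 (@cmod R) E; rewrite cmodN !cmodM cmod_real (gtr0_norm s0) => {}E.
have sw : 0 < s * cmod (w - 1) by rewrite mulr_gt0.
rewrite -(ler_pM2l sw) E; apply: le_trans (cmod_sum _ _ _) _.
apply: le_trans (_ : \sum_(j < M) B * (s * cmod (w - 1)) ^+ 2 <= _).
  apply: ler_sum => j _.
  apply: le_trans (disk_taylor1 hf hf' hB (hy _) (hy _)) _.
  rewrite ler_wpM2l// dy.
  move: (circle_node _ _ _) (cmod_circle_node M j r0) => x hx.
  rewrite !cmodM cmod_real (gtr0_norm s0) hx.
  by rewrite exprMn ler_piMr ?sqr_ge0// expr_le1// ltW.
rewrite sumr_const card_ord -[_ *+ M]mulr_natl expr2.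
have -> : M%:R * (B * (s * cmod (w - 1) * (s * cmod (w - 1))))
  = s * cmod (w - 1) * (M%:R * B * cmod (w - 1)) * s by ring.
rewrite ler_piMr ?(ltW s1)// mulr_ge0 ?(ltW sw)// !mulr_ge0 ?cmod_ge0//.
Qed.

(** Only k = 0 survives, so [cauchy_mean] is exact on constants. *)
Lemma sum_geometric_node (R : realType) (r : R) M z : (0 < M)%N -> 0 < r ->
  \sum_(j < M) \sum_(k < M) (z / circle_node r M j) ^+ k = M%:R.
Proof.
move=> M0 r0; rewrite exchange_big (bigD1 (Ordinal M0))//= [X in _ + X]big1 ?addr0.
  by under eq_bigr do rewrite expr0; rewrite sumr_const card_ord.
move=> k k0; have {}k0 : (0 < k)%N by rewrite lt0n; exact: k0.
transitivity (\sum_(j < M) (z / r%:C) ^+ k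
  * ((unit_root R M ^+ j) ^+ 0 / (unit_root R M ^+ j) ^+ k)).
  apply: eq_bigr => j _; rewrite /circle_node invfM mulrA exprMn expr0 mul1r.
  by rewrite (exprVn _ k).
by rewrite -mulr_sumr sum_unit_root// ltn_eqF// mul0r mulr0.
Qed.

(** The first error term comes from discretising the circle, the second from cutting the kernel. The
    former is controlled by contracting the circle to [z]: along the contraction the Cauchy sum has
    as derivative the sum in [sum_deriv_circle]. *)
Lemma cauchy_mean_error (R : realType) (f f' f'' : R[i] -> R[i]) (B r r' : R) M z :
  (1 < M)%N -> 0 <= B ->
  (forall z, cmod z < 1 -> has_cderiv f z (f' z)) ->
  (forall z, cmod z < 1 -> has_cderiv f' z (f'' z)) ->
  (forall z, cmod z < 1 -> cmod (f z) <= B) ->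
  (forall z, cmod z < 1 -> cmod (f'' z) <= B) ->
  0 <= r' -> r' < r -> r < 1 -> cmod z <= r' ->
  cmod (f z - cauchy_mean r M f z)
  <= B * cmod (unit_root R M - 1) + 2 * B * (r' / r) ^+ M * (1 - r' / r)^-1.
Proof.
move=> M1 B0 hf hf' hB hB2 r'0 r'r r1 hz; set w := unit_root R M.
have r0 : 0 < r by exact: le_lt_trans r'0 r'r.
have M0 : (0 < M)%N by exact: ltn_trans M1.
have MC : M%:R != 0 :> R[i] by rewrite pnatr_eq0 -lt0n.
have MR : 0 < M%:R :> R by rewrite ltr0n.
have hz1 : cmod z < 1 by apply: le_lt_trans hz (lt_trans r'r r1).
set t := r' / r; have t0 : 0 <= t by rewrite divr_ge0// ltW.
have t1 : t < 1 by rewrite ltr_pdivrMr// mul1r.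
have t1' : 0 < 1 - t by rewrite subr_gt0.
pose x j := circle_node r M j.
have hx j : cmod (x j) = r by rewrite cmod_circle_node// ltW.
have x0 j : x j != 0 by rewrite -cmod_eq0 hx gt_eqF.
have hzx j : cmod (z / x j) <= t.
  by rewrite cmodM cmodV hx ler_pM2r ?invr_gt0.
have xz j : x j - z != 0.
  rewrite subr_eq0; apply: contraTneq hz => <-; by rewrite hx -ltNge.
have zx j : z - x j != 0 by rewrite -opprB oppr_eq0 xz.
pose K j := x j / (x j - z).
have hK j : cmod (K j) <= (1 - t)^-1.
  have -> : K j = (1 - z / x j)^-1 by rewrite /K; field; rewrite x0 xz.
  rewrite cmodV lef_pV2 ?posrE//.
    have := cmodD (1 - z / x j) (z / x j); rewrite subrK cmod1; have := hzx j; lra.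
  have := cmodD (1 - z / x j) (z / x j); rewrite subrK cmod1; have := hzx j; lra.
pose G j := \sum_(k < M) (z / x j) ^+ k.
have GK j : G j = K j - (z / x j) ^+ M * K j.
  have E := subrX1 (z / x j) M; rewrite -/(G j) in E.
  have -> : G j = ((z / x j) ^+ M - 1) / (z / x j - 1).
    rewrite E mulrAC divff ?mul1r//; apply: contraNneq (xz j) => h.
    by rewrite -[z](divfK (x0 j)) (subr0_eq h) mul1r subrr.
  by rewrite /K; move: ((z / x j) ^+ M) => u; field; rewrite mulN1r x0 xz zx.
have sG : \sum_(j < M) G j = M%:R by exact: sum_geometric_node.
(* Up to the factor M, Phi 1 and Phi 0 are the discrete Cauchy integrals of f
   and of the constant f z. *)
pose Phi (s : R) := \sum_(j < M) K j * f (z + s%:C * (x j - z)).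
have hPhi : cmod (Phi 1 - Phi 0) <= M%:R * B * cmod (w - 1).
  apply: (@path_mvt R Phi (fun s => \sum_(j < M) K j * f' (z + s%:C * (x j - z)) * (x j - z))).
    move=> s hs; apply: has_rderiv_sum => j; apply: has_rderiv_path; apply: hf.
    by apply: disk_convex => //; rewrite hx.
  move=> s hs; rewrite (eq_bigr (fun j : 'I_M => f' (z + s%:C * (x j - z)) * x j)).
    by apply: (@sum_deriv_circle R f f' f'') => //; rewrite ltW.
  move=> j _; rewrite mulrAC mulrC /K divfK//.
have E : f z - cauchy_mean r M f z
   = M%:R^-1 * (- (Phi 1 - Phi 0) + \sum_(j < M) (f (x j) - f z) * ((z / x j) ^+ M * K j)).
  have -> : Phi 1 = \sum_(j < M) f (x j) * K j.
    by apply: eq_bigr => j _; rewrite -[1%:C]/(1 : R[i]) mul1r addrC subrK mulrC.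
  have -> : Phi 0 = \sum_(j < M) f z * K j.
    by apply: eq_bigr => j _; rewrite -[0%:C]/(0 : R[i]) mul0r addr0 mulrC.
  rewrite -{1}(mulKf MC (f z)) /cauchy_mean -mulrBr; congr (_ * _).
  rewrite -{1}sG mulr_suml -sumrB -sumrB -sumrN -big_split; apply: eq_bigr => j _.
  by rewrite -/(x j) -/(G j) GK /=; move: ((z / x j) ^+ M) => u; ring.
rewrite E cmodM cmodV cmod_nat.
rewrite -(ler_pM2l MR) mulrA divff ?gt_eqF// mul1r.
apply: le_trans (cmodD _ _) _; rewrite cmodN mulrDr mulrA; apply: lerD => //.
apply: le_trans (cmod_sum _ _ _) _.
apply: le_trans (_ : \sum_(j < M) (2 * B) * (t ^+ M * (1 - t)^-1) <= _); last first.
  by rewrite sumr_const card_ord -[_ *+ M]mulr_natl !mulrA.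
apply: ler_sum => j _; rewrite cmodM (cmodM _ (K j)) cmodX; apply: ler_pM; rewrite ?mulr_ge0 ?exprn_ge0 ?cmod_ge0//.
  apply: le_trans (cmodB _ _) _; rewrite mulr_natl mulr2n; apply: lerD; apply: hB => //.
  by rewrite hx.
apply: ler_pM; rewrite ?exprn_ge0 ?cmod_ge0//.
by rewrite lerXn2r ?nnegrE ?cmod_ge0.
Qed.

Lemma cauchy_mean_error_small (R : realType) (B r r' e : R) :
  0 <= B -> 0 <= r' -> r' < r -> 0 < e ->
  exists2 M, (1 < M)%N &
    B * cmod (unit_root R M - 1) + 2 * B * (r' / r) ^+ M * (1 - r' / r)^-1 <= e.
Proof.
move=> B0 r'0 r'r e0; have r0 : 0 < r by exact: le_lt_trans r'0 r'r.
set t := r' / r; have t0 : 0 <= t by rewrite divr_ge0// ltW.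
have t1 : t < 1 by rewrite ltr_pdivrMr// mul1r.
have t1' : 0 < 1 - t by rewrite subr_gt0.
have C0 : 0 < 2 * B * (1 - t)^-1 + 1.
  by rewrite ltr_wpDl// mulr_ge0 ?mulr_ge0// invr_ge0 ltW.
have D0 : 0 < B * (2 * pi) + 1.
  by rewrite ltr_wpDl// mulr_ge0// mulr_ge0// pi_ge0.
have e1 : 0 < e / 2 / (2 * B * (1 - t)^-1 + 1) by rewrite !divr_gt0.
have : (fun n => t ^+ n) @ \oo --> (0 : R).
  by apply: cvg_expr; rewrite ger0_norm.
move=> /cvgrPdist_le/(_ _ e1)[N1 _ hN1].
pose N2 := (Num.bound ((B * (2 * pi) + 1) / (e / 2))).
pose M := (N1 + N2 + 2)%N; exists M; first by rewrite /M addn2.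
have MR : 0 < M%:R :> R by rewrite ltr0n /M addn2.
rewrite [e](splitr e); apply: lerD.
  apply: le_trans (_ : B * (2 * pi / M%:R) <= _).
    rewrite ler_wpM2l//; apply: le_trans (cmod_expi_subr1_le _) _.
    by rewrite ger0_norm// divr_ge0// mulr_ge0// pi_ge0.
  rewrite mulrA ler_pdivrMr//; apply: le_trans (_ : B * (2 * pi) + 1 <= _).
    by rewrite lerDl.
  rewrite [leRHS]mulrC -ler_pdivrMr ?divr_gt0//; apply: ltW.
  apply: lt_le_trans (_ : N2%:R <= _).
    by apply: archi_boundP; rewrite divr_ge0 ?(ltW D0) ?divr_ge0 ?(ltW e0).
  by rewrite ler_nat (leq_trans (leq_addl N1 _))// leq_addr.
have NM : (N1 <= M)%N by rewrite /M -addnA leq_addr.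
have := hN1 M NM; rewrite /=.
rewrite sub0r normrN ger0_norm ?exprn_ge0// => h.
apply: le_trans (_ : t ^+ M * (2 * B * (1 - t)^-1 + 1) <= _).
  by rewrite mulrDr mulr1 ler_wpDr ?exprn_ge0// le_eqVlt; apply/orP; left; apply/eqP; ring.
by rewrite -ler_pdivlMr.
Qed.

Lemma cauchy_mean_poly (R : realType) (r : R) (M : nat) (f : R[i] -> R[i]) z :
  cauchy_mean r M f z
  = \sum_(k < M) (M%:R^-1 * \sum_(j < M) f (circle_node r M j) / circle_node r M j ^+ k)
      * z ^+ k.
Proof.
rewrite /cauchy_mean mulr_sumr.
transitivity (\sum_(j < M) \sum_(k < M)
   M%:R^-1 * (f (circle_node r M j) / circle_node r M j ^+ k) * z ^+ k).
  apply: eq_bigr => j _; rewrite mulr_sumr mulr_sumr; apply: eq_bigr => k _.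
  by rewrite expr_div_n; move: (_ ^- k) => u; ring.
rewrite exchange_big; apply: eq_bigr => k _.
by rewrite mulr_sumr mulr_suml.
Qed.

Lemma cmod_cauchy_mean (R : realType) (r r' e : R) (M : nat) (f : R[i] -> R[i]) z :
  (0 < M)%N -> 0 <= r' -> r' < r -> cmod z <= r' ->
  (forall j, cmod (f (circle_node r M j)) <= e) ->
  cmod (cauchy_mean r M f z) <= e * (1 - r' / r)^-1.
Proof.
move=> M0 r'0 r'r hz hf; have r0 : 0 < r by exact: le_lt_trans r'0 r'r.
have e0 : 0 <= e by apply: le_trans (hf 0%N); exact: cmod_ge0.
have MR : 0 < M%:R :> R by rewrite ltr0n.
rewrite /cauchy_mean cmodM cmodV cmod_nat -(ler_pM2l MR) mulrA divff ?gt_eqF// mul1r.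
apply: le_trans (cmod_sum _ _ _) _.
have -> : M%:R * (e * (1 - r' / r)^-1) = \sum_(j < M) e * (1 - r' / r)^-1.
  by rewrite sumr_const card_ord mulr_natl.
apply: ler_sum => j _; rewrite cmodM; apply: ler_pM; rewrite ?cmod_ge0//.
apply: le_trans (cmod_sum _ _ _) _.
apply: le_trans (geometric_sum_le M (_ : 0 <= r' / r < 1)); last first.
  by rewrite divr_ge0 ?(ltW r0)//= ltr_pdivrMr// mul1r.
apply: ler_sum => k _; rewrite cmodX lerXn2r ?nnegrE ?cmod_ge0 ?divr_ge0 ?(ltW r0)//.
by rewrite cmodM cmodV cmod_circle_node ?(ltW r0)// ler_pM2r ?invr_gt0.
Qed.

Lemma bipoly_approx (R : realType) (F Fz Fzz Fw Fww : R[i] -> R[i] -> R[i]) (B r e : R) :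
  (forall z w, cmod z < 1 -> cmod w < 1 ->
     [/\ has_cderiv (F^~ w) z (Fz z w), has_cderiv (Fz^~ w) z (Fzz z w),
         has_cderiv (F z) w (Fw z w) & has_cderiv (Fw z) w (Fww z w)]) ->
  (forall z w, cmod z < 1 -> cmod w < 1 ->
     [/\ cmod (F z w) <= B, cmod (Fzz z w) <= B & cmod (Fww z w) <= B]) ->
  0 <= r < 1 -> 0 < e ->
  exists n c, forall z w, cmod z <= r -> cmod w <= r ->
    cmod (F z w - bipoly n c z w) <= e.
Proof.
move=> hd hB /andP[r0 r1] e0.
pose r' := (r + 1) / 2; have rr' : r < r' by rewrite /r'; lra.
have r'1 : r' < 1 by rewrite /r'; lra.
have r'0 : 0 < r' by exact: le_lt_trans rr'.
have B0 : 0 <= B.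
  have c01 : cmod (0 : R[i]) < 1 by rewrite cmod0.
  by have [h _ _] := hB 0 0 c01 c01; apply: le_trans h; exact: cmod_ge0.
have t1 : 0 < 1 - r / r' by rewrite subr_gt0 ltr_pdivrMr// mul1r.
(* The 1 pays for the mean in [z]; the other term pays for the error of the mean in [w], amplified
   by the outer mean in [z]. *)
pose K := 1 + (1 - r / r')^-1; have K0 : 0 < K by rewrite addr_gt0// invr_gt0.
have e' : 0 < e / K by rewrite divr_gt0.
have [M M1 hM] := cauchy_mean_error_small B0 r0 rr' e'.
have M0 : (0 < M)%N by exact: ltn_trans M1.
pose c a b : R[i] := M%:R^-1 * \sum_(i < M)
  (M%:R^-1 * \sum_(j < M) F (circle_node r' M i) (circle_node r' M j) / circle_node r' M j ^+ b)
   / circle_node r' M i ^+ a.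
exists M, c => z w hz hw.
have hz1 := le_lt_trans hz r1; have hw1 := le_lt_trans hw r1.
have -> : bipoly M c z w = cauchy_mean r' M (fun z => cauchy_mean r' M (F z) w) z.
  rewrite cauchy_mean_poly /bipoly; apply: eq_bigr => a _.
  transitivity (\sum_(b < M) c a b * w ^+ b * z ^+ a).
    by apply: eq_bigr => b _; rewrite -mulrA [w ^+ b * _]mulrC.
  rewrite -mulr_suml; congr (_ * _).
  under [in RHS]eq_bigr do rewrite cauchy_mean_poly mulr_suml.
  rewrite exchange_big mulr_sumr; apply: eq_bigr => b _.
  rewrite /c -mulrA mulr_suml; congr (_ * _); apply: eq_bigr => i _.
  by move: (_ ^- a) => u; ring.
have -> : F z w - cauchy_mean r' M (fun z => cauchy_mean r' M (F z) w) z
  = (F z w - cauchy_mean r' M (F^~ w) z)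
   + cauchy_mean r' M (fun z => F z w - cauchy_mean r' M (F z) w) z.
  rewrite -addrA; congr (_ + _).
  rewrite {1 3 4}/cauchy_mean -!mulrN -mulrDr; congr (_ * _).
  rewrite -!sumrN -big_split /=; apply: eq_bigr => j _.
  by rewrite mulrBl addrA addNr add0r.
have -> : e = e / K + e / K * (1 - r / r')^-1.
  by rewrite -{1}[e / K]mulr1 -mulrDr divfK// gt_eqF.
apply: le_trans (cmodD _ _) _; apply: lerD.
  apply: le_trans hM; apply: (@cauchy_mean_error R _ (Fz^~ w) (Fzz^~ w)) => // x hx.
  - by have [] := hd x w hx hw1.
  - by have [] := hd x w hx hw1.
  - by have [] := hB x w hx hw1.
  - by have [] := hB x w hx hw1.
apply: cmod_cauchy_mean => // j; set x := circle_node r' M j.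
have hx : cmod x < 1 by rewrite cmod_circle_node ?(ltW r'0).
apply: le_trans hM; apply: (@cauchy_mean_error R _ (Fw x) (Fww x)) => // y hy.
- by have [] := hd x y hx hy.
- by have [] := hd x y hx hy.
- by have [] := hB x y hx hy.
- by have [] := hB x y hx hy.
Qed.

(** * Approximation of the partial derivatives *)

Lemma cmod_horner_le (R : rcfType) (p : {poly R[i]}) z : cmod z <= 1 ->
  cmod p.[z] <= \sum_(i < size p) cmod p`_i.
Proof.
move=> hz; rewrite horner_coef; apply: le_trans (cmod_sum _ _ _) _.
apply: ler_sum => i _; rewrite cmodM cmodX ler_piMr ?cmod_ge0//.
by rewrite exprn_ile1 ?cmod_ge0.
Qed.

Lemma has_cderiv_horner (R : rcfType) (p : {poly R[i]}) z :
  has_cderiv (horner p) z (p^`()).[z].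
Proof.
pose q := p \Po ('X + z%:P) - (p.[z])%:P - (p^`()).[z] *: 'X.
have qE h : q.[h] = p.[z + h] - p.[z] - (p^`()).[z] * h.
  by rewrite /q !(hornerD, hornerN, hornerZ, hornerX, hornerC, horner_comp) addrC [h + z]addrC addrC.
have /factor_theorem[q1 q1E] : root q 0.
  by rewrite /root qE addr0 subrr mulr0 subr0.
rewrite subr0 in q1E.
have /factor_theorem[q2 q2E] : root q1 0.
  apply/rootP.
  have <- : (q^`()).[0] = q1.[0].
    by rewrite q1E derivM derivX mulr1 hornerD hornerM hornerX mulr0 add0r.
  rewrite /q !derivB deriv_comp derivD derivX !derivC addr0 mulr1 subr0.
  rewrite derivZ derivX !(hornerD, hornerN, hornerZ, hornerX, hornerC, horner_comp).
  by rewrite add0r mulr1 subrr.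
rewrite subr0 in q2E.
set C := \sum_(i < size q2) cmod q2`_i.
have C0 : 0 <= C by apply: sumr_ge0 => i _; exact: cmod_ge0.
move=> e e0; exists (Num.min 1 (e / (C + 1))).
  by rewrite lt_min ltr01 divr_gt0// ltr_wpDl.
move=> h; rewrite lt_min => /andP[h1 he]; rewrite -qE q1E q2E !hornerM hornerX.
rewrite !cmodM ler_wpM2r ?cmod_ge0//.
apply: le_trans (_ : C * cmod h <= _).
  by rewrite ler_wpM2r ?cmod_ge0// cmod_horner_le// ltW.
move: he; rewrite ltr_pdivlMr ?ltr_wpDl//; have := cmod_ge0 h; nra.
Qed.

(** [poly_schwarz], recentred at [z], survives uniform limits of polynomials; it stands in for
    Cauchy's estimate on [h]. *)
Lemma poly_limit_lipschitz (R : realType) (h : R[i] -> R[i]) (r r' e : R) z k :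
  (forall d, 0 < d -> exists q : {poly R[i]},
     forall x, cmod x <= r' -> cmod (h x - q.[x]) <= d) ->
  (forall x, cmod x <= r' -> cmod (h x) <= e) ->
  r < r' -> cmod z <= r -> cmod k <= r' - r ->
  cmod (h (z + k) - h z) <= 2 * e / (r' - r) * cmod k.
Proof.
move=> hq he rr' hz hk; have d0 : 0 < r' - r by rewrite subr_gt0.
apply/ler_addgt0Pr => d dp.
pose C := 2 / (r' - r) * cmod k + 2.
have C0 : 0 < C by rewrite ltr_wpDl// mulr_ge0 ?cmod_ge0// divr_ge0// ltW.
have [q hqd] := hq (d / C) (divr_gt0 dp C0).
set t := d / C in hqd.
have hzk : cmod (z + k) <= r'.
  by apply: le_trans (cmodD _ _) _; lra.
have hz' : cmod z <= r' by apply: le_trans hz (ltW rr').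
have h1 : cmod ((q \Po ('X + z%:P)).[k] - (q \Po ('X + z%:P)).[0]) <= 2 * (e + t) / (r' - r) * cmod k.
  apply: poly_schwarz => // x hx; rewrite horner_comp hornerD hornerX hornerC.
  have hx' : cmod (x + z) <= r' by apply: le_trans (cmodD _ _) _; lra.
  have -> : q.[x + z] = h (x + z) - (h (x + z) - q.[x + z]) by ring.
  by apply: le_trans (cmodB _ _) _; apply: lerD; [exact: he | exact: hqd].
move: h1; rewrite !horner_comp !hornerD !hornerX !hornerC add0r (addrC k) => h1.
have -> : h (z + k) - h z = (q.[z + k] - q.[z]) + ((h (z + k) - q.[z + k]) - (h z - q.[z])) by ring.
apply: le_trans (cmodD _ _) _; apply: le_trans (lerD h1 (cmodB _ _)) _.
apply: le_trans (lerD (lexx _) (lerD (hqd _ hzk) (hqd _ hz'))) _.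
have -> : d = t * C by rewrite /t divfK// gt_eqF.
by rewrite /C le_eqVlt; apply/orP; left; apply/eqP; field; rewrite gt_eqF.
Qed.

(** [h - p] is itself a uniform limit of polynomials, so its difference quotients at [z] are at most
    2 e / (r' - r), and so is its derivative. *)
Lemma deriv_step (R : realType) (h : R[i] -> R[i]) (p : {poly R[i]}) (r r' e : R) z D :
  (forall d, 0 < d -> exists q : {poly R[i]},
     forall x, cmod x <= r' -> cmod (h x - q.[x]) <= d) ->
  (forall x, cmod x <= r' -> cmod (h x - p.[x]) <= e) ->
  r < r' -> cmod z <= r -> has_cderiv h z D ->
  cmod (D - (p^`()).[z]) <= 2 / (r' - r) * e.
Proof.
move=> hq he rr' hz hD; have d0 : 0 < r' - r by rewrite subr_gt0.
apply/ler_addgt0Pr => t t0.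
have t2 : 0 < t / 2 by rewrite divr_gt0.
have [d1 d10 H1] := hD _ t2; have [d2 d20 H2] := has_cderiv_horner p z t2.
pose k := Num.min (Num.min d1 d2) (r' - r) / 2.
have k0 : 0 < k by rewrite divr_gt0// !lt_min d10 d20.
have [k1 k2 k3] : [/\ k < d1, k < d2 & k <= r' - r].
  have : 0 < Num.min (Num.min d1 d2) (r' - r) by rewrite !lt_min d10 d20.
  have : Num.min (Num.min d1 d2) (r' - r) <= d1 by rewrite !ge_min lexx.
  have : Num.min (Num.min d1 d2) (r' - r) <= d2 by rewrite !ge_min lexx orbT.
  have : Num.min (Num.min d1 d2) (r' - r) <= r' - r by rewrite !ge_min lexx !orbT.
  rewrite /k; move: (Num.min _ _) => m *; split; lra.
have hk : cmod k%:C = k by rewrite cmod_real gtr0_norm.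
have l1 := H1 k%:C; rewrite hk in l1; have {}l1 := l1 k1.
have l2 := H2 k%:C; rewrite hk in l2; have {}l2 := l2 k2.
have l3 : cmod ((h (z + k%:C) - p.[z + k%:C]) - (h z - p.[z])) <= 2 * e / (r' - r) * k.
  rewrite -[in leRHS]hk.
  apply: (@poly_limit_lipschitz R (fun x => h x - p.[x]) r r') => //; last by rewrite hk.
  move=> d dp; have [q hqd] := hq d dp; exists (q - p) => x hx.
  rewrite hornerD hornerN (_ : _ - _ = h x - q.[x]); first exact: hqd.
  by ring.
rewrite -(ler_pM2r k0) -[in leLHS]hk -cmodM.
have -> : (D - (p^`()).[z]) * k%:C
  = ((h (z + k%:C) - p.[z + k%:C]) - (h z - p.[z]))
   - (h (z + k%:C) - h z - D * k%:C) + (p.[z + k%:C] - p.[z] - (p^`()).[z] * k%:C) by ring.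
apply: le_trans (cmodD _ _) _; apply: le_trans (lerD (cmodB _ _) (lexx _)) _.
apply: le_trans (lerD (lerD l3 l1) l2) _.
rewrite [leRHS]mulrDl (mulrAC 2 _ e) -addrA lerD2l; lra.
Qed.

(* The terms with a < s or b < t vanish since a ^_ s = 0 for a < s. *)
Definition bipolyD (R : realType) (s t n : nat) (c : nat -> nat -> R[i]) (z w : R[i]) : R[i] :=
  \sum_(a < n) \sum_(b < n) c a b
     * ((z ^+ (a - s) *+ (a ^_ s)) * (w ^+ (b - t) *+ (b ^_ t))).

Lemma bipolyD00 (R : realType) n (c : nat -> nat -> R[i]) z w :
  bipolyD 0 0 n c z w = bipoly n c z w.
Proof.
apply: eq_bigr => a _; apply: eq_bigr => b _.
by rewrite !subn0 !ffactn0 !mulr1n.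
Qed.

Lemma deriv_ffact (F : fieldType) (a s : nat) :
  ('X^(a - s) *+ (a ^_ s) : {poly F})^`() = 'X^(a - s.+1) *+ (a ^_ s.+1).
Proof.
rewrite derivMn derivXn -mulrnA subnS; congr (_ *+ _).
by rewrite ffactnSr mulnC.
Qed.

Lemma bipolyD_slice_l (R : realType) s t n (c : nat -> nat -> R[i]) w :
  exists2 p : {poly R[i]}, (forall z, bipolyD s t n c z w = p.[z])
    & (forall z, bipolyD s.+1 t n c z w = (p^`()).[z]).
Proof.
exists (\sum_(a < n) \sum_(b < n) (c a b * (w ^+ (b - t) *+ (b ^_ t))) *: ('X^(a - s) *+ (a ^_ s))).
  move=> z; rewrite horner_sum; apply: eq_bigr => a _.
  rewrite horner_sum; apply: eq_bigr => b _.
  by rewrite hornerZ hornerMn hornerXn -mulrA [_ * (w ^+ _ *+ _)]mulrC.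
move=> z; rewrite raddf_sum horner_sum; apply: eq_bigr => a _.
rewrite raddf_sum horner_sum; apply: eq_bigr => b _.
by rewrite /= derivZ deriv_ffact hornerZ hornerMn hornerXn -mulrA [_ * (w ^+ _ *+ _)]mulrC.
Qed.

Lemma bipolyD_slice_r (R : realType) s t n (c : nat -> nat -> R[i]) z :
  exists2 p : {poly R[i]}, (forall w, bipolyD s t n c z w = p.[w])
    & (forall w, bipolyD s t.+1 n c z w = (p^`()).[w]).
Proof.
exists (\sum_(a < n) \sum_(b < n) (c a b * (z ^+ (a - s) *+ (a ^_ s))) *: ('X^(b - t) *+ (b ^_ t))).
  move=> w; rewrite horner_sum; apply: eq_bigr => a _.
  rewrite horner_sum; apply: eq_bigr => b _.
  by rewrite hornerZ hornerMn hornerXn -mulrA.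
move=> w; rewrite raddf_sum horner_sum; apply: eq_bigr => a _.
rewrite raddf_sum horner_sum; apply: eq_bigr => b _.
by rewrite /= derivZ deriv_ffact hornerZ hornerMn hornerXn -mulrA.
Qed.

Definition near_on (R : realType) (r e : R) (f g : R[i] -> R[i] -> R[i]) :=
  forall z w, cmod z <= r -> cmod w <= r -> cmod (f z w - g z w) <= e.

(** [K] and [r'] do not depend on the approximant, so one polynomial can serve f and all its
    derivatives. The induction on [t] lies inside the case [s = 0] because [partial] differentiates
    in [w] first. *)
Lemma deriv_approx (R : realType) (m : nat) (d : nat -> nat -> R[i] -> R[i] -> R[i]) :
  (forall r e, 0 <= r < 1 -> 0 < e -> exists n c, near_on r e (d 0%N 0%N) (bipoly n c)) ->
  (forall s t z w, (s + t < m)%N -> cmod z < 1 -> cmod w < 1 ->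
     has_cderiv (d s t ^~ w) z (d s.+1 t z w)) ->
  (forall t z w, (t < m)%N -> cmod z < 1 -> cmod w < 1 ->
     has_cderiv (d 0%N t z) w (d 0%N t.+1 z w)) ->
  forall s t, (s + t <= m)%N -> forall r, 0 <= r < 1 ->
  exists K r', [/\ 0 < K, 0 <= r' < 1 &
    forall n c e, near_on r' e (d 0%N 0%N) (bipoly n c) ->
      near_on r (K * e) (d s t) (bipolyD s t n c)].
Proof.
move=> hf hz hw s t.
(* one more derivative in one variable, from radius (1 + r) / 2 to radius r *)
have approx s' t' r : 0 <= r < 1 ->
    (forall r, 0 <= r < 1 -> exists K r', [/\ 0 < K, 0 <= r' < 1 &
    forall n c e, near_on r' e (d 0%N 0%N) (bipoly n c) ->
      near_on r (K * e) (d s' t') (bipolyD s' t' n c)]) ->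
    forall e, 0 < e -> exists n c, near_on r e (d s' t') (bipolyD s' t' n c).
  move=> hr IH e e0; have [K [r' [K0 hr' H]]] := IH r hr.
  have [n [c hn]] := hf r' (e / K) hr' (divr_gt0 e0 K0).
  by exists n, c; have := H _ _ _ hn; rewrite mulrCA divff ?mulr1// gt_eqF.
elim: s t => [|s IHs] t.
  elim: t => [_ r hr|t IH hm r /andP[r0 r1]].
    exists 1, r; split => // n c e h z w hz' hw'.
    by rewrite bipolyD00 mul1r; exact: h.
  pose r1' := (1 + r) / 2; have hr1 : 0 <= r1' < 1 by rewrite /r1'; apply/andP; split; lra.
  have rr : r < r1' by rewrite /r1'; lra.
  have IH' := IH (ltnW hm); have happ := approx _ _ _ hr1 IH'.
  have [K [r' [K0 hr' H]]] := IH' r1' hr1.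
  exists (2 / (r1' - r) * K), r'; split => //.
    by rewrite mulr_gt0// divr_gt0// subr_gt0.
  move=> n c e hn z w hz1 hw1; have [p pE p'E] := bipolyD_slice_r 0 t n c z.
  have hz2 : cmod z <= r1' by exact: le_trans hz1 (ltW rr).
  rewrite p'E -(mulrA _ K e); apply: (@deriv_step R (d 0%N t z) p r r1' (K * e) w _ _ _ rr hw1 _).
  - move=> e' e'0; have [n' [c' hn']] := happ e' e'0.
    have [q qE _] := bipolyD_slice_r 0 t n' c' z.
    by exists q => x hx; rewrite -qE; exact: hn'.
  - by move=> x hx; rewrite -pE; exact: H hn _ _ hz2 hx.
  - apply: hw => //; [exact: le_lt_trans hz1 r1 | exact: le_lt_trans hw1 r1].
move=> hm r /andP[r0 r1].
pose r1' := (1 + r) / 2; have hr1 : 0 <= r1' < 1 by rewrite /r1'; apply/andP; split; lra.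
have rr : r < r1' by rewrite /r1'; lra.
have IH' := IHs t (ltnW hm); have happ := approx _ _ _ hr1 IH'.
have [K [r' [K0 hr' H]]] := IH' r1' hr1.
exists (2 / (r1' - r) * K), r'; split => //.
  by rewrite mulr_gt0// divr_gt0// subr_gt0.
move=> n c e hn z w hz1 hw1; have [p pE p'E] := bipolyD_slice_l s t n c w.
have hw2 : cmod w <= r1' by exact: le_trans hw1 (ltW rr).
rewrite p'E -(mulrA _ K e); apply: (@deriv_step R (d s t ^~ w) p r r1' (K * e) z _ _ _ rr hz1 _).
- move=> e' e'0; have [n' [c' hn']] := happ e' e'0.
  have [q qE _] := bipolyD_slice_l s t n' c' w.
  by exists q => x hx; rewrite -qE; exact: hn'.
- by move=> x hx; rewrite -pE; exact: H hn _ _ hx hw2.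
- apply: hz => //; [exact: le_lt_trans hz1 r1 | exact: le_lt_trans hw1 r1].
Qed.

(** * Polynomial approximation by total degree *)

(** Brings estimates on a smaller bidisk to the closed one by dilation. *)
Definition radially_continuous (R : realType) (G : R[i] -> R[i] -> R[i]) :=
  forall e : R, 0 < e -> exists2 r0 : R, 0 <= r0 < 1 &
    forall r z w, r0 <= r < 1 -> cmod z <= 1 -> cmod w <= 1 ->
      cmod (G (r%:C * z) (r%:C * w) - G z w) <= e.

(* The bound L |h|^gamma, in a form linear in |u - 1| at each scale delta. *)
Definition circular_lip (R : realType) (gamma : R) (G : R[i] -> R[i] -> R[i]) :=
  exists2 L : R, 0 <= L & forall (delta : R) u z w, 0 < delta <= 1 ->
    cmod u = 1 -> cmod z = 1 -> cmod w = 1 ->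
    cmod (G (u * z) (u * w) - G z w) <= L * (delta `^ gamma * (1 + cmod (u - 1) / delta)).

(** [G] is the result of applying the multiplier [W] to [f]; as [f] comes without coefficients, this
    is said through its polynomial approximants, uniformly in them. *)
Definition weight_limit (R : realType) (f : R[i] -> R[i] -> R[i])
    (W : nat -> nat -> nat) (G : R[i] -> R[i] -> R[i]) :=
  forall r : R, 0 <= r < 1 -> exists K r', [/\ 0 < K, 0 <= r' < 1 &
    forall n c e, near_on r' e f (bipoly n c) ->
      near_on r (K * e) G (bipoly n (fun a b => (W a b)%:R * c a b))].

(** Closed under sums and natural multiples, which carries regularity from products of falling
    factorials to (a + b)^m. *)
Definition regular_weight (R : realType) (gamma : R) (f : R[i] -> R[i] -> R[i])
    (W : nat -> nat -> nat) :=
  exists G, [/\ radially_continuous G, circular_lip gamma G & weight_limit f W G].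

Lemma near_on_le (R : realType) (r r' e e' : R) (f g : R[i] -> R[i] -> R[i]) :
  r <= r' -> e' <= e -> near_on r' e' f g -> near_on r e f g.
Proof.
by move=> rr ee h z w hz hw; apply: le_trans (h _ _ _ _) ee; apply: le_trans rr.
Qed.

Lemma radially_continuousD (R : realType) (G1 G2 : R[i] -> R[i] -> R[i]) :
  radially_continuous G1 -> radially_continuous G2 ->
  radially_continuous (fun z w => G1 z w + G2 z w).
Proof.
move=> h1 h2 e e0; have e2 : 0 < e / 2 by rewrite divr_gt0.
have [r1 /andP[r10 r11] H1] := h1 _ e2; have [r2 /andP[r20 r21] H2] := h2 _ e2.
exists (Num.max r1 r2); first by rewrite le_max r10 gt_max r11.
move=> r z w; rewrite ge_max => /andP[/andP[l1 l2] l3] hz hw.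
have := H1 r z w; rewrite l1 l3 => /(_ isT hz hw) {}H1.
have := H2 r z w; rewrite l2 l3 => /(_ isT hz hw) {}H2.
rewrite (_ : _ - _ = (G1 (r%:C * z) (r%:C * w) - G1 z w) + (G2 (r%:C * z) (r%:C * w) - G2 z w)); last by ring.
by apply: le_trans (cmodD _ _) _; lra.
Qed.

Lemma regular_weightD (R : realType) (gamma : R) (f : R[i] -> R[i] -> R[i]) W1 W2 :
  regular_weight gamma f W1 -> regular_weight gamma f W2 ->
  regular_weight gamma f (fun a b => W1 a b + W2 a b)%N.
Proof.
move=> [G1 [c1 [L1 L10 l1] a1]] [G2 [c2 [L2 L20 l2] a2]].
exists (fun z w => G1 z w + G2 z w); split.
- exact: radially_continuousD.
- exists (L1 + L2); first exact: addr_ge0.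
  move=> delta u z w hd hu hz hw.
  rewrite (_ : _ - _ = (G1 (u * z) (u * w) - G1 z w) + (G2 (u * z) (u * w) - G2 z w)); last by ring.
  by apply: le_trans (cmodD _ _) _; rewrite mulrDl; apply: lerD; [exact: l1 | exact: l2].
- move=> r hr; have [K1 [r1 [K10 /andP[r10 r11] H1]]] := a1 r hr.
  have [K2 [r2 [K20 /andP[r20 r21] H2]]] := a2 r hr.
  exists (K1 + K2), (Num.max r1 r2); split; first exact: addr_gt0.
    by rewrite le_max r10 gt_max r11.
  move=> n c e h z w hz hw.
  have {}H1 := H1 n c e (near_on_le (_ : r1 <= _) (lexx e) h) z w hz hw.
  have {}H2 := H2 n c e (near_on_le (_ : r2 <= _) (lexx e) h) z w hz hw.
  rewrite mulrDl; apply: le_trans (lerD (H1 _) (H2 _)); rewrite ?le_max ?lexx ?orbT//.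
  rewrite (_ : bipoly n _ z w = bipoly n (fun a b => (W1 a b)%:R * c a b) z w
     + bipoly n (fun a b => (W2 a b)%:R * c a b) z w).
    by rewrite opprD addrACA; exact: cmodD.
  rewrite /bipoly -big_split; apply: eq_bigr => a _; rewrite -big_split.
  by apply: eq_bigr => b _; rewrite /= natrD !mulrDl.
Qed.

Lemma regular_weight_mulrn (R : realType) (gamma : R) (f : R[i] -> R[i] -> R[i]) W k :
  regular_weight gamma f W -> regular_weight gamma f (fun a b => k * W a b)%N.
Proof.
move=> hW; elim: k => [|k IH]; last first.
  have := regular_weightD hW IH; congr regular_weight.
exists (fun _ _ => 0); split.
- move=> e e0; exists 0; first by rewrite lexx ltr01.
  by move=> *; rewrite subrr cmod0 ltW.
- by exists 0 => // *; rewrite subrr cmod0 mul0r.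
- move=> r /andP[r0 r1]; exists 1, r; split=> //; first by rewrite r0.
  move=> n c e h z w hz hw.
  rewrite /bipoly big1 ?subrr ?cmod0 ?mul1r.
    by apply: le_trans (h z w hz hw); exact: cmod_ge0.
  by move=> a _; rewrite big1// => b _; rewrite mul0n !mul0r.
Qed.

Lemma eq_regular_weight (R : realType) (gamma : R) (f : R[i] -> R[i] -> R[i]) W W' :
  (forall a b, W a b = W' a b) -> regular_weight gamma f W -> regular_weight gamma f W'.
Proof. by move=> h; congr regular_weight; apply/funext => a; apply/funext => b. Qed.

Lemma cmod_subX_le (R : rcfType) (x y : R[i]) n : cmod x <= 1 -> cmod y <= 1 ->
  cmod (x ^+ n - y ^+ n) <= n%:R * cmod (x - y).
Proof.
move=> hx hy; elim: n => [|n IH]; first by rewrite subrr cmod0 mul0r.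
rewrite !exprS (_ : _ - _ = x * (x ^+ n - y ^+ n) + (x - y) * y ^+ n); last by ring.
apply: le_trans (cmodD _ _) _; rewrite !cmodM -natr1 mulrDl mul1r; apply: lerD.
  by apply: le_trans IH; rewrite ler_piMl ?cmod_ge0.
by rewrite ler_piMr ?cmod_ge0// cmodX exprn_ile1 ?cmod_ge0.
Qed.

Lemma monomial_mul_diff (R : rcfType) (B : R) s t (z w z' w' g g' : R[i]) :
  cmod z <= 1 -> cmod w <= 1 -> cmod z' <= 1 -> cmod w' <= 1 -> cmod g <= B ->
  cmod (z' ^+ s * w' ^+ t * g' - z ^+ s * w ^+ t * g)
  <= cmod (g' - g) + (s%:R * cmod (z' - z) + t%:R * cmod (w' - w)) * B.
Proof.
move=> hz hw hz' hw' hg.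
have B0 : 0 <= B by apply: le_trans hg; exact: cmod_ge0.
have hX (x : R[i]) n : cmod x <= 1 -> cmod (x ^+ n) <= 1.
  by move=> hx; rewrite cmodX exprn_ile1 ?cmod_ge0.
rewrite (_ : _ - _ = z' ^+ s * w' ^+ t * (g' - g)
  + ((z' ^+ s - z ^+ s) * w' ^+ t + z ^+ s * (w' ^+ t - w ^+ t)) * g); last by ring.
apply: le_trans (cmodD _ _) _; apply: lerD.
  rewrite cmodM ler_piMl ?cmod_ge0// cmodM mulr_ile1 ?cmod_ge0 ?hX//.
rewrite cmodM; apply: ler_pM; rewrite ?cmod_ge0//.
apply: le_trans (cmodD _ _) _; rewrite !cmodM; apply: lerD.
  apply: le_trans (cmod_subX_le s hz' hz); by rewrite ler_piMr ?cmod_ge0 ?hX.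
apply: le_trans (cmod_subX_le t hw' hw); by rewrite ler_piMl ?cmod_ge0 ?hX.
Qed.

Lemma bipolyD_monomial (R : realType) s t n (c : nat -> nat -> R[i]) z w :
  z ^+ s * w ^+ t * bipolyD s t n c z w
  = bipoly n (fun a b => (a ^_ s * b ^_ t)%N%:R * c a b) z w.
Proof.
have E (x : R[i]) a k : x ^+ k * (x ^+ (a - k) *+ (a ^_ k)) = (a ^_ k)%:R * x ^+ a.
  have [ka|ak] := leqP k a; last by rewrite ffact_small// mulr0n mul0r mulr0.
  by rewrite mulrnAr -exprD subnKC// mulr_natl.
rewrite /bipolyD /bipoly mulr_sumr; apply: eq_bigr => a _.
rewrite mulr_sumr; apply: eq_bigr => b _.
rewrite mulrCA mulrACA !E natrM; move: (a ^_ s)%:R (b ^_ t)%:R => x y; ring.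
Qed.

(** This multiplier is z^s w^t times a partial derivative, and [g] is the extension of that
    derivative. The factor z^s w^t is Lipschitz, which fits the bound at scale delta because delta
    <= delta^gamma. *)
Lemma regular_weight_ffact (R : realType) (gamma B : R) (f g d : R[i] -> R[i] -> R[i]) s t :
  gamma <= 1 ->
  radially_continuous g -> circular_lip gamma g ->
  (forall z w, cmod z <= 1 -> cmod w <= 1 -> cmod (g z w) <= B) ->
  (forall z w, cmod z < 1 -> cmod w < 1 -> d z w = g z w) ->
  (forall r, 0 <= r < 1 -> exists K r', [/\ 0 < K, 0 <= r' < 1 &
    forall n c e, near_on r' e f (bipoly n c) -> near_on r (K * e) d (bipolyD s t n c)]) ->
  regular_weight gamma f (fun a b => a ^_ s * b ^_ t)%N.
Proof.
move=> g1 hc [L L0 hL] hB hdg hd.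
have B0 : 0 <= B by apply: le_trans (hB 0 0 _ _); rewrite ?cmod_ge0 ?cmod0.
exists (fun z w => z ^+ s * w ^+ t * g z w); split.
- move=> e e0; have e2 : 0 < e / 2 by rewrite divr_gt0.
  have [r1 /andP[r10 r11] H1] := hc _ e2.
  pose C := (s%:R + t%:R) * B + 1.
  have C0 : 0 < C by rewrite ltr_wpDl// mulr_ge0// addr_ge0.
  exists (Num.max r1 (1 - e / 2 / C)).
    by rewrite le_max r10 gt_max r11 /= gtrBl divr_gt0.
  move=> r z w; rewrite ge_max => /andP[/andP[l1 l2] l3] hz hw.
  have r0 : 0 <= r by exact: le_trans l1.
  have hr : cmod r%:C = r by rewrite cmod_real ger0_norm.
  have hrx (x : R[i]) : cmod x <= 1 -> cmod (r%:C * x) <= 1.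
    by move=> hx; rewrite cmodM hr mulr_ile1 ?cmod_ge0 ?(ltW l3).
  have hdx (x : R[i]) : cmod x <= 1 -> cmod (r%:C * x - x) <= 1 - r.
    move=> hx; have -> : r%:C * x - x = - ((1 - r)%:C * x) by rewrite rmorphB rmorph1; ring.
    by rewrite cmodN cmodM cmod_real ger0_norm ?subr_ge0 ?(ltW l3)// ler_piMr ?subr_ge0 ?(ltW l3).
  apply: le_trans (monomial_mul_diff s t _ hz hw (hrx _ hz) (hrx _ hw) (hB _ _ hz hw)) _.
  rewrite [leRHS]splitr; apply: lerD; first by apply: H1 => //; rewrite l1.
  apply: le_trans (_ : (1 - r) * C <= _).
    rewrite /C mulrDr mulr1 ler_wpDr ?subr_ge0 ?(ltW l3)// mulrA ler_wpM2r//.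
    have := ler_wpM2l (ler0n R s) (hdx _ hz); have := ler_wpM2l (ler0n R t) (hdx _ hw).
    lra.
  by rewrite -ler_pdivlMr//; lra.
- exists (L + (s%:R + t%:R) * B); first by rewrite addr_ge0// mulr_ge0// addr_ge0.
  move=> delta u z w hdel hu hz hw.
  have huz : cmod (u * z) <= 1 by rewrite cmodM hu hz mulr1.
  have huw : cmod (u * w) <= 1 by rewrite cmodM hu hw mulr1.
  have hz1 : cmod z <= 1 by rewrite hz. have hw1 : cmod w <= 1 by rewrite hw.
  apply: le_trans (monomial_mul_diff s t _ hz1 hw1 huz huw (hB _ _ hz1 hw1)) _.
  rewrite [leRHS]mulrDl; apply: lerD; first exact: hL.
  have dx (x : R[i]) : cmod x = 1 -> cmod (u * x - x) = cmod (u - 1).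
    by move=> hx; rewrite -{2}[x]mul1r -mulrBl cmodM hx mulr1.
  rewrite !dx// -mulrDl mulrAC ler_wpM2l ?mulr_ge0 ?addr_ge0//.
  have hdg1 := ger1_powR hdel g1; case/andP: hdel => d0 d1.
  rewrite -{1}(divfK (lt0r_neq0 d0) (cmod (u - 1))) mulrC.
  by apply: ler_pM; rewrite ?divr_ge0 ?cmod_ge0 ?(ltW d0)// ler_wpDl.
- move=> r hr; have [K [r' [K0 hr' H]]] := hd r hr; exists K, r'; split => //.
  move=> n c e h z w hz hw; rewrite -bipolyD_monomial.
  case/andP: hr => r0 r1.
  have hz1 : cmod z < 1 := le_lt_trans hz r1.
  have hw1 : cmod w < 1 := le_lt_trans hw r1.
  rewrite -hdg// -mulrBr; apply: le_trans (H n c e h z w hz hw).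
  rewrite cmodM ler_piMl ?cmod_ge0// cmodM !cmodX mulr_ile1 ?exprn_ge0 ?cmod_ge0//.
    by rewrite exprn_ile1 ?cmod_ge0 ?ltW.
  by rewrite exprn_ile1 ?cmod_ge0 ?ltW.
Qed.

(** By a * a^_k = a^_(k+1) + k * a^_k, each factor a + b is traded for raised falling factorials
    with natural coefficients; [i] counts the factors still to be expanded. *)
Lemma regular_weight_degree (R : realType) (gamma : R) (f : R[i] -> R[i] -> R[i]) m :
  (forall s t, (s + t <= m)%N -> regular_weight gamma f (fun a b => a ^_ s * b ^_ t)%N) ->
  regular_weight gamma f (fun a b => (a + b) ^ m)%N.
Proof.
move=> h; suff H i s t : (i + (s + t) <= m)%N ->
    regular_weight gamma f (fun a b => (a + b) ^ i * (a ^_ s * b ^_ t))%N.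
  have := H m 0%N 0%N; rewrite !addn0 => /(_ (leqnn m)).
  by apply: eq_regular_weight => a b; rewrite !ffactn0 !muln1.
have mul_ffact a k : (a * a ^_ k = a ^_ k.+1 + k * a ^_ k)%N.
  have [ka|ak] := leqP k a; last by rewrite !ffact_small ?muln0// ltnW.
  by rewrite ffactnSr [(_ ^_ _ * _)%N]mulnC -mulnDl subnK.
elim: i s t => [|i IH] s t hst.
  have := h s t hst; apply: eq_regular_weight => a b; by rewrite expn0 mul1n.
have := regular_weightD (regular_weightD (IH s.+1 t _) (IH s t.+1 _))
  (regular_weight_mulrn (s + t) (IH s t _)).
have [hs ht hst'] : [/\ (i + (s.+1 + t) <= m)%N, (i + (s + t.+1) <= m)%N & (i + (s + t) <= m)%N].
  by split; lia.
move=> /(_ hs ht hst').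
apply: eq_regular_weight => a b.
transitivity ((a + b) ^ i * ((a ^_ s.+1 + s * a ^_ s) * b ^_ t
  + a ^_ s * (b ^_ t.+1 + t * b ^_ t)))%N; first by ring.
by rewrite -!mul_ffact expnSr; ring.
Qed.

(** * Slices through the origin and total degree *)

Lemma bipoly_max_principle (R : realType) n (c : nat -> nat -> R[i]) (B : R) z w :
  (forall x y, cmod x = 1 -> cmod y = 1 -> cmod (bipoly n c x y) <= B) ->
  cmod z <= 1 -> cmod w <= 1 -> cmod (bipoly n c z w) <= B.
Proof.
move=> hB hz hw.
have hx x y : cmod x = 1 -> cmod y <= 1 -> cmod (bipoly n c x y) <= B.
  move=> hx hy; have [p pE _] := bipolyD_slice_r 0 0 n c x.
  rewrite -bipolyD00 pE; apply: poly_max_principle hy => y' hy'.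
  by rewrite -pE bipolyD00; apply: hB.
have [p pE _] := bipolyD_slice_l 0 0 n c w.
rewrite -bipolyD00 pE; apply: poly_max_principle hz => x hx'.
by rewrite -pE bipolyD00; apply: hx.
Qed.

(** The slice u |-> P(u z, u w), graded by the homogeneous parts of P. *)
Definition diagonal_poly (R : realType) n (c : nat -> nat -> R[i]) (z w : R[i]) : {poly R[i]} :=
  \sum_(a < n) \sum_(b < n) (c a b * (z ^+ a * w ^+ b)) *: 'X^(a + b).

Lemma coef_weight_sum (R : rcfType) (mu : nat -> R) n (p : 'I_n -> {poly R[i]}) :
  coef_weight mu (\sum_(i < n) p i) = \sum_(i < n) coef_weight mu (p i).
Proof.
apply/polyP => k; rewrite coef_coef_weight !coef_sum mulr_sumr.
by apply: eq_bigr => i _; rewrite coef_coef_weight.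
Qed.

Lemma coef_weight_monomial (R : rcfType) (mu : nat -> R) k (x : R[i]) :
  coef_weight mu (x *: 'X^k) = ((mu k)%:C * x) *: 'X^k.
Proof.
apply/polyP => j; rewrite coef_coef_weight !coefZ coefXn mulrA.
by case: eqVneq => [->|]//; rewrite !mulr0.
Qed.

Lemma horner_diagonal_poly (R : realType) (mu : nat -> R) n (c : nat -> nat -> R[i]) z w u :
  (coef_weight mu (diagonal_poly n c z w)).[u]
  = bipoly n (fun a b => (mu (a + b)%N)%:C * c a b) (u * z) (u * w).
Proof.
rewrite coef_weight_sum horner_sum; apply: eq_bigr => a _.
rewrite coef_weight_sum horner_sum; apply: eq_bigr => b _.
rewrite coef_weight_monomial hornerZ hornerXn !exprMn exprD.
by move: (_%:C) => v; ring.
Qed.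

Lemma bipoly_jackson (R : realType) s m n (c : nat -> nat -> R[i]) (A B : R) :
  (0 < s)%N -> 0 <= A -> 0 <= B ->
  (forall u z w, cmod u = 1 -> cmod z = 1 -> cmod w = 1 ->
    cmod (bipoly n (fun a b => ((a + b) ^ m)%N%:R * c a b) (u * z) (u * w)
        - bipoly n (fun a b => ((a + b) ^ m)%N%:R * c a b) z w) <= A + B * cmod (u - 1)) ->
  exists c', (forall a b, c' a b != 0 -> (a + b < s.*2.-1)%N) /\
    near_on 1 ((3 / s%:R) ^+ m * (A + B * (3 / s%:R))) (bipoly n c) (bipoly n c').
Proof.
move=> s0 A0 B0 h.
pose mu k := (1 - jackson_coef R s k) ^+ m.+1.
(* From degree 2 s - 1 on the Jackson coefficient vanishes, so [mu] is 1 and the term is dropped. *)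
exists (fun a b => (1 - mu (a + b)%N)%:C * c a b); split.
  move=> a b; rewrite ltnNge; apply: contraNN => hab.
  by rewrite /mu jackson_coef_eq0// subr0 expr1n subrr rmorph0 mul0r.
move=> z w hz hw.
have -> : bipoly n c z w - bipoly n (fun a b => (1 - mu (a + b)%N)%:C * c a b) z w
   = bipoly n (fun a b => (mu (a + b)%N)%:C * c a b) z w.
  rewrite /bipoly -sumrB; apply: eq_bigr => a _; rewrite -sumrB; apply: eq_bigr => b _.
  rewrite (_ : (1 - mu (a + b)%N)%:C = 1 - (mu (a + b)%N)%:C); last by rewrite rmorphB.
  by move: (mu _)%:C => v; ring.
apply: bipoly_max_principle hz hw => {}z {}w hz hw.
have := @jackson R s m (diagonal_poly n c z w) A B s0 A0 B0.
have -> : coef_weight (fun k => k%:R ^+ m) (diagonal_poly n c z w)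
   = coef_weight (fun k => (k ^ m)%N%:R) (diagonal_poly n c z w).
  by apply/polyP => k; rewrite !coef_coef_weight natrX.
move=> H; have := H _ 1; rewrite horner_diagonal_poly !mul1r; apply.
  move=> y u hy hu; rewrite !horner_diagonal_poly.
  have E (x x' : R[i]) : bipoly n (fun a b => (((a + b) ^ m)%N%:R : R)%:C * c a b) x x'
      = bipoly n (fun a b => ((a + b) ^ m)%N%:R * c a b) x x'.
    by apply: eq_bigr => a _; apply: eq_bigr => b _; rewrite rmorph_nat.
  rewrite !E (mulrC y u) -!mulrA; apply: h => //; rewrite cmodM hy ?hz ?hw mulr1//.
exact: cmod1.
Qed.

Lemma bipoly_dilate (R : realType) n (c : nat -> nat -> R[i]) (r : R[i]) z w :
  bipoly n (fun a b => r ^+ (a + b) * c a b) z w = bipoly n c (r * z) (r * w).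
Proof.
apply: eq_bigr => a _; apply: eq_bigr => b _; rewrite exprD !exprMn; ring.
Qed.

(** The accuracy [e] is fixed first, then a radius at which dilation costs at most [e] for both [f]
    and [G], then a polynomial of arbitrary degree close to both at that radius; only then does the
    Jackson operator cut the degree. *)
Lemma total_degree_approx (R : realType) (gamma : R) m (f : R[i] -> R[i] -> R[i]) :
  radially_continuous f ->
  (forall r e, 0 <= r < 1 -> 0 < e -> exists n c, near_on r e f (bipoly n c)) ->
  regular_weight gamma f (fun a b => (a + b) ^ m)%N ->
  exists2 C : R, 0 <= C & forall s, (0 < s)%N -> exists n c,
    (forall a b, c a b != 0 -> (a + b < s.*2.-1)%N) /\
    near_on 1 (C * (s%:R^-1 ^+ m * s%:R^-1 `^ gamma)) f (bipoly n c).
Proof.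
move=> fc fa [G [Gc [L L0 GL] Ga]].
(* 2 e for the dilated polynomial, then (3 t)^m (4 e + L t^gamma + 3 L t^gamma) for the kernel at
   scale t = 1 / s, with e <= t^gamma. *)
exists (2 + 3 ^+ m * (4 + 4 * L)); first by rewrite addr_ge0// mulr_ge0 ?exprn_ge0// addr_ge0// mulr_ge0.
move=> s s0; have sR : 0 < s%:R :> R by rewrite ltr0n.
set t : R := s%:R^-1; have t0 : 0 < t by rewrite invr_gt0.
have t1 : t <= 1 by rewrite invf_le1// ler1n.
have tg : 0 < t `^ gamma by rewrite powR_gt0.
set e := t ^+ m * t `^ gamma; have e0 : 0 < e by rewrite mulr_gt0// exprn_gt0.
have ee : e <= t `^ gamma by rewrite ler_piMl ?(ltW tg)// exprn_ile1// ltW.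
have [r1 /andP[r10 r11] H1] := fc e e0; have [r2 /andP[r20 r21] H2] := Gc e e0.
pose r := Num.max r1 r2.
have r01 : 0 <= r < 1 by rewrite /r le_max r10 gt_max r11.
have [K [r' [K0 /andP[r'0 r'1] H3]]] := Ga r r01.
have eK : 0 < Num.min e (e / K) by rewrite lt_min e0 divr_gt0.
have hr' : 0 <= Num.max r r' < 1 by rewrite le_max r'0 orbT gt_max r'1; case/andP: r01 => _ ->.
have [n [c hn]] := fa _ _ hr' eK.
have hfP : near_on r e f (bipoly n c).
  apply: (near_on_le _ _ hn); first by rewrite le_max lexx.
  by rewrite ge_min lexx.
have hGP : near_on r e G (bipoly n (fun a b => ((a + b) ^ m)%N%:R * c a b)).
  have -> : e = K * (e / K) by rewrite mulrCA divff ?mulr1// gt_eqF.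
  apply: H3; apply: (near_on_le _ _ hn); first by rewrite le_max lexx orbT.
  by rewrite ge_min lexx orbT.
have r0 : 0 <= r by case/andP: r01.
have hrx (x : R[i]) : cmod x <= 1 -> cmod (r%:C * x) <= r.
  by move=> hx; rewrite cmodM cmod_real ger0_norm// ler_piMr.
have hr1 : r1 <= r < 1 by rewrite /r le_max lexx; case/andP: r01.
have hr2 : r2 <= r < 1 by rewrite /r le_max lexx orbT; case/andP: r01.
pose c1 a b := r%:C ^+ (a + b) * c a b.
have hf1 : near_on 1 (2 * e) f (bipoly n c1).
  move=> z w hz hw; rewrite bipoly_dilate.
  rewrite (_ : f z w - _ = (f (r%:C * z) (r%:C * w) - bipoly n c (r%:C * z) (r%:C * w))
     - (f (r%:C * z) (r%:C * w) - f z w)); last by ring.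
  apply: le_trans (cmodB _ _) _.
  by have := H1 r z w hr1 hz hw; have := hfP _ _ (hrx _ hz) (hrx _ hw); lra.
have hG1 : near_on 1 (2 * e) G (bipoly n (fun a b => ((a + b) ^ m)%N%:R * c1 a b)).
  move=> z w hz hw.
  have -> : bipoly n (fun a b => ((a + b) ^ m)%N%:R * c1 a b) z w
    = bipoly n (fun a b => ((a + b) ^ m)%N%:R * c a b) (r%:C * z) (r%:C * w).
    rewrite -bipoly_dilate; apply: eq_bigr => a _; apply: eq_bigr => b _.
    by congr (_ * _); rewrite /c1 mulrCA.
  move: (bipoly n _ _ _) (hGP _ _ (hrx _ hz) (hrx _ hw)) => P hP.
  rewrite (_ : G z w - _ = (G (r%:C * z) (r%:C * w) - P)
     - (G (r%:C * z) (r%:C * w) - G z w)); last by ring.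
  apply: le_trans (cmodB _ _) _.
  by have := H2 r z w hr2 hz hw; lra.
have [||| c' [c'0 hc']] := @bipoly_jackson R s m n c1 (4 * e + L * t `^ gamma) (L * (t `^ gamma / t)) s0.
- by rewrite addr_ge0// mulr_ge0// ltW.
- by rewrite mulr_ge0// divr_ge0// ltW.
- move=> u z w hu hz hw.
  have hz1 : cmod z <= 1 by rewrite hz. have hw1 : cmod w <= 1 by rewrite hw.
  have huz : cmod (u * z) <= 1 by rewrite cmodM hu hz mulr1.
  have huw : cmod (u * w) <= 1 by rewrite cmodM hu hw mulr1.
  have := hG1 _ _ hz1 hw1; have := hG1 _ _ huz huw.
  move: (bipoly n _ z w) (bipoly n _ (u * z) (u * w)) => P Q hQ hP.
  rewrite (_ : Q - P = (G (u * z) (u * w) - G z w) - (G (u * z) (u * w) - Q) + (G z w - P)); last by ring.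
  apply: le_trans (cmodD _ _) _; apply: le_trans (lerD (cmodB _ _) (lexx _)) _.
  have ht : 0 < t <= 1 by rewrite t0.
  have := GL t u z w ht hu hz hw.
  rewrite (_ : L * (t `^ gamma * (1 + cmod (u - 1) / t))
     = L * t `^ gamma + L * (t `^ gamma / t) * cmod (u - 1)); first by lra.
  by field; rewrite gt_eqF.
exists n, c'; split => // z w hz hw.
rewrite (_ : f z w - _ = (f z w - bipoly n c1 z w) + (bipoly n c1 z w - bipoly n c' z w)); last by ring.
apply: le_trans (cmodD _ _) _; apply: le_trans (lerD (hf1 z w hz hw) (hc' z w hz hw)) _.
rewrite -/t [leRHS]mulrDl; apply: lerD; first by [].
rewrite -/t (_ : _ + L * (t `^ gamma / t) * (3 * t) = 4 * e + 4 * L * t `^ gamma); last first.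
  by field; rewrite gt_eqF.
rewrite exprMn -!mulrA ler_pM2l ?exprn_gt0// /e [leRHS]mulrCA ler_pM2l ?exprn_gt0//.
rewrite [leRHS]mulrDl; apply: lerD; last by rewrite !mulrA.
by rewrite ler_pM2l.
Qed.

(** * Compactness of the closed bidisk *)

Lemma nbhs_cmodP (R : realType) (x : Cplx R) (A : set (Cplx R)) :
  nbhs x A <-> exists2 d : R, 0 < d & forall y : R[i], cmod (y - x) < d -> A y.
Proof.
have normE (y : Cplx R) : `|y| = (cmod y)%:C :> R[i] by case: y.
split=> [h|[d d0 H]].
  have [e /= e0 H] := (@nbhs_normP _ _ x A).1 h.
  move: e0; rewrite ltcE /= => /andP[/eqP Ie Re0].
  exists (complex.Re e) => // y hy; apply: H; rewrite /= normE.
  rewrite cmod_distC in hy.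
  by rewrite ltcE /= Ie eqxx.
apply: (@nbhs_normP _ _ x A).2; exists (d%:C) => /=; first by rewrite ltcR.
by move=> y /=; rewrite normE ltcR => hy; apply: H; rewrite cmod_distC.
Qed.

Lemma nbhs_cmod2P (R : realType) (p : Cplx2 R) (A : set (Cplx2 R)) :
  nbhs p A <-> exists2 d : R, 0 < d &
    forall z w : R[i], cmod (z - p.1) < d -> cmod (w - p.2) < d -> A (z, w).
Proof.
split=> [[[P Q] /= [/nbhs_cmodP[d1 d10 H1] /nbhs_cmodP[d2 d20 H2]] H]|[d d0 H]].
  exists (Num.min d1 d2); first by rewrite lt_min d10.
  move=> z w; rewrite !lt_min => /andP[/H1 hz _] /andP[_ /H2 hw].
  exact: (H (z, w)).
exists ([set z : Cplx R | cmod (z - p.1) < d], [set w : Cplx R | cmod (w - p.2) < d]) => /=.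
  by split; apply/nbhs_cmodP; exists d.
by case=> z w /= [hz hw]; apply: H.
Qed.

Lemma cdiskE (R : realType) (z : R[i]) : cdisk R z <-> cmod z <= 1.
Proof.
split=> [hz|hz].
  rewrite leNgt; apply/negP => z1.
  have d0 : 0 < cmod z - 1 by rewrite subr_gt0.
  have : nbhs (z : Cplx R) [set y : Cplx R | cmod (y - z) < cmod z - 1].
    by apply/nbhs_cmodP; exists (cmod z - 1).
  move=> /hz[y [hy /= yz]]; have := cmodD y (z - y).
  by rewrite addrC subrK cmod_distC; rewrite /disk /= in hy; lra.
move=> A /nbhs_cmodP[d d0 H].
pose t := Num.min (1 / 2) (d / 2).
have [t0 t1 td] : [/\ 0 < t, t < 1 & t < d].
  have : t <= 1 / 2 by rewrite ge_min lexx.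
  have : t <= d / 2 by rewrite ge_min lexx orbT.
  have : 0 < t by rewrite lt_min !divr_gt0.
  by split; lra.
exists ((1 - t)%:C * z); split.
  rewrite /disk /= cmodM cmod_real ger0_norm ?subr_ge0 ?(ltW t1)//.
  have := cmod_ge0 z; nra.
apply: H; rewrite rmorphB rmorph1 mulrBl mul1r addrAC subrr add0r cmodN cmodM cmod_real.
by rewrite gtr0_norm//; have := cmod_ge0 z; nra.
Qed.

Lemma cbidiskE (R : realType) (z w : R[i]) :
  cbidisk R (z, w) <-> cmod z <= 1 /\ cmod w <= 1.
Proof.
split=> -[h1 h2]; first by split; [exact: (cdiskE z).1 h1 | exact: (cdiskE w).1 h2].
by split; [exact: (cdiskE z).2 h1 | exact: (cdiskE w).2 h2].
Qed.

Lemma nbhs_bidisk (R : realType) (p : Cplx2 R) : bidisk R p -> nbhs p (bidisk R).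
Proof.
case: p => z w [/= hz hw]; rewrite /disk /= in hz hw.
apply/nbhs_cmod2P; exists (Num.min (1 - cmod z) (1 - cmod w)).
  by rewrite lt_min !subr_gt0 hz.
move=> x y /=; rewrite !lt_min => /andP[hx _] /andP[_ hy].
split; rewrite /disk /=.
  by have := cmodD (x - z) z; rewrite subrK; lra.
by have := cmodD (y - w) w; rewrite subrK; lra.
Qed.

Lemma leja_unit_leja (R : realType) (eta : nat -> R[i]) :
  leja (cdisk R) eta -> unit_leja eta.
Proof.
move=> [hK [_ h0] hmax] K.
have h1 i : cmod (eta i) <= 1 by apply/cdiskE; exact: hK.
split.
- apply/eqP; rewrite eq_le h1 /= leNgt; apply/negP => lt1; apply: h0.
  apply/nbhs_cmodP; exists (1 - cmod (eta 0%N)); first by rewrite subr_gt0.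
  move=> y hy; apply/cdiskE; have := cmodD (y - eta 0%N) (eta 0%N).
  by rewrite subrK; lra.
- by move=> i _; exact: h1.
- move=> k /andP[k0 _] z hz; rewrite -(hmax k k0).
  apply: ub_le_sup; last by exists z => //; apply/cdiskE.
  exists (\prod_(i < k) 2) => _ [y /cdiskE hy <-].
  apply: ler_prod => i _; rewrite cmod_ge0 /=.
  by apply: le_trans (cmodB _ _) _; have := h1 i; lra.
Qed.

(** The continuous image of a rectangle under polar coordinates; [C * 2] bounds the angle since a
    chord is at most 2. *)
Lemma compact_cdisk (R : realType) : compact (cdisk R).
Proof.
have [C C0 hC] := expi_surj R.
pose phi (p : R * R) : Cplx R := p.1%:C * expi p.2.
have phic : continuous phi.
  move=> [s h] A /nbhs_cmodP[d d0 H].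
  pose e := d / (2 + `|s|).
  have K0 : 0 < 2 + `|s| by rewrite ltr_pwDl.
  have e0 : 0 < e by rewrite divr_gt0.
  exists (ball s e, ball h e); first by split; apply: nbhsx_ballx.
  move=> [s' h'] /= [hs hh]; apply: H; rewrite /phi /=.
  have hE : (expi h' : R[i]) = expi h * expi (h' - h) by rewrite -expiD addrC subrK.
  change (cmod (s'%:C * (expi h' : R[i]) - s%:C * (expi h : R[i])) < d).
  have -> : s'%:C * (expi h' : R[i]) - s%:C * (expi h : R[i])
      = (s' - s)%:C * (expi h' : R[i]) + s%:C * ((expi h : R[i]) * ((expi (h' - h) : R[i]) - 1)).
    by rewrite hE rmorphB; ring.
  apply: le_lt_trans (cmodD _ _) _; rewrite !cmodM !cmod_real !cmod_expi mulr1 mul1r.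
  have hd := cmod_expi_subr1_le (h' - h).
  have hs' : `|s' - s| < e by rewrite distrC.
  have hh' : `|h' - h| < e by rewrite distrC.
  have -> : d = e * 2 + `|s| * e by rewrite (mulrC `|s|) -mulrDr divfK// gt_eqF.
  apply: ltr_leD; first by lra.
  by rewrite ler_wpM2l//; lra.
have -> : cdisk R = phi @` (`[0, 1] `*` `[- (C * 2), C * 2]).
  apply/seteqP; split => [z /cdiskE hz|_ [[s h] /= [hs hh] <-]]; last first.
    apply/cdiskE; change (cmod (s%:C * (expi h : R[i])) <= 1); rewrite cmodM cmod_expi mulr1 cmod_real.
    by move: hs; rewrite in_itv /= => /andP[s0 s1]; rewrite ger0_norm.
  have [->|z0] := eqVneq z 0.
    exists (0, 0); last by rewrite /phi /= mul0r.
    by split; rewrite /= in_itv /= ?lexx ?ler01// oppr_le0 mulr_ge0 ?(ltW C0).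
  have cz : 0 < cmod z by rewrite lt_def cmod_eq0 z0 cmod_ge0.
  have hu : cmod (z / (cmod z)%:C) = 1.
    by rewrite cmodM cmodV cmod_real gtr0_norm// divff// gt_eqF.
  have [h uE hh] := hC _ hu.
  exists (cmod z, h); last first.
    rewrite /phi /= -uE mulrC divfK// -cmod_eq0 cmod_real normr_eq0 gt_eqF//.
  split; rewrite /= in_itv /=; first by rewrite cmod_ge0.
  rewrite -ler_norml; apply: le_trans hh _; rewrite ler_pM2l//.
  by apply: le_trans (cmodB _ _) _; rewrite hu cmod1; lra.
apply: continuous_compact; first exact: continuous_subspaceT.
by apply: compact_setX; exact: segment_compact.
Qed.

Lemma compact_cbidisk (R : realType) : compact (cbidisk R).
Proof. by apply: compact_setX; exact: compact_cdisk. Qed.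

Lemma within_cbidiskP (R : realType) (f : Cplx2 R -> Cplx R) (p : Cplx2 R) (e : R) :
  {within cbidisk R, continuous f} -> cbidisk R p -> 0 < e ->
  exists2 d : R, 0 < d & forall z w, cmod z <= 1 -> cmod w <= 1 ->
    cmod (z - p.1) < d -> cmod (w - p.2) < d -> cmod (f (z, w) - f p) < e.
Proof.
move=> /subspace_continuousP hf hp e0.
have : nbhs (f p) [set y : Cplx R | cmod (y - f p) < e] by apply/nbhs_cmodP; exists e.
move=> /(hf p hp)/nbhs_cmod2P[d d0 H]; exists d => // z w hz hw hz' hw'.
exact: H ((cbidiskE z w).2 (conj hz hw)).
Qed.

Lemma within_cbidisk_bounded (R : realType) (f : Cplx2 R -> Cplx R) :
  {within cbidisk R, continuous f} ->
  exists B : R, forall z w, cmod z <= 1 -> cmod w <= 1 -> cmod (f (z, w)) <= B.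
Proof.
move=> hf.
have := (@compact_near_coveringP _ (cbidisk R)).1 (@compact_cbidisk R) R (pinfty_nbhs R)
  (fun M p => cbidisk R p -> cmod (f p) <= M) _.
case.
- move=> p hp; have [d d0 H] := within_cbidiskP hf hp (@ltr01 R).
  exists ([set q : Cplx2 R | cbidisk R q -> cmod (f q) <= cmod (f p) + 1], [set M | cmod (f p) + 1 <= M]).
    split.
      apply/nbhs_cmod2P; exists d => // z w hz hw /= /cbidiskE[hz1 hw1].
      have := H z w hz1 hw1 hz hw; have := cmodD (f (z, w) - f p) (f p).
      by rewrite subrK; lra.
    exact: nbhs_pinfty_ge (num_real _).
  by move=> [q M] /= [h hM] hq; apply: le_trans hM; exact: h.
- move=> M [_ HM]; exists (M + 1) => z w hz hw.
  have hp : cbidisk R (z, w) by apply/cbidiskE.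
  by apply: (HM (M + 1) _ (z, w) hp hp); rewrite ltrDl.
Qed.

(** Near-covering compactness, with the radius tending to 1 as parameter, makes the estimate
    uniform; half of [d] is spent on moving the point, half on dilating it. *)
Lemma within_cbidisk_radial (R : realType) (f : Cplx2 R -> Cplx R) :
  {within cbidisk R, continuous f} -> radially_continuous (fun z w => f (z, w)).
Proof.
move=> hf e e0; have e2 : 0 < e / 2 by rewrite divr_gt0.
have := (@compact_near_coveringP _ (cbidisk R)).1 (@compact_cbidisk R) R (nbhs (1 : R))
  (fun r p => r < 1 -> 0 <= r -> cbidisk R p -> cmod (f (r%:C * p.1, r%:C * p.2) - f p) <= e) _.
case.
- move=> p hp; have [d d0 H] := within_cbidiskP hf hp e2.
  have d2 : 0 < d / 2 by rewrite divr_gt0.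
  exists ([set q : Cplx2 R | cmod (q.1 - p.1) < d / 2 /\ cmod (q.2 - p.2) < d / 2],
    ball (1 : R) (d / 2)).
    split; last exact: nbhsx_ballx.
    by apply/nbhs_cmod2P; exists (d / 2).
  move=> [[z w] r] /= [[hz hw] hr] r1 r0 /cbidiskE[hz1 hw1].
  have hrx (x : R[i]) : cmod x <= 1 -> cmod (r%:C * x) <= 1.
    by move=> hx; rewrite cmodM cmod_real ger0_norm// mulr_ile1 ?cmod_ge0 ?(ltW r1).
  have hdx (x y : R[i]) : cmod x <= 1 -> cmod (x - y) < d / 2 -> cmod (r%:C * x - y) < d.
    move=> hx hxy; rewrite (_ : _ - _ = (x - y) - (1 - r)%:C * x); last by rewrite rmorphB rmorph1; ring.
    apply: le_lt_trans (cmodB _ _) _; rewrite cmodM cmod_real.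
    have : `|1 - r| * cmod x <= `|1 - r| by rewrite ler_piMr.
    have : `|1 - r| < d / 2 by exact: hr.
    lra.
  have h1 := H _ _ (hrx _ hz1) (hrx _ hw1) (hdx _ _ hz1 hz) (hdx _ _ hw1 hw).
  have h2 := H z w hz1 hw1 (lt_trans hz (_ : d / 2 < d)) (lt_trans hw (_ : d / 2 < d)).
  have {}h2 : cmod (f (z, w) - f p) < e / 2 by apply: h2; lra.
  rewrite (_ : _ - _ = (f (r%:C * z, r%:C * w) - f p) - (f (z, w) - f p)); last by ring.
  by apply: le_trans (cmodB _ _) _; lra.
- move=> d /= d0 Hd; exists (Num.max 0 (1 - d / 2)).
    rewrite le_max lexx gt_max ltr01 gtrBl divr_gt0//.
  move=> r z w; rewrite ge_max => /andP[/andP[r0 rd] r1] hz hw.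
  have hp : cbidisk R (z, w) by apply/cbidiskE.
  apply: (Hd r _ (z, w) hp r1 r0 hp).
  by rewrite /= ger0_norm ?subr_ge0 ?(ltW r1)//; lra.
Qed.

(** * Conclusion *)

Lemma derivable_cmod (R : realType) (f : Cplx2 R -> Cplx R) (p v : Cplx2 R) :
  derivable f p v -> forall e : R, 0 < e -> exists2 d : R, 0 < d &
    forall h : R[i], cmod h < d ->
      cmod (f ((h : Cplx R) *: v + p) - f p - 'D_v f p * h) <= e * cmod h.
Proof.
move=> hf e e0.
have cv : (fun h => h^-1 *: ((f \o shift p) (h *: v) - f p)) @ (0 : Cplx R)^' --> 'D_v f p.
  exact: hf.
have : nbhs ('D_v f p) [set y : Cplx R | cmod (y - 'D_v f p) < e] by apply/nbhs_cmodP; exists e.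
move=> /cv/nbhs_cmodP[d d0 H]; exists d => // h hd.
have [->|h0] := eqVneq h 0.
  by rewrite scale0r add0r subrr mulr0 subr0 cmod0 mulr0.
have := H h; rewrite subr0 => /(_ hd h0) /=; rewrite /shift /=.
set X := f _ - f p; set D := 'D_v f p.
change (cmod (h^-1 * (X : R[i]) - (D : R[i])) < e -> cmod ((X : R[i]) - (D : R[i]) * h) <= e * cmod h).
move: X D => X D {}H.
have -> : (X : R[i]) - D * h = (h^-1 * X - D) * h.
  by rewrite mulrBl mulrAC mulVf// mul1r.
by rewrite cmodM ler_wpM2r ?cmod_ge0// ltW.
Qed.

Lemma derivable_has_cderiv_l (R : realType) (f : Cplx2 R -> Cplx R) (z w : R[i]) :
  derivable f (z, w) (1, 0) ->
  has_cderiv (fun x => f (x, w)) z (partial_z f (z, w)).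
Proof.
move=> /derivable_cmod hf e e0; have [d d0 H] := hf e e0; exists d => // h hd.
have := H h hd.
have -> : (h : Cplx R) *: ((1, 0) : Cplx2 R) + (z, w) = (h * 1 + z, h * 0 + w) by [].
by rewrite mulr0 add0r mulr1 (addrC h).
Qed.

Lemma derivable_has_cderiv_r (R : realType) (f : Cplx2 R -> Cplx R) (z w : R[i]) :
  derivable f (z, w) (0, 1) ->
  has_cderiv (fun x => f (z, x)) w (partial_w f (z, w)).
Proof.
move=> /derivable_cmod hf e e0; have [d d0 H] := hf e e0; exists d => // h hd.
have := H h hd.
have -> : (h : Cplx R) *: ((0, 1) : Cplx2 R) + (z, w) = (h * 0 + z, h * 1 + w) by [].
by rewrite mulr0 add0r mulr1 (addrC h).
Qed.

(** The partial derivative coincides with its holomorphic extension [g] on a whole neighbourhood of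
    [p]. *)
Lemma Lipm_derivable (R : realType) m gamma (f : Cplx2 R -> Cplx R) s t p v :
  Lipm m gamma f -> (s + t <= m)%N -> bidisk R p -> derivable (partial s t f) p v.
Proof.
move=> [_ _ hf] hst hp; have [g [gh _ _] E] := hf s t hst.
apply: (@near_eq_derivable _ _ _ g); last by apply: diff_derivable; exact: gh.
have := nbhs_bidisk hp; apply: filterS => q hq; apply/esym/E.
by rewrite inE.
Qed.

Lemma powR_le1D (R : realType) (x gamma : R) : 0 <= x -> 0 <= gamma <= 1 -> x `^ gamma <= 1 + x.
Proof.
move=> x0 /andP[g0 g1]; have [x1|/ltW x1] := leP x 1.
  have : x `^ gamma <= 1 `^ gamma by apply: ge0_ler_powR; rewrite ?nnegrE.
  by rewrite powR1; lra.
by have := ler1_powR x1 g1; lra.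
Qed.

(** |h|^gamma = delta^gamma (|h| / delta)^gamma <= delta^gamma (1 + |h| / delta), and |h| is at most
    C |u - 1|. *)
Lemma Lip_circular_lip (R : realType) gamma (g : Cplx2 R -> Cplx R) :
  0 < gamma -> gamma <= 1 -> Lip gamma g -> circular_lip gamma (fun z w => g (z, w)).
Proof.
move=> g0 g1 [_ _ [L L0 hL]]; have [C C0 hC] := expi_surj R.
exists (L * (1 + C)); first by rewrite mulr_ge0 ?addr_ge0 ?ltW.
move=> delta u z w /andP[d0 d1] /hC[h uE hh] hz hw.
have hp : torus2 R (z, w) by [].
have {hL} := hL _ hp h; rewrite /= -uE => hL; apply: (le_trans hL).
rewrite -mulrA ler_pM2l//.
have -> : `|h| = delta * (`|h| / delta) by rewrite mulrCA divff ?mulr1// gt_eqF.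
rewrite powRM ?divr_ge0 ?(ltW d0)// mulrCA ler_pM2l ?powR_gt0//.
apply: le_trans (powR_le1D _ _) _; rewrite ?divr_ge0 ?(ltW d0) ?(ltW g0)//.
rewrite mulrDl mul1r mulrDr mulr1.
have : `|h| / delta <= C * (cmod (u - 1) / delta) by rewrite mulrA ler_pM2r ?invr_gt0.
have : 0 <= cmod (u - 1) / delta by rewrite divr_ge0 ?cmod_ge0 ?ltW.
lra.
Qed.

Lemma Lipm_approx (R : realType) m gamma (f : Cplx2 R -> Cplx R) :
  (2 <= m)%N -> 0 < gamma -> gamma <= 1 -> Lipm m gamma f ->
  exists2 C : R, 0 <= C & forall s, (0 < s)%N -> exists n c,
    (forall a b, c a b != 0 -> (a + b < s.*2.-1)%N) /\
    near_on 1 (C * (s%:R^-1 ^+ m * s%:R^-1 `^ gamma)) (fun z w => f (z, w)) (bipoly n c).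
Proof.
move=> m2 g0 g1 hf; have [_ fc hder] := hf.
pose d s t (z w : R[i]) : R[i] := partial s t f (z, w).
have hbi (z w : R[i]) : cmod z < 1 -> cmod w < 1 -> bidisk R (z, w) by split.
have dl s t z w : (s + t <= m)%N -> cmod z < 1 -> cmod w < 1 ->
    has_cderiv (d s t ^~ w) z (d s.+1 t z w).
  move=> hst hz hw; apply: derivable_has_cderiv_l.
  by apply: Lipm_derivable hf hst _; apply: hbi.
have dr t z w : (t <= m)%N -> cmod z < 1 -> cmod w < 1 ->
    has_cderiv (d 0%N t z) w (d 0%N t.+1 z w).
  move=> ht hz hw; apply: derivable_has_cderiv_r.
  by apply: (@Lipm_derivable _ _ _ _ 0 t _ _ hf ht); apply: hbi.
have bnd s t : (s + t <= m)%N -> exists B : R, forall z w, cmod z < 1 -> cmod w < 1 ->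
    cmod (d s t z w) <= B.
  move=> hst; have [g [_ gc _] E] := hder s t hst.
  have [B hB] := within_cbidisk_bounded gc; exists B => z w hz hw.
  by rewrite /d E ?hB ?(ltW hz) ?(ltW hw)// inE; apply: hbi.
(* The discrete Cauchy formula uses bounded second derivatives, hence [2 <= m]. *)
have fa r e : 0 <= r < 1 -> 0 < e -> exists n c, near_on r e (d 0%N 0%N) (bipoly n c).
  move=> hr e0; have [B0 hB0] := bnd 0%N 0%N (leq0n m).
  have [B1 hB1] := bnd 2%N 0%N m2; have [B2 hB2] := bnd 0%N 2%N m2.
  apply: (@bipoly_approx R (d 0%N 0%N) (d 1%N 0%N) (d 2%N 0%N) (d 0%N 1%N) (d 0%N 2%N)
    (Num.max B0 (Num.max B1 B2))) => // z w hz hw; last first.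
    by split; [apply: le_trans (hB0 z w hz hw) _ | apply: le_trans (hB1 z w hz hw) _
      | apply: le_trans (hB2 z w hz hw) _]; rewrite !le_max lexx ?orbT.
  have m1 := ltnW m2.
  by split; [exact: dl | exact: dl | exact: dr | exact: dr].
apply: total_degree_approx.
- exact: within_cbidisk_radial.
- exact: fa.
apply: regular_weight_degree => s t hst.
have [g gL E] := hder s t hst; have [_ gc _] := gL.
have [B hB] := within_cbidisk_bounded gc.
apply: (@regular_weight_ffact R gamma B _ (fun z w => g (z, w)) (d s t)) => //.
- exact: within_cbidisk_radial.
- exact: Lip_circular_lip.
- by move=> z w hz hw; rewrite /d E// inE; apply: hbi.
apply: (@deriv_approx R m d) => //.
- by move=> s' t' z w /ltnW; exact: dl.
- by move=> t' z w /ltnW; exact: dr.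
Qed.

Lemma triangle_bracket N : (0 < N)%N ->
  exists2 d, (0 < d)%N & ('C(d.+1, 2) <= N < 'C(d.+2, 2))%N.
Proof.
elim: N => // -[_ _|N IH _]; first by exists 1%N.
have [//|d d0 /andP[h1 h2]] := IH.
have [h|h] := ltnP N.+2 'C(d.+2, 2); first by exists d => //; rewrite h andbT ltnW.
exists d.+1 => //; rewrite h /= binS bin1; lia.
Qed.

(** With b the exponent, the left-hand side is (x^2)^(-b); since b >= 0, replacing x^2 by y costs
    6^b. *)
Lemma error_exponent (R : realType) (m : nat) (gamma x y : R) :
  0 < x -> 0 < y -> y <= 6 * x ^+ 2 -> 0 <= (m%:R + gamma - 3) / 2 ->
  x ^+ 3 * (x^-1 ^+ m * x^-1 `^ gamma)
  <= 6 `^ ((m%:R + gamma - 3) / 2) / y `^ ((m%:R + gamma - 3) / 2).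
Proof.
move=> x0 y0 hy; set b := (_ / 2) => b0.
rewrite ler_pdivlMr ?powR_gt0//.
have hyb : y `^ b <= (6 * x ^+ 2) `^ b.
  apply: ge0_ler_powR => //; rewrite nnegrE; first exact: ltW.
  by rewrite mulr_ge0// sqr_ge0.
have lhs0 : 0 <= x ^+ 3 * (x^-1 ^+ m * x^-1 `^ gamma).
  by rewrite !mulr_ge0 ?exprn_ge0 ?invr_ge0 ?powR_ge0 ?(ltW x0).
apply: le_trans (ler_wpM2l lhs0 hyb) _.
have x0' := ltW x0; have xn0 : x != 0 by rewrite gt_eqF.
rewrite powRM ?exprn_ge0// -!(powR_mulrn _ x0') exprVn -(powR_invn _ x0').
rewrite -(powR_inv1 x0') -!powRrM mulrCA -!powRD ?xn0 ?implybT//.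
by rewrite (_ : _ + _ = 0) ?powRr0 ?mulr1// /b; field.
Qed.

Theorem corollary3 (R : realType) (m : nat) (gamma : R)
    (eta theta : nat -> Cplx R) (f : Cplx2 R -> Cplx R) :
  (3 <= m)%N -> 0 < gamma -> gamma <= 1 ->
  leja (cdisk R) eta -> leja (cdisk R) theta ->
  Lipm m gamma f ->
  exists M : R, forall N : nat, (1 <= N)%N ->
    (sup_dist (cbidisk R) f
       (lagrange N (nodes (intertwining eta theta) N) f)
     <= (M / N%:R `^ ((m%:R + gamma - 3) / 2))%:E)%E.
Proof.
move=> m3 g0 g1 /leja_unit_leja he /leja_unit_leja ht hf.
have [C C0 hC] := Lipm_approx (ltnW m3) g0 g1 hf.
set b := (_ / 2).
have b0 : 0 <= b.
  have : 3 <= m%:R :> R by rewrite (ler_nat R 3 m).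
  by rewrite /b; lra.
(* 865 = 1 + 32 * 3^3, from 1 + 32 (d + 1)^3 with d + 1 <= 3 s. *)
exists (865 * C * 6 `^ b) => N N0.
apply: ge_ereal_sup => _ [[z w] /cbidiskE[hz hw] <-]; rewrite lee_fin.
have [d d0 /andP[h1 h2]] := triangle_bracket N0.
(* The largest s with 2 s - 1 <= d: the approximant then has total degree below d, the number of
   complete diagonals, and so lies in the polynomial space. *)
pose s := uphalf d; have s0 : (0 < s)%N by rewrite /s uphalf_gt0.
have sd : (s.*2.-1 <= d)%N by rewrite /s uphalfE; lia.
have ds : (d <= s.*2)%N by rewrite /s uphalfE; lia.
have [n [c [hc hQ]]] := hC s s0.
set e := C * _ in hQ.
have hP : poly_space N (fun p : Cplx2 R => bipoly n c p.1 p.2).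
  apply: bipoly_poly_space => a b' _ _ /hc hab; apply: degree_leq_rank h1 _.
  exact: leq_trans hab sd.
have := lagrange_near_best he ht h2 hP (fun z w hz hw => hQ z w hz hw) hz hw.
move=> h; apply: (le_trans h) => {h}.
have x1 : 1 <= s%:R :> R by rewrite ler1n.
have x0 : 0 < s%:R :> R by rewrite ltr0n.
have hd : d.+1%:R <= 3 * s%:R :> R.
  by rewrite -[3]/(3%:R) -natrM ler_nat; lia.
(* N < (d + 2) (d + 1) / 2 <= (s + 1) (2 s + 1), at most 6 s^2 for s >= 1. *)
have hN : N%:R <= 6 * s%:R ^+ 2 :> R.
  rewrite -[6]/(6%:R) -natrX -natrM ler_nat; apply: leq_trans (ltnW h2) _.
  rewrite bin2; nia.
have y0 : 0 < N%:R :> R by rewrite ltr0n.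
have := error_exponent x0 y0 hN b0; rewrite -/b => hE.
apply: le_trans (_ : (865 * s%:R ^+ 3) * e <= _).
  rewrite ler_wpM2r//.
    by rewrite mulr_ge0// mulr_ge0 ?powR_ge0// exprn_ge0// invr_ge0 ltW.
  have : d.+1%:R ^+ 3 <= (3 * s%:R) ^+ 3 :> R by apply: lerXn2r hd; rewrite nnegrE ?mulr_ge0.
  have : 1 <= s%:R ^+ 3 :> R by rewrite exprn_ege1.
  rewrite exprMn; lra.
rewrite /e mulrACA -[leRHS]mulrA.
exact: ler_wpM2l (mulr_ge0 (ler0n R 865) C0) _ _ hE.
Qed.
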